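(* Let $G$ be a finite simple graph with at least two edges, and let $k$ be a field. Assume that the Rees algebra $\mathcal{R}(G)$ of the edge ideal of $G$ over $k$ is normal. Then $\operatorname{reg}(\mathcal{R}(G)) = \nu(G)$ if and only if $G$ is a Tutte-Berge graph.
   Context: $G$ has vertex set $V(G)=[n]=\{1,\dots,n\}$ and edge set $E(G)$. The Rees algebra $\mathcal{R}(G)$ is the $k$-subalgebra of $k[x_1,\dots,x_n,t]$ generated by $x_1,\dots,x_n$ and the monomials $x_ix_jt$ with $\{i,j\}\in E(G)$. It is regarded as a standard graded $k$-algebra in which every one of these generators has degree $1$ (equivalently, $\mathcal{R}(G)$ is isomorphic to the toric ring of the cone graph $G^*$, generated by $x_ix_{n+1}$, $i\in[n]$, and $x_ix_j$, $\{i,j\}\in E(G)$, in degree $1$), and $\operatorname{reg}$ denotes Castelnuovo–Mumford regularity. $\nu(G)$ is the matching number of $G$ (maximum size of a set of pairwise disjoint edges). For $U\subseteq V(G)$, $N_G(U)$ is the set of vertices of $G$ adjacent to at least one vertex of $U$. A set $T\subseteq V(G)$ is independent if no edge of $G$ has both endpoints in $T$. $G$ is a Tutte-Berge graph if there exists an independent set $T$ of $G$ with $|T| = |N_G(T)| + |V(G)| - 2\nu(G)$. *)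

(* Defs.v *)
From HB Require Import structures.
From mathcomp Require Import all_boot all_order all_algebra.
From mathcomp Require Import fraction.
From mathcomp.multinomials Require Import mpoly.
Set Implicit Arguments. Unset Strict Implicit. Unset Printing Implicit Defensive.
Import Order.TTheory GRing.Theory Num.Theory.
Local Open Scope ring_scope.

Definition simple_graph (n : nat) (adj : rel 'I_n) : Prop :=
  ssrbool.symmetric adj /\ ssrbool.irreflexive adj.

Definition edges (n : nat) (adj : rel 'I_n) : {set {set 'I_n}} :=
  [set e : {set 'I_n} | [exists i, exists j, adj i j && (e == [set i; j])]].

Definition is_matching (n : nat) (adj : rel 'I_n) (M : {set {set 'I_n}}) : bool :=
  (M \subset edges adj) &&
  [forall e in M, forall f in M, (e != f) ==> [disjoint e & f]].

Definition matching_number (n : nat) (adj : rel 'I_n) : nat :=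
  \max_(M : {set {set 'I_n}} | is_matching adj M) #|M|.

Definition nbhd (n : nat) (adj : rel 'I_n) (U : {set 'I_n}) : {set 'I_n} :=
  [set v | [exists u in U, adj u v]].

Definition independent (n : nat) (adj : rel 'I_n) (T : {set 'I_n}) : bool :=
  [forall u in T, forall v in T, ~~ adj u v].

Definition tutte_berge_graph (n : nat) (adj : rel 'I_n) : Prop :=
  exists T : {set 'I_n}, independent adj T /\
    (#|T|%:Z = (#|nbhd adj T|)%:Z + n%:Z - 2%:Z * (matching_number adj)%:Z)%R.

Section Rees.
Variables (k : fieldType) (n : nat) (adj : rel 'I_n).

Definition xvar (i : 'I_n) : {mpoly k[n.+1]} := 'X_(widen_ord (leqnSn n) i).
Definition tvar : {mpoly k[n.+1]} := 'X_(ord_max).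

Definition nedges : nat := #|edges adj|.

Definition edge_mon (e : 'I_nedges) : {mpoly k[n.+1]} :=
  (\prod_(i in enum_val e) xvar i) * tvar.

(* The presentation ring S = k[y_1..y_n, z_e (e in E(G))], standard graded
   (every variable of degree 1), and the surjection S -> R(G) sending each
   variable to the corresponding degree-1 generator of R(G). *)
Definition rees_gen (v : 'I_(n + nedges)) : {mpoly k[n.+1]} :=
  match split v with inl i => xvar i | inr e => edge_mon e end.

Definition rees_pres (p : {mpoly k[n + nedges]}) : {mpoly k[n.+1]} :=
  mmap (@mpolyC n.+1 k) rees_gen p.

Definition rees_algebra (f : {mpoly k[n.+1]}) : Prop :=
  exists p, rees_pres p = f.

(* Its defining (toric) ideal, so that R(G) = S / rees_ideal as graded algebras. *)
Definition rees_ideal : pred {mpoly k[n + nedges]} :=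
  fun p => rees_pres p == 0.
End Rees.
Arguments rees_algebra k {n} adj _.
Arguments rees_ideal k {n} adj _.

Local Notation tofrac := (@FracField.tofrac _).
Local Notation "x %:F" := (@FracField.tofrac _ x).

Definition normal_subring (A : idomainType) (P : A -> Prop) : Prop :=
  forall q : {fraction A},
    (exists f g : A, [/\ P f, P g, g != 0 & q = f%:F / g%:F]) ->
    (exists p : {poly A}, [/\ p \is monic, (forall i, P p`_i) &
                             root (map_poly tofrac p) q]) ->
    exists f : A, P f /\ q = f%:F.

(* Graded finite free resolutions of S/J over S = {mpoly k[N]} with the
   standard grading, in row-vector convention:
     ... -> F_3 --M 1--> F_2 --M 0--> F_1 --N0--> F_0 = S(0) -> S/J -> 0
   F_(i+1) = (+)_j S(-sh i j), of rank rk i. *)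
Unset Implicit Arguments.
Record graded_free_res (k : fieldType) (N : nat) (J : pred {mpoly k[N]}) := GFRes {
  rk : nat -> nat;
  sh : forall i : nat, 'I_(rk i) -> nat;
  N0 : 'M[{mpoly k[N]}]_(rk 0, 1);
  M  : forall i : nat, 'M[{mpoly k[N]}]_(rk i.+1, rk i);
  res_finite : exists p, forall i, (p <= i)%N -> rk i = 0%N;
  N0_homog : forall j, N0 j ord0 \is (sh 0 j).-homog;
  M_homog : forall i a b, M i a b = 0 \/
     ((sh i b <= sh i.+1 a)%N /\ M i a b \is (sh i.+1 a - sh i b).-homog);
  exact0 : forall f, J f <-> exists u : 'rV_(rk 0), (u *m N0) ord0 ord0 = f;
  exact1 : forall u : 'rV_(rk 0), u *m N0 = 0 <-> exists v, u = v *m M 0;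
  exactS : forall i (u : 'rV_(rk i.+1)),
     u *m M i = 0 <-> exists v, u = v *m M i.+1
}.
Arguments rk {k N J} _ _.
Arguments sh {k N J} _ _ _.
Set Implicit Arguments.

(* max_{i,j} (shift - homological degree) of a resolution is <= r
   (homological degree of F_(i+1) is i+1; F_0 contributes 0 <= r). *)
Definition res_reg_le (k : fieldType) (N : nat) (J : pred {mpoly k[N]})
  (F : graded_free_res k N J) (r : nat) : Prop :=
  forall i (j : 'I_(rk F i)), (sh F i j <= r + i.+1)%N.

(* Castelnuovo-Mumford regularity of S/J: the minimum over graded finite free
   resolutions of max_{i,j} (b_{ij} shift - i); it is attained by the minimal
   graded free resolution, which is a direct summand of every other one. *)
Definition cm_regularity_eq (k : fieldType) (N : nat) (J : pred {mpoly k[N]})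
  (r : nat) : Prop :=
  (exists F : graded_free_res k N J, res_reg_le F r) /\
  (forall (F : graded_free_res k N J) (r' : nat), res_reg_le F r' -> (r <= r')%N).

(* Main.v *)
(**
  The regularity of a normal toric ring of dimension d equals d minus the least degree of a lattice
  point in the interior of its cone.  For a graded quotient R of a polynomial ring, having a finite
  graded free resolution with shifts at most r + i in step i is equivalent to the vanishing of the
  Koszul homology of R in degrees above r (dimension shifting; minimal generators give the
  converse).  In a fine degree, Koszul homology is compared with the Cech complex by a staircase
  argument, and the Cech complex in degree x is acyclic unless - x is interior, when its only
  cohomology is in degree d: this is a line shelling of the facets of the cone.

  For the Rees algebra, d = n + 1 and the point x_1 ... x_n t^b has degree n - b.  Let nu be the
  matching number.  If (1, ..., 1; nu) is not interior, a supporting weight function is tight on a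
  maximum matching, and the vertices of small weight form an independent set T with
  |T| = |N(T)| + n - 2 nu.  Conversely the facet functional of such a T forces interior points to
  have degree at least n + 1 - nu.  A point of degree n + 1 - nu is interior for every G with two
  edges.
*)

(* Regularity is defined through arbitrary resolutions, so both inequalities are routed through
   Koszul homology, which depends only on R. Everything stays at the level of elements: modules are
   predicates on ambient groups, and exactness at one spot replaces homology groups.

   The constant comes from a count. Koszul homology in position j with coefficients of degree e,
   seen in fine degree a, has wt a = e + j. A staircase of length d links it to a Cech class at a
   set F of j + d generators, which lives only if the sum of F minus a is interior; that point has
   degree (j + d) - (e + j) = d - e. Normality enters because the empty set is admissible in the
   Cech complex exactly at points of the cone, and these must be the exponents of R.

   For the Rees algebra d = n + 1, so the question is whether some interior lattice point has degree
   at most n - nu. With a single edge R is a polynomial ring of regularity 0 while nu = 1, hence the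
   bound on the number of edges. *)
Require Import Defs.
From HB Require Import structures.
From mathcomp Require Import all_boot all_order all_algebra.
From mathcomp Require Import fraction.
From mathcomp.multinomials Require Import mpoly.
From mathcomp Require Import ring lra zify.
From Stdlib Require Import Classical ClassicalEpsilon.
Set Implicit Arguments. Unset Strict Implicit. Unset Printing Implicit Defensive.
Import Order.TTheory GRing.Theory Num.Theory.

(** * Exterior algebra on set-indexed chains *)

Section Exterior.
Local Open Scope ring_scope.
Variables (N : nat) (Q : zmodType).
Local Notation chain := {ffun {set 'I_N} -> Q}.
Implicit Types (f : chain) (A E : {set 'I_N}) (g h : 'I_N).

(** Coefficients form only an additive group, so that one calculus serves scalars, polynomials, rows
    and chains of chains; signs are therefore Booleans. *)
Definition sgn (b : bool) (x : Q) : Q := if b then - x else x.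

Lemma sgnK b : involutive (sgn b).
Proof. by case: b => x //=; rewrite opprK. Qed.

Lemma sgn_sgn b c x : sgn b (sgn c x) = sgn (b (+) c) x.
Proof. by case: b c => [] [] //=; rewrite opprK. Qed.

Lemma sgn0 b : sgn b 0 = 0.
Proof. by case: b; rewrite //= oppr0. Qed.

Lemma sgnB b x y : sgn b (x - y) = sgn b x - sgn b y.
Proof. by case: b; rewrite //= opprB opprK addrC. Qed.

Lemma sgn_eq0 b x : (sgn b x == 0) = (x == 0).
Proof. by case: b; rewrite //= oppr_eq0. Qed.

Definition pos_in g A : bool := odd #|[set h in A | (h < g)%N]|.

Lemma pos_inU1 g h A : h \notin A -> pos_in g (h |: A) = pos_in g A (+) (h < g)%N.
Proof.
move=> hA; rewrite /pos_in; case: ltnP => hg.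
  have -> : [set h0 in h |: A | (h0 < g)%N] = h |: [set h0 in A | (h0 < g)%N].
    by apply/setP=> i; rewrite !inE; case: eqP => [->|] //=; rewrite hg.
  by rewrite cardsU1 inE (negPf hA) /= addbT.
have -> : [set h0 in h |: A | (h0 < g)%N] = [set h0 in A | (h0 < g)%N].
  apply/setP=> i; rewrite !inE; case: eqP => [->|] //=.
  by rewrite ltnNge hg andbF.
by rewrite addbF.
Qed.

Lemma pos_inU1id g A : pos_in g (g |: A) = pos_in g A.
Proof.
case gA: (g \in A); first by rewrite (setUidPr _) // sub1set.
by rewrite pos_inU1 ?gA // ltnn addbF.
Qed.

Lemma pos_inD1 g h A : h \in A -> pos_in g (A :\ h) = pos_in g A (+) (h < g)%N.
Proof.
move=> hA; rewrite -{2}(setD1K hA) pos_inU1 ?setD11 //.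
by rewrite -addbA addbb addbF.
Qed.

Lemma pos_inD1id g A : pos_in g (A :\ g) = pos_in g A.
Proof.
case gA: (g \in A); last by rewrite (setDidPl _) // disjoint_sym disjoints1 gA.
by rewrite pos_inD1 // ltnn addbF.
Qed.

Lemma ltn_neqb g h : g != h -> (h < g)%N = ~~ (g < h)%N.
Proof. by move=> gh; rewrite -leqNgt ltn_neqAle [(h == g :> nat)]eq_sym (inj_eq val_inj) gh. Qed.

(* Exterior multiplication by, and contraction with, the basis vector [g]. *)
Definition wedge g f : chain :=
  [ffun A : {set 'I_N} => if g \in A then sgn (pos_in g A) (f (A :\ g)) else 0].
Definition contr g f : chain :=
  [ffun A : {set 'I_N} => if g \in A then 0 else sgn (pos_in g A) (f (g |: A))].

Fact wedge_is_zmod_morphism g : zmod_morphism (wedge g).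
Proof. by move=> f f'; apply/ffunP=> A; rewrite !ffunE; case: ifP; rewrite ?sgnB ?subr0. Qed.
HB.instance Definition _ g := GRing.isZmodMorphism.Build chain chain (wedge g)
  (wedge_is_zmod_morphism g).

Fact contr_is_zmod_morphism g : zmod_morphism (contr g).
Proof. by move=> f f'; apply/ffunP=> A; rewrite !ffunE; case: ifP; rewrite ?sgnB ?subr0. Qed.
HB.instance Definition _ g := GRing.isZmodMorphism.Build chain chain (contr g)
  (contr_is_zmod_morphism g).

Lemma wedge_wedge g h f : wedge g (wedge h f) + wedge h (wedge g f) = 0.
Proof.
apply/ffunP=> A; rewrite !ffunE !inE.
have [<-|gh] := eqVneq g h; first by rewrite ?eqxx /=; case: (g \in A); rewrite /= ?sgn0 ?addr0.
case gA: (g \in A); case hA: (h \in A); rewrite /= ?sgn0 ?addr0 ?andbT ?andbF //.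
rewrite !sgn_sgn !pos_inD1 // (ltn_neqb gh) setDDl setUC -setDDl.
set x := f _; case: (pos_in g A); case: (pos_in h A); case: (g < h)%N;
  by rewrite /= ?addrN ?addNr.
Qed.

Lemma contr_contr g h f : contr g (contr h f) + contr h (contr g f) = 0.
Proof.
apply/ffunP=> A; rewrite !ffunE !inE.
have [<-|gh] := eqVneq g h; first by rewrite ?eqxx /=; case: (g \in A); rewrite /= ?sgn0 ?addr0.
case gA: (g \in A); case hA: (h \in A); rewrite /= ?sgn0 ?addr0 ?orbT ?orbF //=; rewrite ?sgn0 //.
rewrite !sgn_sgn !pos_inU1 ?gA ?hA // (ltn_neqb gh) setUCA.
set x := f _; case: (pos_in g A); case: (pos_in h A); case: (g < h)%N;
  by rewrite /= ?addrN ?addNr.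
Qed.

(** With [contr_wedgeN] this is the Clifford relation, the source of the contracting homotopies
    [contr_cobd] and [bd_wedge]. *)
Lemma contr_wedge g f : contr g (wedge g f) + wedge g (contr g f) = f.
Proof.
apply/ffunP=> A; rewrite !ffunE !inE eqxx /=.
case gA: (g \in A).
  by rewrite add0r pos_inD1id sgnK setD1K.
by rewrite addr0 pos_inU1id sgnK setU1K ?gA.
Qed.

Lemma contr_wedgeN g h f : g != h -> contr g (wedge h f) + wedge h (contr g f) = 0.
Proof.
move=> gh; apply/ffunP=> A; rewrite !ffunE !inE (negPf gh) /= eq_sym (negPf gh) /=.
case gA: (g \in A); case hA: (h \in A); rewrite /= ?sgn0 ?addr0 //.
rewrite !sgn_sgn pos_inU1 ?gA // pos_inD1 //.
have -> : (g |: A) :\ h = g |: A :\ h.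
  apply/setP=> i; rewrite !inE; have [->|//] := eqVneq i g; by rewrite gh.
rewrite (ltn_neqb gh); set x := f _.
by case: (pos_in g A); case: (pos_in h A); case: (g < h)%N; rewrite /= ?addrN ?addNr.
Qed.

End Exterior.

Section Antisym.
Local Open Scope ring_scope.
(** The diagonal has its own hypothesis because in characteristic 2 antisymmetry says nothing about
    it. *)
Lemma sum_antisym (V : zmodType) (I : eqType) (r : seq I) (P : pred I) (s : I -> I -> V) :
  (forall g h, s g h + s h g = 0) -> (forall g, s g g = 0) ->
  \sum_(g <- r | P g) \sum_(h <- r | P h) s g h = 0.
Proof.
move=> sN s0; rewrite -big_filter; under eq_bigr do rewrite -big_filter.
elim: [seq _ <- r | P _] => [|a l IH]; first by rewrite big_nil.
rewrite big_cons big_cons s0 add0r.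
under [X in _ + X]eq_bigr do rewrite big_cons.
by rewrite big_split /= IH addr0 -big_split big1 //= => i _.
Qed.
End Antisym.

Section Differentials.
Local Open Scope ring_scope.
Variables (N : nat) (Q : zmodType).
Local Notation chain := {ffun {set 'I_N} -> Q}.
Implicit Types (f : chain) (A E : {set 'I_N}) (g h : 'I_N).

Definition cobd E f : chain := \sum_(g in E) wedge g f.

Fact cobd_is_zmod_morphism E : zmod_morphism (cobd E).
Proof.
by move=> f f'; rewrite /cobd -sumrB; apply: eq_bigr => g _; rewrite raddfB.
Qed.
HB.instance Definition _ E := GRing.isZmodMorphism.Build chain chain (cobd E)
  (cobd_is_zmod_morphism E).

Lemma cobdE E f A :
  cobd E f A = \sum_(g in E | g \in A) sgn (pos_in g A) (f (A :\ g)).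
Proof.
rewrite /cobd sum_ffunE big_mkcondr; apply: eq_bigr => g _.
by rewrite ffunE.
Qed.

Lemma cobd_cobd E f : cobd E (cobd E f) = 0.
Proof.
rewrite /cobd; under eq_bigr do rewrite raddf_sum.
apply: sum_antisym => [g h|g]; first exact: wedge_wedge.
apply/ffunP=> A; rewrite !ffunE setD11; case: ifP => // _; exact: sgn0.
Qed.

Lemma contr_cobd E g f : g \in E -> contr g (cobd E f) + cobd E (contr g f) = f.
Proof.
move=> gE; rewrite /cobd raddf_sum -big_split /= (bigD1 g) //= contr_wedge big1 ?addr0 //.
by move=> h /andP[_ hg]; rewrite contr_wedgeN // eq_sym.
Qed.

Definition bd f : chain := \sum_g contr g f.

Fact bd_is_zmod_morphism : zmod_morphism bd.
Proof. by move=> f f'; rewrite /bd -sumrB; apply: eq_bigr => g _; rewrite raddfB. Qed.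
HB.instance Definition _ := GRing.isZmodMorphism.Build chain chain bd bd_is_zmod_morphism.

Lemma bdE f A :
  bd f A = \sum_(g | g \notin A) sgn (pos_in g A) (f (g |: A)).
Proof.
rewrite /bd sum_ffunE [RHS]big_mkcond; apply: eq_bigr => g _.
by rewrite ffunE; case: (g \in A).
Qed.

Lemma bd_bd f : bd (bd f) = 0.
Proof.
rewrite /bd; under eq_bigr do rewrite raddf_sum.
apply: sum_antisym => [g h|g]; first exact: contr_contr.
apply/ffunP=> A; rewrite !ffunE setU11; case: ifP => // _; exact: sgn0.
Qed.

Lemma bd_wedge g f : bd (wedge g f) + wedge g (bd f) = f.
Proof.
rewrite /bd raddf_sum -big_split /= (bigD1 g) //= contr_wedge big1 ?addr0 //.
by move=> h hg; rewrite contr_wedgeN.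
Qed.

Definition has_card (p : nat) f := forall A, f A != 0 -> #|A| = p.

End Differentials.

Section Cmap.
Local Open Scope ring_scope.
Variables (N : nat) (Q Q' : zmodType) (phi : {additive Q -> Q'}).
Definition cmap (f : {ffun {set 'I_N} -> Q}) : {ffun {set 'I_N} -> Q'} :=
  [ffun A => phi (f A)].
Fact cmap_is_zmod_morphism : zmod_morphism cmap.
Proof. by move=> f f'; apply/ffunP=> A; rewrite !ffunE raddfB. Qed.
HB.instance Definition _ := GRing.isZmodMorphism.Build _ _ cmap cmap_is_zmod_morphism.

Lemma raddf_sgn b x : phi (sgn b x) = sgn b (phi x).
Proof. by case: b; rewrite //= raddfN. Qed.

Lemma contr_cmap g f : contr g (cmap f) = cmap (contr g f).
Proof. by apply/ffunP=> A; rewrite !ffunE; case: ifP; rewrite ?raddf0 ?raddf_sgn. Qed.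
Lemma bd_cmap f : bd (cmap f) = cmap (bd f).
Proof. by rewrite /bd raddf_sum; apply: eq_bigr => g _; rewrite contr_cmap. Qed.
End Cmap.

(** * Cech complexes of polyhedral cones *)

Section SetFamilies.
Local Open Scope ring_scope.
Variables (N : nat) (k : zmodType).
Local Notation chain := {ffun {set 'I_N} -> k}.
Implicit Types (E A : {set 'I_N}) (U : pred {set 'I_N}) (c b : chain).

Definition supp_in U p c := forall A, c A != 0 -> U A && (#|A| == p).
(* Same as [supp_in U p.-1], except that no junk chain is allowed when [p = 0]. *)
Definition supp_pred U p c := forall A, c A != 0 -> U A && (#|A|.+1 == p).
Definition exact_at E U p :=
  forall c, supp_in U p c -> cobd E c = 0 -> exists2 b, supp_pred U p b & cobd E b = c.

Definition upclosed E U := forall A g, g \in E -> U A -> U (g |: A).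

Lemma supp_inB U p c c' : supp_in U p c -> supp_in U p c' -> supp_in U p (c - c').
Proof.
move=> h h' A; rewrite !ffunE; have [->|/h//] := eqVneq (c A) 0.
by rewrite sub0r oppr_eq0; apply: h'.
Qed.

Lemma supp_in_cobd E U p c : upclosed E U -> supp_in U p c -> supp_in U p.+1 (cobd E c).
Proof.
move=> up h A; rewrite cobdE; apply: contraNT => HA; apply/eqP.
apply: big1 => g /andP[gE gA]; apply/eqP; rewrite sgn_eq0; apply: contraNT HA => /h /andP[h1 h2].
by rewrite -(setD1K gA) up //= cardsU1 setD11 add1n eqSS.
Qed.

Lemma supp_pred0 U c : supp_pred U 0 c -> c = 0.
Proof.
move=> h; apply/ffunP=> A; rewrite ffunE; apply: contraTeq isT => /h.
by rewrite andbF.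
Qed.

(** For an upward closed U', the members not contained in E0 span a subcomplex; [restr] is the
    projection onto the quotient complex, whose differential is [cobd E0]. *)
Definition restr E0 c : chain := [ffun A : {set 'I_N} => if A \subset E0 then c A else 0].

Lemma cobd_restr E E0 c : E0 \subset E -> cobd E0 (restr E0 c) = restr E0 (cobd E c).
Proof.
move=> sE; apply/ffunP=> A; rewrite !ffunE !cobdE.
case: ifP => AE0.
  have AE := subset_trans AE0 sE.
  have eqP1 : forall g, (g \in E) && (g \in A) = (g \in E0) && (g \in A).
    by move=> g; case gA: (g \in A); rewrite ?andbF // (subsetP AE) // (subsetP AE0).
  rewrite (eq_bigl _ _ eqP1); apply: eq_bigr => g _.
  by rewrite ffunE (subset_trans (subD1set _ _) AE0).
apply: big1 => g /andP[gE0 gA]; rewrite ffunE; case: ifP => // h; rewrite ?sgn0 //.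
by move: AE0; rewrite -(setD1K gA) subUset sub1set gE0 h.
Qed.

(** Long exact sequence of 0 -> C(U) -> C(U') -> C(U0) -> 0, at the stretch from degree q of U0 to
    degree q + 1 of U and U'. *)
Lemma exact_step E E0 U U' U0 q : E0 \subset E -> upclosed E U' ->
  (forall A, U A = U' A && ~~ (A \subset E0)) ->
  (forall A, U0 A = U' A && (A \subset E0)) ->
  exact_at E U' q.+1 -> exact_at E0 U0 q -> exact_at E U q.+1.
Proof.
move=> sE up UE U0E ex' ex0 c cU cc.
have [b bU' bc] : exists2 b, supp_pred U' q.+1 b & cobd E b = c.
  by apply: ex' => // A /cU; rewrite UE => /andP[/andP[-> _]].
have rc : restr E0 c = 0.
  apply/ffunP=> A; rewrite !ffunE; case: ifP => // s; apply: contraTeq isT => /cU.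
  by rewrite UE s andbF.
have [y yU0 yb] : exists2 y, supp_pred U0 q y & cobd E0 y = restr E0 b.
  apply: ex0; last by rewrite (cobd_restr _ sE) bc.
  move=> A; rewrite ffunE; case: ifP; rewrite ?eqxx // => s /bU'.
  by rewrite U0E s andbT eqSS.
have ry : restr E0 y = y.
  apply/ffunP=> A; rewrite ffunE; case: ifP => // s; apply/esym; apply: contraFeq s => /yU0.
  by rewrite U0E => /andP[/andP[]].
(* A primitive of c in U' is corrected by a coboundary so that its restriction to E0 vanishes. *)
exists (b - cobd E y); last by rewrite raddfB /= bc cobd_cobd subr0.
have yU' : supp_pred U' q.+1 (cobd E y).
  case: q ex' ex0 cU bU' yU0 => [|q] _ _ _ _ yU0; first by rewrite (supp_pred0 yU0) raddf0 => A; rewrite ffunE eqxx.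
  have /(supp_in_cobd up) h : supp_in U' q y.
    by move=> A /yU0; rewrite U0E eqSS => /andP[/andP[-> _]].
  by move=> A /h; rewrite eqSS.
move=> A h; rewrite UE -andbA [~~ _ && _]andbC andbA.
have -> : U' A && (#|A|.+1 == q.+1).
  move: h; rewrite !ffunE; have [->|/bU'//] := eqVneq (b A) 0.
  by rewrite sub0r oppr_eq0; apply: yU'.
apply: contra h => s.
have := congr1 (fun f : chain => f A) (cobd_restr y sE).
by rewrite ry yb [RHS]ffunE s [LHS]ffunE s 2!ffunE => ->; rewrite subrr.
Qed.

(** Nothing precedes degree 0, so exactness there means that no nonzero cocycle exists, a property
    inherited by smaller families. *)
Lemma exact_step0 E U U' :
  (forall A, U A -> U' A) -> exact_at E U' 0 -> exact_at E U 0.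
Proof.
move=> sU ex c cU cc; have [b /supp_pred0 -> <-] : exists2 b, supp_pred U' 0 b & cobd E b = c.
  by apply: ex => // A /cU /andP[/sU -> ->].
by exists 0; rewrite ?raddf0 // => A; rewrite ffunE eqxx.
Qed.

(** Same long exact sequence; contraposed, it carries a nonzero class of the face to one of the
    whole cone, one degree higher. *)
Lemma exact_step_conv E E0 U U' U0 q : E0 \subset E -> upclosed E U' ->
  (forall A, U A = U' A && ~~ (A \subset E0)) ->
  (forall A, U0 A = U' A && (A \subset E0)) ->
  exact_at E U' q -> exact_at E U q.+1 -> exact_at E0 U0 q.
Proof.
move=> sE up UE U0E ex' ex c0 c0U cc.
have c0U' : supp_in U' q c0 by move=> A /c0U; rewrite U0E => /andP[/andP[-> _] ->].
have rc0 : restr E0 c0 = c0.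
  apply/ffunP=> A; rewrite ffunE; case: ifP => // s; apply/esym; apply: contraFeq s => /c0U.
  by rewrite U0E => /andP[/andP[]].
have [b bU bc] : exists2 b, supp_pred U q.+1 b & cobd E b = cobd E c0.
  apply: ex; last by rewrite cobd_cobd.
  move=> A h; rewrite UE -andbA [~~ _ && _]andbC andbA (supp_in_cobd up c0U') //=.
  apply: contra h => s.
  have := congr1 (fun f : chain => f A) (cobd_restr c0 sE).
  by rewrite rc0 cc [RHS]ffunE s ffunE => <-.
have [y yU' yc] : exists2 y, supp_pred U' q y & cobd E y = c0 - b.
  apply: ex'; last by rewrite raddfB /= bc subrr.
  by apply: supp_inB => // A /bU; rewrite UE eqSS => /andP[/andP[-> _]].
exists (restr E0 y).
  move=> A; rewrite ffunE; case: ifP => s; rewrite ?eqxx // => /yU'.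
  by rewrite U0E s andbT.
rewrite (cobd_restr _ sE) yc; apply/ffunP=> A; rewrite -[in RHS]rc0 !ffunE.
case: ifP => // s; suff -> : b A = 0 by rewrite subr0.
by apply: contraTeq s => /bU; rewrite UE => /andP[/andP[]].
Qed.

Lemma exact_full E p : E != set0 -> exact_at E (fun A => A \subset E) p.
Proof.
case/set0Pn => g gE c cU cc; exists (contr g c).
  move=> A; rewrite ffunE; case: ifP => gA; rewrite ?eqxx // sgn_eq0 => /cU.
  by rewrite subUset sub1set gE /= cardsU1 gA.
by have := contr_cobd c gE; rewrite cc raddf0 add0r.
Qed.

End SetFamilies.

Section Generic.
Local Open Scope ring_scope.

Lemma positive_nonroot (p : {poly rat}) : p != 0 -> exists2 s, 0 < s & p.[s] != 0.
Proof.
move=> p0.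
pose rs := [seq (i.+1)%:R : rat | i <- iota 0 (size p)].
have u : uniq rs.
  rewrite map_inj_in_uniq ?iota_uniq // => i j _ _ /eqP.
  by rewrite eqr_nat eqSS => /eqP.
have : ~~ all (root p) rs.
  by apply/negP=> /(max_poly_roots p0) /(_ u); rewrite size_map size_iota ltnn.
case/allPn => s /mapP[i _ ->] h; exists (i.+1)%:R; rewrite ?ltr0n //.
Qed.

Lemma positive_common_nonroot (I : finType) (P : I -> {poly rat}) :
  exists2 s, 0 < s & forall i, P i != 0 -> (P i).[s] != 0.
Proof.
have : \prod_(i | P i != 0) P i != 0 by apply/prodf_neq0.
case/positive_nonroot => s s0; rewrite horner_prod => /prodf_neq0 h.
by exists s.
Qed.

End Generic.

Section Cech.
Local Open Scope ring_scope.
Variables (k : fieldType) (N d M : nat) (G : 'M[rat]_(N, d)) (L : 'M[rat]_(d, M)).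
Local Notation chain := {ffun {set 'I_N} -> k}.
Implicit Types (E A : {set 'I_N}) (x y z : 'rV[rat]_d) (g h : 'I_N) (j : 'I_M).

Definition lv x j := (x *m L) 0 j.
Definition gv g j := lv (row g G) j.
Definition span_mx E : 'M[rat]_(N, d) := \matrix_(g, i) (if g \in E then G g i else 0).
Definition conic E y := exists c : 'I_N -> rat,
  (forall g, 0 <= c g) /\ y = \sum_(g in E) c g *: row g G.
(** On the span of E the functionals of L cut out exactly the cone of E. Asking this inside the span
    only lets the property pass to faces. *)
Definition saturated E := forall y, (y <= span_mx E)%MS -> (forall j, 0 <= lv y j) -> conic E y.
(* The sets [A] such that [x] lies in the localization of the cone of [E] at the generators in
   [A]: they index the degree [x] part of the Cech complex. *)
Definition adm E x : pred {set 'I_N} := fun A => (A \subset E) &&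
  [forall j, (lv x j < 0) ==> [exists g in A, 0 < gv g j]].
(* [- x] is in the relative interior of the cone of [E]. *)
Definition negative E x := [forall j, [exists g in E, gv g j != 0] ==> (lv x j < 0)].

Hypothesis gv_ge0 : forall g j, 0 <= gv g j.
Hypothesis gv_pointed : forall g, exists j, 0 < gv g j.

Lemma lvD x y j : lv (x + y) j = lv x j + lv y j.
Proof. by rewrite /lv mulmxDl mxE. Qed.
Lemma lvZ t x j : lv (t *: x) j = t * lv x j.
Proof. by rewrite /lv -scalemxAl mxE. Qed.
Lemma lvN x j : lv (- x) j = - lv x j.
Proof. by rewrite /lv mulNmx mxE. Qed.
Lemma lv_sum (I : Type) (r : seq I) (P : pred I) (F : I -> 'rV[rat]_d) j :
  lv (\sum_(i <- r | P i) F i) j = \sum_(i <- r | P i) lv (F i) j.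
Proof. by rewrite /lv mulmx_suml summxE. Qed.

Lemma row_span_mx E g : g \in E -> (row g G <= span_mx E)%MS.
Proof.
move=> gE; have -> : row g G = row g (span_mx E); last exact: row_sub.
by apply/rowP=> i; rewrite !mxE gE.
Qed.

Lemma span_mxP E y : reflect (exists c : 'I_N -> rat, y = \sum_(g in E) c g *: row g G)
  (y <= span_mx E)%MS.
Proof.
apply: (iffP idP) => [/submxP[c ->]|[c ->]]; last first.
  by apply: summx_sub => g gE; apply: scalemx_sub; apply: row_span_mx.
exists (c 0); rewrite mulmx_sum_row (bigID (mem E)) /= [X in _ + X]big1 ?addr0.
  apply: eq_bigr => g gE; congr (_ *: _); apply/rowP=> i; by rewrite !mxE gE.
move=> g gE; rewrite (_ : row g _ = 0) ?scaler0 //; apply/rowP=> i.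
by rewrite !mxE (negPf gE).
Qed.

Lemma conic_span E y : conic E y -> (y <= span_mx E)%MS.
Proof. by case=> c [_ ->]; apply/span_mxP; exists c. Qed.

Lemma span_mxS E E0 : E0 \subset E -> (span_mx E0 <= span_mx E)%MS.
Proof.
move=> sE; apply/row_subP=> g.
have -> : row g (span_mx E0) = if g \in E0 then row g G else 0.
  by apply/rowP=> i; rewrite !mxE; case: ifP; rewrite mxE.
case: ifP => [gE|_]; last exact: sub0mx.
by apply: row_span_mx; apply: (subsetP sE).
Qed.

Lemma lv_span0 E y j : (y <= span_mx E)%MS -> (forall g, g \in E -> gv g j = 0) -> lv y j = 0.
Proof.
case/span_mxP=> c -> h; rewrite lv_sum big1 // => g gE.
by rewrite lvZ -/(gv g j) h // mulr0.
Qed.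

Definition face E j := [set g in E | gv g j == 0].

Lemma face_sub E j : face E j \subset E.
Proof. by apply/subsetP=> g; rewrite inE => /andP[]. Qed.

Lemma conic_face E y j : conic E y -> lv y j = 0 -> conic (face E j) y.
Proof.
case=> c [c0 ->] h; exists c; split => //.
have h' : \sum_(g in E) c g * gv g j = 0.
  by rewrite -[RHS]h lv_sum; apply: eq_bigr => g _; rewrite lvZ.
have := psumr_eq0P _ h' => /(_ (fun g _ => mulr_ge0 (c0 g) (gv_ge0 g j))) h2.
rewrite (bigID (fun g => gv g j == 0)) /= [X in _ + X]big1 ?addr0.
  by apply: eq_bigl => g; rewrite inE.
move=> g /andP[gE ngj]; have /eqP := h2 g gE.
by rewrite mulf_eq0 (negPf ngj) orbF => /eqP ->; rewrite scale0r.
Qed.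

Lemma saturated_face E j : saturated E -> saturated (face E j).
Proof.
move=> sat y ys y0; apply: conic_face; first apply: sat => //.
  by apply: submx_trans ys (span_mxS (face_sub E j)).
by apply: lv_span0 ys _ => g; rewrite inE => /andP[_ /eqP].
Qed.

(** With weights c g = s^g each pair (j, j') yields a polynomial in s, whose coefficients vanish
    exactly in the first alternative; a single positive s avoids the roots of all the nonzero
    ones. *)
Lemma generic_interior E x : exists c : 'I_N -> rat, (forall g, 0 < c g) /\
  forall j j', (forall g, g \in E -> lv x j * gv g j' = lv x j' * gv g j) \/
   lv x j * lv (\sum_(g in E) c g *: row g G) j' !=
   lv x j' * lv (\sum_(g in E) c g *: row g G) j.
Proof.
pose cf (jj : 'I_M * 'I_M) g := lv x jj.1 * gv g jj.2 - lv x jj.2 * gv g jj.1.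
pose P (jj : 'I_M * 'I_M) : {poly rat} := \sum_(g in E) cf jj g *: 'X^g.
have [s s0 sP] := positive_common_nonroot P.
exists (fun g => s ^+ g); split => [g|j j']; first exact: exprn_gt0.
have [P0|/sP Pn] := eqVneq (P (j, j')) 0.
  left=> g gE; apply/eqP; rewrite -subr_eq0; apply/eqP.
  have := congr1 (fun p : {poly rat} => p`_g) P0.
  rewrite coef0 coef_sum (bigD1 g) //= coefZ coefXn eqxx mulr1 big1 ?addr0 //.
  move=> h /andP[_ hg]; rewrite coefZ coefXn (inj_eq val_inj) eq_sym (negPf hg).
  by rewrite mulr0.
right; rewrite -subr_eq0; move: Pn; congr (_ != _).
rewrite !lv_sum !mulr_sumr -sumrB horner_sum; apply: eq_bigr => g _.
by rewrite hornerZ hornerXn !lvZ /cf /=; rewrite -!/(gv _ _); ring.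
Qed.

Lemma adm_up E x : upclosed E (adm E x).
Proof.
move=> A g gE /andP[AE /forallP h]; apply/andP; split.
  by rewrite subUset sub1set gE.
apply/forallP=> j; apply/implyP=> xj; have /implyP/(_ xj)/existsP[h0 /andP[hA hj]] := h j.
by apply/existsP; exists h0; rewrite inE hA orbT.
Qed.

Definition visible x := [set j | lv x j < 0].

(* Line shelling: pushing [x] along a generic interior direction until the first visible facet
   stops being visible at [x'] splits the Cech complex of [(E, x')] into those of [(E, x)] and of
   [(face E j0, x')].  Genericity of the direction makes ties occur only between functionals
   cutting out the same face. *)
Lemma facet_removal E x jv : saturated E -> (x <= span_mx E)%MS -> lv x jv < 0 ->
  exists x' j0, let E0 := face E j0 in
  [/\ [/\ (x' <= span_mx E)%MS, E0 \proper E & (#|visible x'| < #|visible x|)%N],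
      (forall A, adm E x A = adm E x' A && ~~ (A \subset E0)),
      (forall A, adm E0 x' A = adm E x' A && (A \subset E0)),
      ~~ negative E x' &
      if (x' <= span_mx E0)%MS then negative E0 x' = negative E x
      else (forall A, ~~ adm E0 x' A) /\ ~~ negative E x] /\
  (negative E x -> \rank (span_mx E) = (\rank (span_mx E0)).+1).
Proof.
move=> sat xE xjv.
have [c [c0 gen]] := generic_interior E x; move: gen.
set z := \sum_(g in E) _ => gen.
have lvz j : lv z j = \sum_(g in E) c g * gv g j.
  by rewrite lv_sum; apply: eq_bigr => g _; rewrite lvZ.
have z_ge0 j : 0 <= lv z j.
  by rewrite lvz; apply: sumr_ge0 => g _; rewrite mulr_ge0 // ltW.
have z_gt0 j g : g \in E -> gv g j != 0 -> 0 < lv z j.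
  move=> gE gj; rewrite lvz (bigD1 g) //= ltr_wpDr //.
    by apply: sumr_ge0 => h _; rewrite mulr_ge0 // ltW.
  by rewrite mulr_gt0 // lt_def gj gv_ge0.
have zE : (z <= span_mx E)%MS by apply/span_mxP; exists c.
have vis_nz j : lv x j < 0 -> exists2 g, g \in E & gv g j != 0.
  move=> xj; have [/existsP[g /andP[gE gj]]|] := boolP [exists g in E, gv g j != 0].
    by exists g.
  move/existsPn=> h; move: xj; rewrite (lv_span0 xE) ?ltxx // => g gE.
  by have := h g; rewrite gE /= negbK => /eqP.
have vis_z j : lv x j < 0 -> 0 < lv z j by case/vis_nz=> g; apply: z_gt0.
(* [q j] is the time at which x + t z crosses the facet j, and j0 is a facet crossed first. *)
pose q j := - lv x j / lv z j.
case: (@arg_minP _ _ _ jv (fun j => lv x j < 0) q xjv) => j0 xj0 min_j0.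
have zj0 := vis_z _ xj0.
set t := q j0 in min_j0.
have t0 : 0 < t by rewrite divr_gt0 // oppr_gt0.
have tz : t * lv z j0 = - lv x j0 by rewrite /t /q divfK // gt_eqF.
pose x' := x + t *: z.
have x'E j : lv x' j = lv x j + t * lv z j by rewrite lvD lvZ.
have x'span : (x' <= span_mx E)%MS by rewrite addmx_sub // scalemx_sub.
have x'j0 : lv x' j0 = 0 by rewrite x'E tz subrr.
have le_x' j : lv x j < 0 -> lv x' j <= 0.
  move=> xj; have := min_j0 _ xj; rewrite /q ler_pdivlMr ?vis_z // x'E => h.
  by rewrite -(opprK (lv x j)) addrC subr_le0.
have vis' j : lv x' j < 0 -> lv x j < 0.
  by apply: le_lt_trans; rewrite x'E lerDl mulr_ge0 // ltW.
(* Functionals that vanish together with j0 are proportional to it on E by the choice of z, hence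
   cut out the same face. *)
have tie j : lv x j < 0 -> lv x' j = 0 -> forall g, g \in E -> lv x j * gv g j0 = lv x j0 * gv g j.
  move=> xj x'j; have [//|/eqP[]] := gen j j0.
  have -> : lv x j = - (t * lv z j) by apply/eqP; rewrite -addr_eq0 -x'E x'j.
  by rewrite -[lv x j0]opprK -tz; ring.
have tie_face j : lv x j < 0 -> lv x' j = 0 -> face E j = face E j0.
  move=> xj x'j; apply/setP=> g; rewrite !inE; case gE: (g \in E) => //=.
  have := tie j xj x'j g gE => h; apply/eqP/eqP => h0; move/eqP: h; rewrite h0 mulr0 ?[0 == _]eq_sym mulf_eq0 lt_eqF //= => /eqP //.
have properE0 : face E j0 \proper E.
  have [g gE gj] := vis_nz _ xj0.
  apply/properP; split; first exact: face_sub.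
  by exists g => //; rewrite inE gE.
have vis_lt : (#|visible x'| < #|visible x|)%N.
  apply: proper_card; apply/properP; split.
    by apply/subsetP=> j; rewrite !inE; apply: vis'.
  by exists j0; rewrite !inE // x'j0 ltxx.
have admE A : adm E x A = adm E x' A && ~~ (A \subset face E j0).
  rewrite /adm; case AE: (A \subset E) => //=; apply/idP/andP => [/forallP h|[/forallP h nA]].
    split; first by apply/forallP=> j; apply/implyP=> /vis' xj; apply: (implyP (h j)).
    have /implyP/(_ xj0)/existsP[g /andP[gA gj]] := h j0.
    apply/negP=> /subsetP/(_ g gA); rewrite inE => /andP[_ /eqP g0].
    by rewrite g0 ltxx in gj.
  apply/forallP=> j; apply/implyP=> xj; have := le_x' j xj; rewrite le_eqVlt => /orP[/eqP x'j|x'j].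
    case/subsetPn: nA => g gA; rewrite -(tie_face j xj x'j) inE (subsetP AE) //= => gj.
    by apply/existsP; exists g; rewrite gA lt_def gj gv_ge0.
  exact: (implyP (h j)).
have adm0E A : adm (face E j0) x' A = adm E x' A && (A \subset face E j0).
  rewrite /adm; case AE: (A \subset face E j0) => /=; last by rewrite andbF.
  by rewrite (subset_trans AE (face_sub _ _)) andbT.
have nneg' : ~~ negative E x'.
  have [g gE gj] := vis_nz _ xj0.
  rewrite negb_forall; apply/existsP; exists j0; rewrite negb_imply x'j0 ltxx andbT.
  by apply/existsP; exists g; rewrite gE.
have neg_x j : negative E x -> 0 <= - lv x' j.
  move/forallP/(_ j)/implyP=> h; rewrite oppr_ge0.
  have [|/existsPn h'] := boolP [exists g in E, gv g j != 0]; first by move/h/le_x'.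
  rewrite (lv_span0 x'span) // => g gE.
  by have := h' g; rewrite gE /= negbK => /eqP.
have neg_span : negative E x -> (x' <= span_mx (face E j0))%MS.
  move=> neg; rewrite -eqmx_opp; apply: conic_span; apply: conic_face; last by rewrite lvN x'j0 oppr0.
  by apply: sat; [rewrite eqmx_opp | move=> j; rewrite lvN neg_x].
exists x', j0; split; first split => //.
  case: ifP => x'0.
    apply/idP/idP => /forallP neg; apply/forallP=> j; apply/implyP => /existsP[g /andP[gE gj]].
      have [/existsP h|/existsPn h'] := boolP [exists g in face E j0, gv g j != 0].
        apply: vis'; apply: (implyP (neg j)); exact/existsP.
      have x'j : lv x' j = 0.
        rewrite (lv_span0 x'0) // => h hE0.
        by have := h' h; rewrite hE0 /= negbK => /eqP.
      have := z_gt0 j g gE gj => zj; have := mulr_gt0 t0 zj; move: x'j; rewrite x'E.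
      by move=> /eqP; rewrite addr_eq0 => /eqP ->; rewrite oppr_lt0.
    have xj : lv x j < 0.
      apply: (implyP (neg j)); apply/existsP; exists g; rewrite gj andbT.
      by move: gE; rewrite inE => /andP[].
    have := le_x' j xj; rewrite le_eqVlt => /orP[/eqP x'j|//].
    by move: gE; rewrite -(tie_face j xj x'j) inE (negPf gj) andbF.
  split; last by apply/negP=> /neg_span; rewrite x'0.
  move=> A; apply/negP=> /andP[AE0 /forallP h]; move/negP: x'0; apply.
  (* An admissible A inside the face makes w positive wherever x' is negative. So x' + K w lies in
     the cone, hence in the span of the face, and x' with it. *)
  pose w := \sum_(g in face E j0) row g G.
  have wE0 : (w <= span_mx (face E j0))%MS by apply: summx_sub => g; apply: row_span_mx.
  have lvw j : lv w j = \sum_(g in face E j0) gv g j by rewrite lv_sum.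
  pose K := \sum_(j | lv w j != 0) (`|lv x' j| / lv w j).
  have w_ge0 j : 0 <= lv w j by rewrite lvw; apply: sumr_ge0.
  have K0 : 0 <= K by apply: sumr_ge0 => j _; rewrite divr_ge0.
  have pos j : 0 <= lv (x' + K *: w) j.
    rewrite lvD lvZ; have [x'j|x'j] := leP 0 (lv x' j); first by rewrite addr_ge0 // mulr_ge0.
    have wj : 0 < lv w j.
      have /implyP/(_ x'j)/existsP[g /andP[gA gj]] := h j.
      rewrite lvw (bigD1 g) ?(subsetP AE0) //= ltr_wpDr //; exact: sumr_ge0.
    rewrite addrC -[X in _ + X]opprK subr_ge0 -ler_pdivrMr //.
    rewrite /K (bigD1 j) ?gt_eqF //= ltr0_norm // lerDl.
    by apply: sumr_ge0 => i _; rewrite divr_ge0.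
  have /(@conic_face _ _ j0) h1 : conic E (x' + K *: w).
    apply: sat => //; rewrite addmx_sub // scalemx_sub //.
    exact: submx_trans wE0 (span_mxS (face_sub E j0)).
  have /h1/conic_span h2 : lv (x' + K *: w) j0 = 0.
    rewrite lvD x'j0 lvZ (lv_span0 wE0) ?mulr0 ?addr0 // => g.
    by rewrite inE => /andP[_ /eqP].
  by rewrite -[x'](addrK (K *: w)) addmx_sub // eqmx_opp scalemx_sub.
move=> neg.
have face0 y : (y <= span_mx (face E j0))%MS -> lv y j0 = 0.
  by move=> ys; rewrite (lv_span0 ys) // => g; rewrite inE => /andP[_ /eqP].
(* z spans a complement of the span of the face: subtracting a multiple of z puts y in the kernel of
   j0, and a large multiple of - x', a relative interior point of the face, then moves it into the
   cone. *)
have eqS : (span_mx E :=: span_mx (face E j0) + z)%MS.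
  apply/eqmxP; apply/andP; split; last by rewrite addsmx_sub zE span_mxS ?face_sub.
  apply/rV_subP => y yE.
  pose y0 := y - (lv y j0 / lv z j0) *: z.
  have y0E : (y0 <= span_mx E)%MS by rewrite addmx_sub // eqmx_opp scalemx_sub.
  have y0j0 : lv y0 j0 = 0 by rewrite lvD lvN lvZ divfK ?subrr // gt_eqF.
  suff y00 : (y0 <= span_mx (face E j0))%MS.
    rewrite -[y](subrK ((lv y j0 / lv z j0) *: z)) -/y0 addmx_sub //.
      exact: submx_trans y00 (addsmxSl _ _).
    by rewrite scalemx_sub // addsmxSr.
  pose K := \sum_(j | lv x' j != 0) (`|lv y0 j| / - lv x' j).
  have pos j : 0 <= lv (K *: (- x') + y0) j.
    rewrite lvD lvZ lvN; have := neg_x j neg; rewrite le_eqVlt => /orP[/eqP x'j|x'j].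
      suff -> : lv y0 j = 0 by rewrite -x'j mulr0 addr0.
      have x'j0' : lv x' j = 0 by apply/eqP; rewrite -oppr_eq0 -x'j.
      have [/existsP[g /andP[gE gj]]|/existsPn h'] := boolP [exists g in E, gv g j != 0]; last first.
        rewrite (lv_span0 y0E) // => g gE.
        by have := h' g; rewrite gE /= negbK => /eqP.
      have xj : lv x j < 0 by apply: (implyP (forallP neg j)); apply/existsP; exists g; rewrite gE.
      case/span_mxP: y0E y0j0 => c1 -> /eqP; rewrite !lv_sum => /eqP y0j0.
      apply/eqP; have : lv x j0 != 0 by rewrite lt_eqF.
      move/(mulfI)/inj_eq <-; rewrite mulr0 mulr_sumr; apply/eqP.
      transitivity (lv x j * \sum_(i in E) lv (c1 i *: row i G) j0).
        rewrite mulr_sumr; apply: eq_bigr => i iE; rewrite !lvZ -!/(gv _ _).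
        by rewrite mulrCA -tie // mulrCA.
      by rewrite y0j0 mulr0.
    rewrite -[X in _ + X]opprK subr_ge0; apply: le_trans (ler_norm _) _; rewrite normrN.
    rewrite -ler_pdivrMr // /K (bigD1 j) //= ?lerDl; last by rewrite -oppr_eq0 gt_eqF.
    by apply: sumr_ge0 => i _; rewrite divr_ge0 // neg_x.
  have /(@conic_face _ _ j0) h1 : conic E (K *: (- x') + y0).
    by apply: sat => //; rewrite addmx_sub // scalemx_sub // eqmx_opp.
  have /h1/conic_span h2 : lv (K *: (- x') + y0) j0 = 0.
    by rewrite lvD lvZ lvN x'j0 oppr0 mulr0 add0r.
  rewrite -[y0](addKr (K *: (- x'))) addmx_sub // eqmx_opp scalemx_sub // eqmx_opp.
  exact: neg_span.
rewrite eqS mxrank_disjoint_sum ?rank_rV.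
  suff -> : z != 0 by rewrite addn1.
  by apply: contraTneq zj0 => ->; rewrite /lv mul0mx mxE ltxx.
apply/eqP; rewrite -submx0; apply/rV_subP=> v; rewrite sub_capmx => /andP[/face0 v0 /sub_rVP[a av]].
move: v0; rewrite av lvZ => /eqP; rewrite mulf_eq0 [X in _ || X]gt_eqF // orbF => /eqP ->.
by rewrite scale0r sub0mx.
Qed.

(** Outer induction on the cone, inner induction on the visible facets. When none is visible, every
    subset of E is admissible: the complex is an acyclic full simplex, or E is empty and the empty
    set carries the class in degree 0. *)
Theorem cech_cohomology E x : saturated E -> (x <= span_mx E)%MS ->
  (forall p, (p != \rank (span_mx E)) || ~~ negative E x -> exact_at k E (adm E x) p) /\
  (negative E x -> ~ exact_at k E (adm E x) (\rank (span_mx E))).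
Proof.
have [m] := ubnP #|E|; elim: m E x => // m IHm E x /ltnSE Em.
have [v] := ubnP #|visible x|; elim: v x => // v IHv x /ltnSE xv sat xE.
have [/forallP x0|] := boolP [forall j, 0 <= lv x j]; last first.
  rewrite negb_forall => /existsP[jv]; rewrite -ltNge => xjv.
  have [x' [j0 [[[x'E properE0 vis_lt] admE adm0E nneg' cond] rkE]]] := facet_removal sat xE xjv.
  set E0 := face E j0 in properE0 admE adm0E cond rkE.
  have sE0 := proper_sub properE0.
  have [ex' _] := IHv x' (leq_trans vis_lt xv) sat x'E.
  have {}ex' p : exact_at k E (adm E x') p by apply: ex'; rewrite nneg' orbT.
  have up' := @adm_up E x'.
  case: ifP cond => x'0 cond; last first.
    (* No subset of the face is admissible, so x and x' have the same complex. *)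
    case: cond => adm0 nneg; split; last by move=> neg; rewrite neg in nneg.
    move=> p _; have eqU A : adm E x A = adm E x' A.
      by have := adm0E A; rewrite (negPf (adm0 A)) admE; case: (A \subset E0) => /=; rewrite ?andbT ?andbF.
    move=> c cU cc; have [A /cU|b bU bc] := ex' p c _ cc; first by rewrite eqU.
    by exists b => // A /bU; rewrite eqU.
  have E0m : (#|E0| < m)%N := leq_trans (proper_card properE0) Em.
  have [ex0 nex0] := IHm E0 x' E0m (@saturated_face E j0 sat) x'0.
  rewrite cond in ex0 nex0.
  split.
    case=> [|p] h; first by apply: exact_step0 (ex' 0%N) => A; rewrite admE => /andP[].
    apply: exact_step sE0 up' admE adm0E (ex' p.+1) _; apply: ex0.
    have [neg|] := boolP (negative E x); rewrite ?orbT // orbF.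
    by move: h; rewrite neg orbF rkE // eqSS.
  move=> neg; rewrite (rkE neg) => exE; apply: (nex0 neg).
  exact: exact_step_conv sE0 up' admE adm0E (ex' _) exE.
have [E0|En] := eqVneq E set0.
  have rk0 : \rank (span_mx E) = 0%N.
    apply/eqP; rewrite mxrank_eq0; apply/eqP/matrixP=> g i; by rewrite !mxE E0 inE.
  have admS A : adm E x A -> A = set0 by case/andP; rewrite E0 subset0 => /eqP.
  have neg : negative E x.
    by apply/forallP=> j; apply/implyP=> /existsP[g]; rewrite E0 inE.
  rewrite rk0; split => [p|_ ex].
    rewrite neg orbF => p0 c cU _; exists 0; first by move=> A; rewrite ffunE eqxx.
    rewrite raddf0; apply/ffunP=> A; rewrite ffunE; apply: contraTeq p0 => h.
    have /cU/andP[/admS A0 /eqP <-] : c A != 0 by rewrite eq_sym.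
    by rewrite A0 cards0.
  pose c : chain := [ffun A : {set 'I_N} => if A == set0 then 1 else 0].
  have [A||b /supp_pred0 -> cb] := ex c _ _.
  - rewrite ffunE; have [-> _|_] := eqVneq A set0; rewrite ?eqxx // cards0 andbT /adm sub0set /=.
    by apply/forallP=> j; rewrite ltNge x0.
  - apply/ffunP=> A; rewrite cobdE ffunE; apply: big1 => g; by rewrite E0 inE.
  - have := congr1 (fun f : chain => f set0) cb; rewrite raddf0 !ffunE eqxx => /eqP.
    by rewrite eq_sym oner_eq0.
have nneg : ~~ negative E x.
  case/set0Pn: En => g gE; have [j gj] := gv_pointed g.
  rewrite negb_forall; apply/existsP; exists j; rewrite negb_imply -leNgt x0 andbT.
  by apply/existsP; exists g; rewrite gE gt_eqF.
split; last by rewrite (negPf nneg).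
move=> p _ c cU cc; have [A /cU/andP[/andP[-> _]]//|b bU bc] := @exact_full _ k E p En c _ cc.
exists b => // A /bU/andP[AE ->]; rewrite /adm AE andbT /=.
by apply/forallP=> j; rewrite ltNge x0.
Qed.

End Cech.

(** * The Koszul-Cech double complex *)

Section KoszulCech.
Local Open Scope ring_scope.
Variables (k : fieldType) (N d M : nat) (G : 'M[rat]_(N, d)) (L : 'M[rat]_(d, M)).
Local Notation chain := {ffun {set 'I_N} -> k}.
Local Notation dchain := {ffun {set 'I_N} -> chain}.
Implicit Types (F A : {set 'I_N}) (c b y : dchain) (P R : pred nat).
Local Notation adm := (adm G L setT).
Local Notation negative := (negative G L setT).

Hypothesis gv_ge0 : forall g j, 0 <= gv G L g j.
Hypothesis gv_pointed : forall g, exists j, 0 < gv G L g j.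
Hypothesis satG : saturated G L setT.
Hypothesis rkG : \rank (span_mx G setT) = d.

Lemma sgn_ffunE (s : bool) (f : chain) A : (sgn s f : chain) A = sgn s (f A).
Proof. by case: s; rewrite //= ffunE. Qed.

Section FineDegree.
Variable a : 'rV[rat]_d.
(** The degree of the coefficient at the Koszul basis element F, so that the total fine degree stays
    a. *)
Definition degF F := a - \sum_(g in F) row g G.

Lemma degFU1 g F : g \notin F -> degF (g |: F) = degF F - row g G.
Proof. by move=> gF; rewrite /degF big_setU1 //= opprD addrCA addrC. Qed.

Lemma degFD1 g F : g \in F -> degF (F :\ g) = degF F + row g G.
Proof. by move=> gF; rewrite -{2}(setD1K gF) degFU1 ?setD11 // subrK. Qed.

Lemma span_all (x : 'rV_d) : (x <= span_mx G setT)%MS.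
Proof. by apply: submx_full; rewrite /row_full rkG. Qed.

Lemma adm_addrow g x A : adm x A -> adm (x + row g G) A.
Proof.
case/andP=> AE /forallP h; apply/andP; split=> //; apply/forallP=> j; apply/implyP=> xj.
apply: (implyP (h j)); apply: le_lt_trans xj; rewrite lvD lerDl; exact: gv_ge0.
Qed.

(** The generators in A are inverted, so subtracting one of them costs nothing. This makes the rows
    of positive Cech degree exact. *)
Lemma adm_subrow g x A : g \in A -> adm x A -> adm (x - row g G) A.
Proof.
move=> gA /andP[AE /forallP h]; apply/andP; split=> //; apply/forallP=> j; apply/implyP=> xj.
have [xj'|xj'] := ltP (lv L x j) 0; first exact: (implyP (h j)).
apply/existsP; exists g; rewrite gA /=; move: xj; rewrite lvD lvN subr_lt0.
exact: le_lt_trans.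
Qed.

Definition dsupp P R c := forall F A, c F A != 0 -> [&& P #|F|, R #|A| & adm (degF F) A].

Definition dco c : dchain := cmap (cobd setT) c.

Fact dco_is_zmod_morphism : zmod_morphism dco.
Proof. by move=> f f'; rewrite /dco raddfB. Qed.
HB.instance Definition _ := GRing.isZmodMorphism.Build dchain dchain dco dco_is_zmod_morphism.

Lemma dco_dco c : dco (dco c) = 0.
Proof. by apply/ffunP=> F; rewrite !ffunE /= cobd_cobd. Qed.

Lemma bd_dco c : bd (dco c) = dco (bd c).
Proof. exact: bd_cmap. Qed.

Lemma dsupp0 P R : dsupp P R 0.
Proof. by move=> F A; rewrite !ffunE eqxx. Qed.

Lemma dsuppB P R c b : dsupp P R c -> dsupp P R b -> dsupp P R (c - b).
Proof.
move=> h h' F A; rewrite !ffunE; have [->|/h//] := eqVneq (c F A) 0.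
by rewrite sub0r oppr_eq0; apply: h'.
Qed.

Lemma dsupp_weaken P R P' R' c : (forall n, P n -> P' n) -> (forall n, R n -> R' n) ->
  dsupp P R c -> dsupp P' R' c.
Proof. by move=> hP hR h F A /h /= /and3P[/hP -> /hR -> ->]. Qed.

Lemma dsupp_empty P R c : (forall n, (n <= N)%N -> P n -> False) -> dsupp P R c -> c = 0.
Proof.
move=> hP h; apply/ffunP=> F; apply/ffunP=> A; rewrite !ffunE.
apply: contraTeq isT => /h /= /and3P[/hP h1 _ _]; case: h1.
by rewrite (leq_trans (max_card _)) ?card_ord.
Qed.

Lemma dsupp_dco P q c : dsupp P (pred1 q) c -> dsupp P (pred1 q.+1) (dco c).
Proof.
move=> h F; rewrite ffunE.
have up := @adm_up _ _ _ G L setT (degF F).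
move=> A h1; have PF : P #|F|.
  apply: contraNT h1 => nP; suff -> : c F = 0 by rewrite raddf0 ffunE.
  by apply/ffunP=> B; rewrite ffunE; apply: contraNeq nP => /h /= /and3P[].
have hF : supp_in (adm (degF F)) q (c F) by move=> B /h /= /and3P[_ -> ->].
by have /andP[h2 h3] := supp_in_cobd up hF h1; rewrite PF /= h3.
Qed.

Lemma dsupp_bd P R c : dsupp P R c -> dsupp (fun n => P n.+1) R (bd c).
Proof.
move=> h F A; rewrite bdE sum_ffunE; apply: contraNT => nh; apply/eqP; apply: big1 => g gF.
apply/eqP; rewrite sgn_ffunE sgn_eq0; apply: contraNT nh => /h; rewrite cardsU1 gF /= add1n => /and3P[-> ->].
by rewrite degFU1 // => /(adm_addrow g); rewrite subrK.
Qed.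

Lemma dco_exact P q c : dsupp P (pred1 q) c -> dco c = 0 ->
  (forall F, P #|F| -> (q != d) || ~~ negative (degF F)) ->
  exists2 b, dsupp P (fun n => n.+1 == q) b & dco b = c.
Proof.
move=> cS cc hF.
have ex F : exists b : chain, (P #|F| -> supp_pred (adm (degF F)) q b) /\
   (~~ P #|F| -> b = 0) /\ cobd setT b = c F.
  have [PF|nPF] := boolP (P #|F|); last first.
    exists 0; split=> //; split=> //; rewrite raddf0; apply/ffunP=> A; rewrite ffunE.
    by apply/esym; apply: contraNeq nPF => /cS /= /and3P[].
  have [ex _] := cech_cohomology k gv_ge0 gv_pointed satG (span_all (degF F)).
  rewrite rkG in ex; have {ex} := ex q (hF F PF) (c F) => -[||b bS bc]; last by exists b.
    by move=> A /cS /= /and3P[_ -> ->].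
  by have := congr1 (fun f : dchain => f F) cc; rewrite !ffunE.
have [b hb] := fin_all_exists ex.
exists (finfun b); last by apply/ffunP=> F; rewrite !ffunE; case: (hb F) => _ [].
move=> F A; rewrite ffunE; have [h1 [h2 _]] := hb F.
have [PF|nPF] := boolP (P #|F|); last by rewrite h2 // ffunE eqxx.
by move=> h; have /andP[-> ->] := h1 PF A h.
Qed.

Definition evA A (f : chain) : k := f A.
Fact evA_is_zmod_morphism A : zmod_morphism (evA A).
Proof. by move=> f f'; rewrite /evA !ffunE. Qed.
HB.instance Definition _ A := GRing.isZmodMorphism.Build chain k (evA A) (evA_is_zmod_morphism A).

(** [bd] acts on the Koszul index alone, so a homotopy may use a different generator for each Cech
    index A. *)
Lemma bd_ev A c c' : (forall F, c F A = c' F A) -> forall F, bd c F A = bd c' F A.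
Proof.
move=> h F; have e (x : dchain) : bd x F A = bd (cmap (evA A) x) F by rewrite bd_cmap ffunE.
by rewrite !e; congr (bd _ F); apply/ffunP=> F'; rewrite !ffunE; apply: h.
Qed.

(** For nonempty A, exterior multiplication by any generator in A contracts the row; [adm_subrow]
    keeps the values admissible. *)
Lemma bd_exact p q c : dsupp (pred1 p) (pred1 q.+1) c -> bd c = 0 ->
  exists2 b, dsupp (pred1 p.+1) (pred1 q.+1) b & bd b = c.
Proof.
move=> cS cc.
pose b : dchain := [ffun F : {set 'I_N} => [ffun A : {set 'I_N} =>
  if [pick g in A] is Some g then wedge g c F A else 0]].
exists b.
  move=> F A; rewrite !ffunE; case: pickP => [g gA|_]; last by rewrite eqxx.
  rewrite ffunE; case: ifP => gF; last by rewrite ffunE eqxx.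
  rewrite sgn_ffunE sgn_eq0 => /cS /= /and3P[/eqP cF -> /(adm_subrow gA)].
  by rewrite degFD1 // addrK => ->; rewrite (cardsD1 g F) gF cF add1n eqxx.
apply/ffunP=> F; apply/ffunP=> A.
case pA: [pick g in A] => [g|].
  rewrite (@bd_ev A _ (wedge g c)); last by move=> F'; rewrite ffunE ffunE pA.
  by have := bd_wedge g c; rewrite cc raddf0 addr0 => ->.
rewrite (@bd_ev A _ 0); last by move=> F'; rewrite !ffunE pA.
rewrite raddf0 !ffunE; apply/esym; apply: contraTeq isT => /cS /= /and3P[_ /=].
case: pickP pA => // nA _; suff -> : A = set0 by rewrite cards0.
by apply/setP=> g; rewrite inE; apply: nA.
Qed.

(* Staircase through the double complex: rows of positive Cech degree are exact, and columns are
   exact away from Cech degree [d]. *)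
Lemma koszul_fine_exact i c :
  (forall F, #|F| = (i + d)%N -> ~~ negative (degF F)) ->
  dsupp (pred1 i) (pred1 0%N) c -> bd c = 0 ->
  exists2 b, dsupp (pred1 i.+1) (pred1 0%N) b & bd b = c.
Proof.
move=> hF cS cc.
have colx s y : dsupp (pred1 (i + s)%N) (pred1 s) y -> dco y = 0 ->
    exists2 b, dsupp (pred1 (i + s)%N) (fun n => n.+1 == s) b & dco b = y.
  move=> yS yc; apply: dco_exact yS yc _ => F /eqP cF.
  by have [sd|//] := eqVneq s d; rewrite hF // -sd.
(* Descending induction on the Cech degree s. Write dco x = bd x1, correct x1 one step further up by
   w, and write x1 - bd w = dco u; this u corrects x. *)
have claim m s : (s + m = N)%N -> forall x, dsupp (pred1 (i + s)%N) (pred1 s) x -> bd (dco x) = 0 ->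
    exists2 w, dsupp (pred1 (i + s).+1) (pred1 s) w & dco (x - bd w) = 0.
  elim: m s => [|m IH] s sm x xS xc.
    exists 0; first exact: dsupp0.
    rewrite raddf0 subr0; have := dsupp_dco xS => h.
    apply/ffunP=> F; apply/ffunP=> A; rewrite !ffunE -[LHS]/(cobd setT (x F) A).
    apply: contraTeq isT => h1; have := h F A; rewrite ffunE => /(_ h1) /and3P[_ /eqP cA _].
    by have := max_card (mem A); rewrite card_ord cA -sm addn0 ltnn.
  have [x1 x1S x1c] := bd_exact (dsupp_dco xS) xc.
  rewrite -addnS in x1S.
  have [||w wS wc] := IH s.+1 _ x1 x1S; [by rewrite addSnnS| by rewrite bd_dco x1c dco_dco |].
  have [|u uS uc] := colx s.+1 _ _ wc; first by apply: dsuppB => //; apply: dsupp_bd wS.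
  exists u; first by rewrite -addnS; apply: dsupp_weaken uS.
  rewrite raddfB /= -bd_dco uc -x1c raddfB /= bd_bd subr0.
  by rewrite subrr.
have [//||w wS wc] := claim N 0%N (add0n N) c; first by rewrite addn0.
  by rewrite bd_dco cc raddf0.
rewrite addn0 in wS.
(* In Cech degree 0 the only coboundary is 0, so c = bd w. *)
have [|u uS uc] := colx 0%N _ _ wc.
  by apply: dsuppB; rewrite addn0 //; apply: dsupp_bd wS.
exists w => //; apply/eqP; rewrite eq_sym -subr_eq0 -uc.
suff -> : u = 0 by rewrite raddf0.
apply/ffunP=> F; apply/ffunP=> A; rewrite !ffunE; apply: contraTeq isT => /uS.
by rewrite andbF.
Qed.

End FineDegree.

(* The same staircase read backwards, from the Cech class of degree [- w] to the Koszul complex. *)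
Lemma koszul_fine_nonexact w (a := \sum_g row g G - w) : (0 < d)%N ->
  negative (- w) -> (forall g, ~~ negative (row g G - w)) ->
  ~ (forall c, dsupp a (pred1 (N - d)%N) (pred1 0%N) c -> bd c = 0 ->
      exists2 b, dsupp a (pred1 (N - d).+1) (pred1 0%N) b & bd b = c).
Proof.
move=> d0 neg nneg Kos.
have dN : (d <= N)%N by rewrite -rkG rank_leq_row.
have degT : degF a setT = - w.
  rewrite /degF /a -addrA [- w - _]addrC addrA.
  by rewrite [X in _ - X - _](eq_bigl predT) ?subrr ?add0r // => g; rewrite inE.
have claim q : (q <= d)%N -> forall y, dsupp a (pred1 (N - d + q)%N) (pred1 q) y ->
    dco (bd y) = 0 ->
    exists2 u, dsupp a (pred1 (N - d + q)%N) (fun n => n.+1 == q) u & bd (y - dco u) = 0.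
  elim: q => [|q IH] qd y yS yc.
    have [|u uS uc] := dco_exact (dsupp_bd yS) yc; first by move=> F _; rewrite neq_ltn d0.
    exists 0; first exact: dsupp0.
    rewrite raddf0 subr0 -uc; suff -> : u = 0 by rewrite raddf0.
    apply/ffunP=> F; apply/ffunP=> A; rewrite !ffunE; apply: contraTeq isT => /uS.
    by rewrite andbF.
  have bS : dsupp a (pred1 (N - d + q)%N) (pred1 q.+1) (bd y).
    by apply: dsupp_weaken (dsupp_bd yS) => // n; rewrite addnS.
  (* The column could fail to be exact only in Cech degree d; there |F| = N - 1, and [nneg]
     applies. *)
  have [|y' y'S y'c] := dco_exact bS yc.
    move=> F /eqP cF; have [qd'|//] := eqVneq q.+1 d; rewrite orFb.
    have cFN : #|F|.+1 = N by rewrite cF -addnS qd' subnK.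
    have /eqP/cards1P[g gF] : #|~: F| = 1%N.
      by apply/eqP; rewrite -(eqn_add2l #|F|) cardsC card_ord addn1 cFN.
    have -> : degF a F = row g G - w; last exact: nneg.
    have -> : F = setT :\ g by rewrite -[F]setCK gF; apply/setP=> h; rewrite !inE andbT.
    by rewrite degFD1 ?inE // degT addrC.
  have [|||u' u'S u'c] := IH _ y'.
  - exact: ltnW.
  - by apply: dsupp_weaken y'S.
  - by rewrite -bd_dco y'c bd_bd.
  have dS : dsupp a (pred1 (N - d + q)%N) (pred1 q) (y' - dco u').
    apply: dsuppB; first exact: dsupp_weaken y'S.
    case: (q) u'S => [|q'] u'S; last exact: (dsupp_dco u'S).
    suff -> : u' = 0 by rewrite raddf0; apply: dsupp0.
    apply/ffunP=> F; apply/ffunP=> A; rewrite !ffunE; apply: contraTeq isT => /u'S.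
    by rewrite andbF.
  have [v vS vc] : exists2 v, dsupp a (pred1 (N - d + q.+1)%N) (pred1 q) v & bd v = y' - dco u'.
    rewrite addnS; case: (q) dS => [|q'] dS; last exact: bd_exact.
    by rewrite addn0 in dS *; apply: Kos.
  exists v; first exact: dsupp_weaken vS.
  by rewrite raddfB /= bd_dco vc raddfB /= dco_dco subr0 y'c subrr.
have [_ nex] := cech_cohomology k gv_ge0 gv_pointed satG (span_all (- w)).
apply: (nex neg); rewrite rkG => c cS cc.
(* The full set is the only F of size N, and its degree is - w. A cocycle placed there is pushed
   down the staircase to the Koszul complex. *)
pose y : dchain := [ffun F : {set 'I_N} => if F == setT then c else 0].
have yS : dsupp a (pred1 (N - d + d)%N) (pred1 d) y.
  rewrite subnK // => F A; rewrite ffunE; have [->|] := eqVneq F setT; last by rewrite ffunE eqxx.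
  by move=> /cS /andP[h1 h2]; rewrite /= cardsT card_ord eqxx h2 degT.
have yc : dco y = 0.
  by apply/ffunP=> F; rewrite !ffunE; case: ifP; rewrite ?cc ?raddf0.
have [|u uS uc] := claim d (leqnn d) y yS; first by rewrite -bd_dco yc raddf0.
have d1 : d.-1.+1 = d by rewrite prednK.
have dS : dsupp a (pred1 N) (pred1 d.-1.+1) (y - dco u).
  rewrite -{1}(subnK dN); apply: dsuppB; first by rewrite d1.
  by apply: dsupp_dco; apply: dsupp_weaken uS => // n; rewrite -{1}d1 eqSS.
have [v vS vc] := bd_exact dS uc.
have v0 : v = 0 by apply: (dsupp_empty (a := a) _ vS) => n nN /= /eqP e; rewrite e ltnn in nN.
exists (u setT); first by move=> A /uS /= /and3P[_ -> ]; rewrite degT => ->.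
have := congr1 (fun f : dchain => f setT) vc.
rewrite v0 raddf0 !ffunE eqxx => /eqP; rewrite eq_sym subr_eq0 => /eqP -> //.
Qed.

End KoszulCech.

(** * Graded Koszul homology and dimension shifting *)

Section Koszul.
Local Open Scope ring_scope.
Variables (N : nat) (Q : zmodType) (Y : 'I_N -> {additive Q -> Q}).
Local Notation chain := {ffun {set 'I_N} -> Q}.
Implicit Types (f b : chain) (A : {set 'I_N}).

Definition kd f : chain := \sum_g contr g (cmap (Y g) f).

Fact kd_is_zmod_morphism : zmod_morphism kd.
Proof. by move=> f f'; rewrite /kd -sumrB; apply: eq_bigr => g _; rewrite !raddfB. Qed.
HB.instance Definition _ := GRing.isZmodMorphism.Build chain chain kd kd_is_zmod_morphism.

Lemma kdE f A : kd f A = \sum_(g | g \notin A) sgn (pos_in g A) (Y g (f (g |: A))).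
Proof.
rewrite /kd sum_ffunE [RHS]big_mkcond; apply: eq_bigr => g _.
by rewrite !ffunE; case: (g \in A).
Qed.

Lemma kd_kd f : (forall g h x, Y g (Y h x) = Y h (Y g x)) -> kd (kd f) = 0.
Proof.
move=> Yc; have -> : kd (kd f) = \sum_g \sum_h contr g (contr h (cmap (Y g) (cmap (Y h) f))).
  rewrite /kd; apply: eq_bigr => g _; rewrite !raddf_sum; apply: eq_bigr => h _.
  by rewrite /= -contr_cmap.
apply: sum_antisym => [g h|g].
  have -> : cmap (Y g) (cmap (Y h) f) = cmap (Y h) (cmap (Y g) f).
    by apply/ffunP=> A; rewrite !ffunE Yc.
  exact: contr_contr.
apply/ffunP=> A; rewrite !ffunE setU11; case: ifP => // _; exact: sgn0.
Qed.

Definition additive_pred (P : Q -> Prop) := P 0 /\ forall x y, P x -> P y -> P (x - y).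

Lemma additive_predN P x : additive_pred P -> P x -> P (- x).
Proof. by case=> P0 PB Px; rewrite -sub0r; apply: PB. Qed.

Lemma additive_predD P x y : additive_pred P -> P x -> P y -> P (x + y).
Proof. by move=> Pa Px Py; rewrite -[y]opprK; case: (Pa) => _; apply=> //; apply: additive_predN. Qed.

Lemma additive_pred_sum P (I : Type) (r : seq I) (R : pred I) (F : I -> Q) :
  additive_pred P -> (forall i, R i -> P (F i)) -> P (\sum_(i <- r | R i) F i).
Proof.
move=> Pa h; apply: (big_ind P) => //; first by case: Pa.
by move=> x y; apply: additive_predD.
Qed.

Lemma additive_pred_sgn P s x : additive_pred P -> P x -> P (sgn s x).
Proof. by move=> Pa Px; case: s => //=; apply: additive_predN. Qed.

Lemma additive_pred_kd (P P' : Q -> Prop) f : additive_pred P' ->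
  (forall g x, P x -> P' (Y g x)) -> (forall A, P (f A)) -> forall A, P' (kd f A).
Proof.
move=> Pa PY Pf A; rewrite kdE; apply: additive_pred_sum => // g _.
by apply: additive_pred_sgn => //; apply: PY.
Qed.

Lemma has_card0 p : has_card (N := N) (Q := Q) p 0.
Proof. by move=> A; rewrite ffunE eqxx. Qed.

Lemma has_cardB p f b : has_card p f -> has_card p b -> has_card p (f - b).
Proof.
move=> h h' A; rewrite !ffunE; have [->|/h//] := eqVneq (f A) 0.
by rewrite sub0r oppr_eq0; apply: h'.
Qed.

Lemma has_cardD p f b : has_card p f -> has_card p b -> has_card p (f + b).
Proof.
move=> h h' A; rewrite !ffunE; have [->|/h//] := eqVneq (f A) 0.
by rewrite add0r; apply: h'.
Qed.

Lemma has_card_kd p f : has_card p.+1 f -> has_card p (kd f).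
Proof.
move=> h A; rewrite kdE => nz; apply/eqP; apply: contraNT nz => nA; apply/eqP.
apply: big1 => g gA; suff -> : f (g |: A) = 0 by rewrite raddf0 sgn0.
apply: contraNeq nA => /h /eqP; by rewrite cardsU1 gA add1n eqSS.
Qed.

(* Vanishing of the [j]-th Koszul homology of the submodule [Z] on chains with values in degree
   [e], that is in internal degree [e + j]. *)
Definition kexact (Z : Q -> Prop) (H : int -> Q -> Prop) (j : nat) (e : int) :=
  forall f, has_card j f -> (forall A, Z (f A) /\ H e (f A)) -> kd f = 0 ->
  exists b, [/\ has_card j.+1 b, (forall A, Z (b A) /\ H (e - 1) (b A)) & kd b = f].

End Koszul.

Lemma kd_cmap (N : nat) (Q Q' : zmodType) (Y : 'I_N -> {additive Q -> Q})
    (Y' : 'I_N -> {additive Q' -> Q'}) (phi : {additive Q -> Q'}) f :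
  (forall g x, phi (Y g x) = Y' g (phi x)) -> kd Y' (cmap phi f) = cmap phi (kd Y f).
Proof.
move=> h; rewrite /kd raddf_sum; apply: eq_bigr => g _; rewrite /= -contr_cmap.
by congr contr; apply/ffunP=> A; rewrite !ffunE h.
Qed.

Lemma has_card_cmap (N : nat) (Q Q' : zmodType) (phi : {additive Q -> Q'}) p
  (f : {ffun {set 'I_N} -> Q}) : has_card p f -> has_card p (cmap phi f).
Proof.
by move=> h A; rewrite ffunE => nz; apply: h; apply: contraNneq nz => ->; rewrite raddf0.
Qed.

(* Dimension shifting along a graded presentation [phi : F -> Z] with kernel [Z']. *)
Section Shift.
Local Open Scope ring_scope.
Variables (N : nat) (F Q : zmodType).
Variables (YF : 'I_N -> {additive F -> F}) (Y : 'I_N -> {additive Q -> Q}).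
Variables (phi : {additive F -> Q}) (Z : Q -> Prop).
Variables (HF : int -> F -> Prop) (H : int -> Q -> Prop).
Hypothesis YFC : forall g h x, YF g (YF h x) = YF h (YF g x).
Hypothesis phiY : forall g x, phi (YF g x) = Y g (phi x).
Hypothesis HF_add : forall e, additive_pred (HF e).
Hypothesis HF_Y : forall e g x, HF e x -> HF (e + 1) (YF g x).
Hypothesis phiH : forall e x, HF e x -> H e (phi x).
Hypothesis phiZ : forall x, Z (phi x).
Hypothesis phi_lift : forall e z, Z z -> H e z -> exists2 x, HF e x & phi x = z.
Local Notation Z' := (fun x => phi x = 0).

Lemma Z'_add : additive_pred Z'.
Proof. by split=> [|x y hx hy]; rewrite ?raddf0 // raddfB hx hy subrr. Qed.

(** The lift of 0 is chosen to be 0, so that the support of the chain does not grow. *)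
Lemma chain_lift p e (f : {ffun {set 'I_N} -> Q}) :
  has_card p f -> (forall A, Z (f A) /\ H e (f A)) ->
  exists b, [/\ has_card p b, (forall A, HF e (b A)) & cmap phi b = f].
Proof.
move=> fp fZ.
have ex A : exists x, [/\ HF e x, (f A = 0 -> x = 0) & phi x = f A].
  have [f0|f0] := eqVneq (f A) 0.
    by exists 0; split=> //; [case: (HF_add e) | rewrite raddf0].
  have [Zf Hf] := fZ A; have [x Hx xf] := phi_lift Zf Hf.
  by exists x; split=> // /eqP; rewrite (negPf f0).
have [b hb] := fin_all_exists ex.
exists (finfun b); split=> [A|A|]; rewrite ?ffunE.
- by move=> nz; apply: fp; apply: contraNneq nz; case: (hb A) => _ h _ /h ->.
- by case: (hb A).
- by apply/ffunP=> A; rewrite !ffunE; case: (hb A).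
Qed.

(** A cycle in the kernel bounds some b in F; phi b is a cycle in Z, and lifting a chain that it
    bounds corrects b. The internal degree j + e is preserved, whence the pair (j + 1, e - 1). *)
Lemma kexact_kernel j e :
  (forall f, has_card j f -> (forall A, Z' (f A) /\ HF e (f A)) -> kd YF f = 0 ->
     exists b, [/\ has_card j.+1 b, (forall A, HF (e - 1) (b A)) & kd YF b = f]) ->
  kexact Y Z H j.+1 (e - 1) -> kexact YF Z' HF j e.
Proof.
move=> exF exZ f fj fZ fc.
have [b [bj bH bf]] := exF f fj fZ fc.
have [|A||y [yj yZ yb]] := exZ (cmap phi b).
- exact: has_card_cmap.
- by rewrite ffunE; split; [apply: phiZ | apply: phiH].
- by rewrite (kd_cmap _ phiY) bf; apply/ffunP=> A; rewrite !ffunE; case: (fZ A).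
have [u [uj uH uy]] := chain_lift yj yZ.
exists (b - kd YF u); split.
- by apply: has_cardB => //; apply: has_card_kd.
- move=> A; split.
    have : cmap phi (b - kd YF u) = 0 by rewrite raddfB /= -(kd_cmap _ phiY) uy yb subrr.
    by move/ffunP/(_ A); rewrite !ffunE.
  rewrite !ffunE; have [_ h] := HF_add (e - 1); apply: h => //.
  apply: (additive_pred_kd (P := HF (e - 1 - 1))) => //.
  by move=> g x /HF_Y; rewrite subrK; apply.
- by rewrite raddfB /= kd_kd // subr0.
Qed.

(** A lift of a cycle has its boundary in the kernel; bounding it there turns the lift into a cycle
    of F. *)
Lemma kexact_image j e :
  (forall f, has_card j.+1 f -> (forall A, HF e (f A)) -> kd YF f = 0 ->
     exists b, [/\ has_card j.+2 b, (forall A, HF (e - 1) (b A)) & kd YF b = f]) ->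
  kexact YF Z' HF j (e + 1) -> kexact Y Z H j.+1 e.
Proof.
move=> exF exZ' f fj fZ fc.
have [b [bj bH bf]] := chain_lift fj fZ.
have [||| y [yj yZ yb]] := exZ' (kd YF b).
- exact: has_card_kd.
- move=> A; split.
    have : cmap phi (kd YF b) = 0 by rewrite -(kd_cmap _ phiY) bf.
    by move/ffunP/(_ A); rewrite !ffunE.
  by apply: (additive_pred_kd (P := HF e)) => // g x; apply: HF_Y.
- exact: kd_kd.
have [||| x [xj xH xb]] := exF (b - y).
- exact: has_cardB.
- move=> A; rewrite !ffunE; have [_ h] := HF_add e; apply: h => //.
  by have [_] := yZ A; rewrite addrK.
- by rewrite raddfB /= yb subrr.
exists (cmap phi x); split.
- exact: has_card_cmap.
- by move=> A; rewrite ffunE; split; [apply: phiZ | apply: phiH].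
- rewrite (kd_cmap _ phiY) xb raddfB /= bf.
  suff -> : cmap phi y = 0 by rewrite subr0.
  by apply/ffunP=> A; rewrite !ffunE; case: (yZ A).
Qed.

(** In position 0 every chain is a cycle, so the kernel does not enter. *)
Lemma kexact_image0 e :
  (forall f, has_card 0 f -> (forall A, HF e (f A)) -> kd YF f = 0 ->
     exists b, [/\ has_card 1 b, (forall A, HF (e - 1) (b A)) & kd YF b = f]) ->
  kexact Y Z H 0 e.
Proof.
move=> exF f fj fZ fc.
have [b [bj bH bf]] := chain_lift fj fZ.
have [|x [xj xH xb]] := exF b bj bH.
  apply/ffunP=> A; rewrite kdE ffunE; apply: big1 => g gA.
  suff -> : b (g |: A) = 0 by rewrite raddf0 sgn0.
  apply: contraTeq isT => /bj /eqP; by rewrite cardsU1 gA.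
exists (cmap phi x); split.
- exact: has_card_cmap.
- by move=> A; rewrite ffunE; split; [apply: phiZ | apply: phiH].
- by rewrite (kd_cmap _ phiY) xb.
Qed.

End Shift.

(** * Koszul complexes of monomials, one fine degree at a time *)

Section MonomialKoszul.
Local Open Scope ring_scope.
Variables (k : fieldType) (m N : nat) (v : 'I_N -> 'X_{1..m}).
Local Notation P := {mpoly k[m]}.
Local Notation chain := {ffun {set 'I_N} -> k}.
Local Notation pchain := {ffun {set 'I_N} -> P}.
Implicit Types (F : {set 'I_N}) (a mu : 'X_{1..m}) (f b : pchain) (c : chain).

Definition mulv (g : 'I_N) (p : P) : P := 'X_[v g] * p.
Fact mulv_is_zmod_morphism g : zmod_morphism (mulv g).
Proof. by move=> p q; rewrite /mulv mulrBr. Qed.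
HB.instance Definition _ g := GRing.isZmodMorphism.Build P P (mulv g) (mulv_is_zmod_morphism g).

Definition sumv F : 'X_{1..m} := (\big[+%MM/0%MM]_(g in F) v g)%MM.

Lemma sumvU1 g F : g \notin F -> sumv (g |: F) = (v g + sumv F)%MM.
Proof. by move=> gF; rewrite /sumv big_setU1. Qed.

Lemma mcoeff_mulv g p mu :
  (mulv g p)@_mu = if (v g <= mu)%MM then p@_(mu - v g) else 0.
Proof.
rewrite /mulv; case: ifP => h.
  by rewrite -{1}(submK h) addmC mulrC mcoeffMX.
rewrite mulrC; apply/eqP; apply: contraFT h; rewrite -mcoeff_msupp.
move/msuppM_le/allpairsP => -[[m1 m2] /= [_ h2 ->]].
by move: h2; rewrite msuppX inE => /eqP ->; rewrite lem_addl.
Qed.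

(** In a fixed fine degree each coefficient is a scalar, and the Koszul differential becomes the
    simplicial boundary ([fine_kd]). *)
Definition fine a f : chain :=
  [ffun F : {set 'I_N} => if (sumv F <= a)%MM then (f F)@_(a - sumv F) else 0].
Definition unfine a c : pchain :=
  [ffun F : {set 'I_N} => if (sumv F <= a)%MM then c F *: 'X_[a - sumv F] else 0].

Lemma sumv_leU1 g F a : g \notin F ->
  (sumv (g |: F) <= a)%MM = (sumv F <= a)%MM && (v g <= a - sumv F)%MM.
Proof.
move=> gF; rewrite sumvU1 //; apply/idP/andP => [/mnm_lepP h|[/mnm_lepP h1 /mnm_lepP h2]].
  split; apply/mnm_lepP=> i; have := h i; rewrite ?mnmBE mnmDE.
    by apply: leq_trans; apply: leq_addl.
  by move=> h'; rewrite leq_subRL 1?addnC // (leq_trans _ h') // leq_addl.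
apply/mnm_lepP=> i; rewrite mnmDE -(subnK (h1 i)) leq_add2r.
by have := h2 i; rewrite mnmBE.
Qed.

Lemma sub_sumvU1 g F a : g \notin F -> (a - sumv (g |: F) = a - sumv F - v g)%MM.
Proof. by move=> gF; apply/mnmP=> i; rewrite !mnmBE sumvU1 // mnmDE subnDA subnAC. Qed.

Lemma fine_kd a f : fine a (kd mulv f) = bd (fine a f).
Proof.
apply/ffunP=> F; rewrite ffunE bdE kdE; case: ifP => Fa; last first.
  apply/esym/big1 => g gF; rewrite ffunE sumv_leU1 // Fa /=; exact: sgn0.
rewrite raddf_sum /=; apply: eq_bigr => g gF.
have -> : (sgn (pos_in g F) (mulv g (f (g |: F))))@_(a - sumv F)
   = sgn (pos_in g F) ((mulv g (f (g |: F)))@_(a - sumv F)).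
  by case: pos_in; rewrite //= mcoeffN.
by rewrite mcoeff_mulv ffunE sumv_leU1 // Fa /= sub_sumvU1.
Qed.

Lemma kd_unfine a c : (forall F, c F != 0 -> (sumv F <= a)%MM) ->
  kd mulv (unfine a c) = unfine a (bd c).
Proof.
move=> cS; apply/ffunP=> F; rewrite kdE ffunE bdE; case: ifP => Fa; last first.
  apply: big1 => g gF; rewrite ffunE sumv_leU1 // Fa /= raddf0; exact: sgn0.
rewrite scaler_suml; apply: eq_bigr => g gF; rewrite ffunE; case: ifP => gFa; last first.
  have -> : c (g |: F) = 0 by apply: contraFeq gFa => /cS.
  by rewrite raddf0 !sgn0 scale0r.
rewrite /= /mulv -scalerAr -mpolyXD sub_sumvU1 //.
have /andP[_ vg] : (sumv F <= a)%MM && (v g <= a - sumv F)%MM by rewrite -sumv_leU1.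
rewrite addmC submK //; case: pos_in => //=; by rewrite scaleNr.
Qed.

Lemma fine_unfine a c : (forall F, c F != 0 -> (sumv F <= a)%MM) -> fine a (unfine a c) = c.
Proof.
move=> cS; apply/ffunP=> F; rewrite !ffunE; case: ifP => h.
  by rewrite h mcoeffZ mcoeffX eqxx mulr1.
by apply/esym; apply: contraFeq h => /cS.
Qed.

Lemma fine_decomp f : exists s : seq 'X_{1..m}, f = \sum_(a <- s) unfine a (fine a f).
Proof.
pose s := undup (flatten [seq [seq (mu + sumv F)%MM | mu <- msupp (f F)] | F : {set 'I_N}]).
exists s; apply/ffunP=> F; rewrite sum_ffunE; apply/mpolyP=> mu; rewrite raddf_sum /=.
have E a : (unfine a (fine a f) F)@_mu = if a == (mu + sumv F)%MM then (f F)@_mu else 0.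
  rewrite !ffunE; case: ifP => h.
    rewrite ?h mcoeffZ mcoeffX; have [->|ne] := eqVneq a (mu + sumv F)%MM.
      by rewrite addmK eqxx mulr1.
    suff /negPf -> : (a - sumv F)%MM != mu by rewrite mulr0.
    by apply: contraNneq ne => <-; rewrite submK.
  rewrite mcoeff0; case: eqP => // e; move: h; rewrite e lem_addl //.
rewrite (eq_bigr _ (fun a _ => E a)) -big_mkcond /=.
case: (boolP ((mu + sumv F)%MM \in s)) => h.
  rewrite -big_filter filter_pred1_uniq ?undup_uniq // big_seq1 //.
rewrite big1_seq; last by move=> a /andP[/eqP -> ]; rewrite (negPf h).
apply/eqP; apply: contraNT h; rewrite -mcoeff_msupp => h; rewrite mem_undup.
apply/flatten_mapP; exists F; rewrite ?mem_enum //; exact: map_f.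
Qed.

Variables (sigma : 'X_{1..m} -> Prop) (wt : 'X_{1..m} -> int).
Hypothesis wtD : forall mu nu, wt (mu + nu)%MM = wt mu + wt nu.
Hypothesis wt_v : forall g, wt (v g) = 1.

Definition msupp_in (p : P) := forall mu, mu \in msupp p -> sigma mu.
Definition wt_homog (e : int) (p : P) := forall mu, mu \in msupp p -> wt mu = e.

Lemma wt0 : wt 0%MM = 0.
Proof. by apply/eqP; have := wtD 0%MM 0%MM; rewrite addm0 -{1}[wt _]addr0 => /addrI/eqP; rewrite eq_sym. Qed.

Lemma wt_sumv F : wt (sumv F) = #|F|%:Z.
Proof.
rewrite /sumv (big_morph wt wtD wt0) (eq_bigr (fun=> 1)) ?sumr_const //.
by rewrite -[RHS]natz.
Qed.

Lemma additive_msupp_in : additive_pred msupp_in.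
Proof.
split=> [mu|p q hp hq mu /msuppB_le]; first by rewrite msupp0.
by rewrite mem_cat => /orP[/hp|/hq].
Qed.

Lemma additive_wt_homog e : additive_pred (wt_homog e).
Proof.
split=> [mu|p q hp hq mu /msuppB_le]; first by rewrite msupp0.
by rewrite mem_cat => /orP[/hp|/hq].
Qed.

Definition fine_supp a j c := forall F, c F != 0 ->
  [/\ #|F| = j, (sumv F <= a)%MM & sigma (a - sumv F)%MM].

Definition fine_exact a j := forall c, fine_supp a j c -> bd c = 0 ->
  exists2 b, fine_supp a j.+1 b & bd b = c.

Lemma wt_sub_sumv F a : (sumv F <= a)%MM -> wt (a - sumv F)%MM = wt a - #|F|%:Z.
Proof. by move=> h; rewrite -{2}(submK h) wtD wt_sumv addrK. Qed.

Lemma unfine_in a j c : fine_supp a j c ->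
  has_card j (unfine a c) /\
  forall F, msupp_in (unfine a c F) /\ wt_homog (wt a - j%:Z) (unfine a c F).
Proof.
move=> cS.
have h F mu : mu \in msupp (unfine a c F) -> [/\ mu = (a - sumv F)%MM, c F != 0 & (sumv F <= a)%MM].
  rewrite ffunE; case: ifP => h; last by rewrite msupp0.
  rewrite mcoeff_msupp mcoeffZ mcoeffX mulf_eq0 negb_or => /andP[c0].
  by have [<- //|_] := eqVneq (a - sumv F)%MM mu; rewrite eqxx.
split=> [F|F].
  rewrite -msupp_eq0 => nz; have : exists mu, mu \in msupp (unfine a c F).
    by case: (msupp _) nz => // mu s _; exists mu; rewrite inE eqxx.
  by case=> mu /h [_ /cS []].
split=> mu /h [-> /cS [cF h1 h2] _] //.
by rewrite wt_sub_sumv // cF.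
Qed.

Lemma fine_in a j e f : has_card j f -> (forall F, msupp_in (f F) /\ wt_homog e (f F)) ->
  fine_supp a j (fine a f) /\ (fine a f != 0 -> wt a = e + j%:Z).
Proof.
move=> fj fS.
have h F : fine a f F != 0 -> [/\ #|F| = j, (sumv F <= a)%MM, sigma (a - sumv F)%MM & wt a = e + j%:Z].
  rewrite ffunE; case: ifP; rewrite ?eqxx // => Fa; rewrite -mcoeff_msupp => hm.
  have [h1 h2] := fS F.
  have cF : #|F| = j by apply: fj; apply: contraTneq hm => ->; rewrite msupp0.
  split=> //; first exact: h1.
  by rewrite -(h2 _ hm) wt_sub_sumv // cF subrK.
split=> [F /h[]//|]; apply: contraNeq => ne; apply/eqP/ffunP=> F; rewrite [RHS]ffunE.
by apply: contraNeq ne => /h [_ _ _ ->].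
Qed.

(** Finitely many fine degrees occur in f; a bounding chain is found in each, and they are added
    up. *)
Lemma kexact_of_fine j e :
  (forall a, wt a = e + j%:Z -> fine_exact a j) -> kexact mulv msupp_in wt_homog j e.
Proof.
move=> ex f fj fS fc; have [s fE] := fine_decomp f.
suff [b [bj bS bE]] : exists b, [/\ has_card j.+1 b,
    (forall A, msupp_in (b A) /\ wt_homog (e - 1) (b A)) &
    kd mulv b = \sum_(a <- s) unfine a (fine a f)].
  by exists b; rewrite [f in _ = f]fE.
elim: s {fE} => [|a s [b [bj bS bE]]].
  exists 0; rewrite raddf0 big_nil; split=> //; first exact: has_card0.
  by move=> A; rewrite ffunE; split; [case: additive_msupp_in | case: (additive_wt_homog (e - 1))].
have [fS1 fw] := fine_in a fj fS.
have fb : bd (fine a f) = 0 by rewrite -fine_kd fc; apply/ffunP=> F; rewrite !ffunE mcoeff0 if_same.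
(* A zero component says nothing about wt a, hence the proviso c != 0. *)
have [c cS cE] : exists2 c, fine_supp a j.+1 c /\ (c != 0 -> wt a = e + j%:Z) & bd c = fine a f.
  have [f0|/fw wa] := eqVneq (fine a f) 0.
    exists 0; last by rewrite raddf0 f0.
    by rewrite eqxx; split=> // F; rewrite ffunE eqxx.
  by have [c cS cE] := ex a wa _ fS1 fb; exists c.
case: cS => cS cw.
have [uj uS] := unfine_in cS.
exists (unfine a c + b); split.
- exact: has_cardD uj bj.
- move=> A; rewrite ffunE; have [u1 u2] := uS A; have [b1 b2] := bS A; split.
    exact: (additive_predD additive_msupp_in u1 b1).
  have [c0|/cw wa] := eqVneq c 0.
    have -> : unfine a c A = 0 by rewrite ffunE c0 ffunE scale0r if_same.
    by rewrite add0r.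
  have e1 : wt a - j.+1%:Z = e - 1 by rewrite wa -addn1 PoszD opprD addrA addrK.
  by rewrite e1 in u2; apply: (additive_predD (additive_wt_homog (e - 1)) u2 b2).
- rewrite raddfD /= bE big_cons kd_unfine ?cE // => F /cS [] //.
Qed.

Lemma fine_of_kexact j e a : wt a = e + j%:Z ->
  kexact mulv msupp_in wt_homog j e -> fine_exact a j.
Proof.
move=> wa ex c cS cc.
have [uj uS] := unfine_in cS.
have cS' F : c F != 0 -> (sumv F <= a)%MM by case/cS.
have [|||b [bj bS bE]] := ex (unfine a c) => //.
- by move=> F; move: (uS F); rewrite wa addrK.
- by rewrite kd_unfine // cc; apply/ffunP=> F; rewrite !ffunE scale0r if_same.
exists (fine a b); first by case: (fine_in a bj bS).
by rewrite -fine_kd bE fine_unfine.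
Qed.

End MonomialKoszul.

Section PolyKoszul.
Local Open Scope ring_scope.
Variables (k : fieldType) (N : nat).
Local Notation S := {mpoly k[N]}.
Local Notation ud := (fun g : 'I_N => U_(g)%MM).

(** Integers, since shifts make negative degrees occur. *)
Definition degz (mu : 'X_{1..N}) : int := (mdeg mu)%:Z.
Definition homogz : int -> S -> Prop := wt_homog degz.

Lemma sumv_ud F i : (@sumv N N ud F) i = (i \in F).
Proof.
rewrite /sumv (big_morph (fun mu : 'X_{1..N} => mu i) (fun x y => mnmDE i x y) (mnm0E i)).
case iF: (i \in F).
  rewrite (bigD1 i) //= mnm1E eqxx big1 ?addn0 // => g /andP[_ gi].
  by rewrite mnm1E (negPf gi).
rewrite big1 // => g gF; rewrite mnm1E; case: eqP gF => // ->; by rewrite iF.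
Qed.

(** In fine degree a the relevant F are the subsets of the support of a, a full simplex contracted
    by any g with a g > 0. The exception j = e = 0 is the fine degree 0, where only the empty set
    occurs. *)
Lemma koszul_exact j e : (j != 0%N) || (e != 0) ->
  kexact (@mulv k N N ud) (fun=> True) homogz j e.
Proof.
move=> je f fj fS fc.
have wD (mu nu : 'X_{1..N}) : degz (mu + nu)%MM = degz mu + degz nu by rewrite /degz mdegD.
have wv (g : 'I_N) : degz U_(g)%MM = 1 by rewrite /degz mdeg1.
have [||||b [bj bS bE]] := @kexact_of_fine k N N ud (fun=> True) degz wD wv j e _ f => //.
- move=> a wa c cS cc.
  have [c0|/eqP c0] := eqVneq c 0.
    by exists 0; [move=> F; rewrite ffunE eqxx | rewrite raddf0 c0].
  have [g ga] : exists g, (0 < a g)%N.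
    apply/existsP; apply: contraPT c0; rewrite negb_exists => /forallP a0 []; apply/ffunP=> F.
    have {}a0 : a = 0%MM by apply/mnmP=> i; have := a0 i; rewrite -eqn0Ngt mnm0E => /eqP.
    rewrite ffunE; apply: contraTeq je => /cS [cF /mnm_lepP h _].
    have F0 : F = set0.
      apply/setP=> i; have := h i; rewrite sumv_ud a0 mnm0E inE.
      by case: (i \in F).
    move: cF wa; rewrite F0 cards0 a0 /degz mdeg0 => <-; rewrite addr0 => <-.
    by rewrite eqxx.
  exists (wedge g c); last by have := bd_wedge g c; rewrite cc raddf0 addr0.
  move=> F; rewrite ffunE; case: ifP => gF; rewrite ?eqxx // sgn_eq0 => /cS [cF /mnm_lepP h _].
  split=> //; first by rewrite (cardsD1 g F) gF cF.
  apply/mnm_lepP=> i; have := h i; rewrite !sumv_ud !inE.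
  by have [->|//] := eqVneq i g; rewrite gF.
- by move=> F; split=> //; case: (fS F).
by exists b; split=> // A; split=> //; case: (bS A).
Qed.
End PolyKoszul.

(** * Graded free resolutions and Koszul homology *)

Section HomogComponents.
Local Open Scope ring_scope.
Variables (k : fieldType) (N : nat).
Local Notation S := {mpoly k[N]}.
Implicit Types (p q : S) (mu : 'X_{1..N}).

Lemma homogz_add e : additive_pred (@homogz k N e).
Proof. exact: additive_wt_homog. Qed.

Lemma homogzM e e' p q : homogz e p -> homogz e' q -> homogz (e + e') (p * q).
Proof.
move=> hp hq mu /msuppM_le/allpairsP[[m1 m2] /= [h1 h2 ->]].
by rewrite /degz mdegD PoszD -/(degz m1) -/(degz m2) (hp _ h1) (hq _ h2).
Qed.

Lemma homogz1X g : homogz 1 ('X_g : S).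
Proof. by move=> mu; rewrite msuppX inE => /eqP ->; rewrite /degz mdeg1. Qed.

Lemma homogz_neg e p : homogz e p -> e < 0 -> p = 0.
Proof.
move=> h e0; apply/eqP; rewrite -msupp_eq0; case E: (msupp p) => [//|mu s].
have := h mu; rewrite E inE eqxx => /(_ isT) hm; move: e0; rewrite -hm /degz.
by rewrite ltNge.
Qed.

Lemma homogz_const p : homogz 0 p -> p = (p@_0%MM)%:MP.
Proof.
move=> h; apply/mpolyP=> mu; rewrite mcoeffC; have [->|mu0] := eqVneq mu 0%MM; first by rewrite ?eqxx mulr1.
rewrite mulr0; apply: contraNeq mu0; rewrite -mcoeff_msupp => /h.
by rewrite /degz => /eqP; rewrite eqz_nat mdeg_eq0.
Qed.

Definition compz (e : int) p : S := \sum_(mu <- msupp p | degz mu == e) p@_mu *: 'X_[mu].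

Lemma mcoeff_compz e p mu : (compz e p)@_mu = if degz mu == e then p@_mu else 0.
Proof.
rewrite /compz raddf_sum /=.
have E nu : (p@_nu *: 'X_[nu])@_mu = if nu == mu then p@_mu else 0.
  by rewrite mcoeffZ mcoeffX; case: eqP => [->|]; rewrite ?mulr1 ?mulr0.
rewrite (eq_bigr _ (fun nu _ => E nu)) -big_mkcondr /=.
case: ifP => h.
  case: (boolP (mu \in msupp p)) => hm.
    rewrite -big_filter (eq_filter (a2 := pred1 mu)); last first.
      by move=> nu /=; have [->|_] := eqVneq nu mu; rewrite ?h ?andbF.
    by rewrite filter_pred1_uniq ?msupp_uniq // big_seq1.
  by rewrite (memN_msupp_eq0 hm) big1_eq.
by rewrite big1 // => nu /andP[h1 /eqP e1]; move: h1; rewrite e1 h.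
Qed.

Fact compz_is_zmod_morphism e : zmod_morphism (compz e).
Proof.
by move=> p q; apply/mpolyP=> mu; rewrite mcoeffB !mcoeff_compz mcoeffB; case: ifP; rewrite ?subr0.
Qed.
HB.instance Definition _ e := GRing.isZmodMorphism.Build S S (compz e) (compz_is_zmod_morphism e).

Lemma homogz_compz e p : homogz e (compz e p).
Proof. by move=> mu; rewrite mcoeff_msupp mcoeff_compz; case: ifP => [/eqP//|]; rewrite eqxx. Qed.

Lemma compz_id e p : homogz e p -> compz e p = p.
Proof.
move=> h; apply/mpolyP=> mu; rewrite mcoeff_compz; case: eqP => // ne.
by apply/esym/memN_msupp_eq0; apply/negP => /h.
Qed.

Lemma compz_ne e e' p : homogz e p -> e != e' -> compz e' p = 0.
Proof.
move=> h ne; apply/mpolyP=> mu; rewrite mcoeff_compz mcoeff0; case: eqP => // e1.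
apply: contraNeq ne; rewrite -mcoeff_msupp => /h <-; exact/eqP.
Qed.

Lemma compzM e e' p q : homogz e' q -> compz (e + e') (p * q) = compz e p * q.
Proof.
move=> hq; rewrite {1}(mpolyE p) mulr_suml raddf_sum /= mulr_suml [RHS]big_mkcond /=.
apply: eq_bigr => mu _.
have h : homogz (degz mu + e') (p@_mu *: 'X_[mu] * q).
  apply: homogzM => // nu; rewrite mcoeff_msupp mcoeffZ mcoeffX; have [->//|_] := eqVneq mu nu.
  by rewrite mulr0 eqxx.
case: eqP => [<-|ne]; first exact: compz_id.
apply: compz_ne h _; by rewrite (inj_eq (addIr _)); apply/eqP.
Qed.

End HomogComponents.

Section GradedRows.
Local Open Scope ring_scope.
Variables (k : fieldType) (N : nat).
Local Notation S := {mpoly k[N]}.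
Local Notation ud := (fun g : 'I_N => U_(g)%MM).

Definition mulX (p : nat) (g : 'I_N) (u : 'rV[S]_p) : 'rV[S]_p := ('X_g : S) *: u.
Fact mulX_is_zmod_morphism p g : zmod_morphism (@mulX p g).
Proof. by move=> u w; rewrite /mulX scalerBr. Qed.
HB.instance Definition _ p g := GRing.isZmodMorphism.Build 'rV[S]_p 'rV[S]_p (@mulX p g)
  (@mulX_is_zmod_morphism p g).

Lemma mulXC p g h (u : 'rV_p) : mulX g (mulX h u) = mulX h (mulX g u).
Proof. by rewrite /mulX !scalerA mulrC. Qed.

Definition rowh p (sh : 'I_p -> nat) (e : int) (u : 'rV[S]_p) :=
  forall b, homogz (e - (sh b)%:Z) (u 0 b).

Lemma rowh_add p (sh : 'I_p -> nat) e : additive_pred (rowh sh e).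
Proof.
split=> [b|u w hu hw b]; have [h0 hB] := @homogz_add k N (e - (sh b)%:Z); rewrite !mxE //.
exact: hB.
Qed.

Lemma rowh_mulX p (sh : 'I_p -> nat) e g u : rowh sh e u -> rowh sh (e + 1) (mulX g u).
Proof.
move=> h b; rewrite mxE addrAC addrC; apply: homogzM (h b); exact: homogz1X.
Qed.

Definition coordr p (b : 'I_p) (u : 'rV[S]_p) : S := u 0 b.
Fact coordr_is_zmod_morphism p b : zmod_morphism (@coordr p b).
Proof. by move=> u w; rewrite /coordr !mxE. Qed.
HB.instance Definition _ p b := GRing.isZmodMorphism.Build 'rV[S]_p S (@coordr p b)
  (@coordr_is_zmod_morphism p b).

Lemma coordr_mulX p b g (u : 'rV_p) : coordr b (mulX g u) = mulv ud g (coordr b u).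
Proof. by rewrite /coordr mxE. Qed.

(** The last hypothesis excludes the only homology of the summand S(- sh b): constants in position 0
    and degree sh b. *)
Lemma row_koszul p (sh : 'I_p -> nat) j e (f : {ffun {set 'I_N} -> 'rV[S]_p}) :
  has_card j f -> (forall A, rowh sh e (f A)) -> kd (@mulX p) f = 0 ->
  (forall b, j = 0%N -> e = (sh b)%:Z -> forall A, f A 0 b = 0) ->
  exists b, [/\ has_card j.+1 b, (forall A, rowh sh (e - 1) (b A)) & kd (@mulX p) b = f].
Proof.
move=> fj fH fc f0.
have ex b : exists h : {ffun {set 'I_N} -> S}, [/\ has_card j.+1 h,
   (forall A, homogz (e - (sh b)%:Z - 1) (h A)) & kd (mulv ud) h = cmap (coordr b) f].
  have [je|] := boolP ((j != 0%N) || (e - (sh b)%:Z != 0)).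
    have [|||h [h1 h2 h3]] := koszul_exact je (f := cmap (coordr b) f).
    - exact: has_card_cmap.
    - by move=> A; split=> //; rewrite ffunE; apply: fH.
    - by rewrite (kd_cmap _ (coordr_mulX b)) fc; apply/ffunP=> A; rewrite !ffunE raddf0.
    by exists h; split=> // A; case: (h2 A).
  rewrite negb_or !negbK subr_eq0 => /andP[/eqP j0 /eqP e0].
  exists 0; split; [exact: has_card0 | by move=> A; rewrite ffunE; case: (@homogz_add k N (e - (sh b)%:Z - 1)) |].
  by rewrite raddf0; apply/ffunP=> A; rewrite !ffunE /= /coordr f0.
have [h hh] := fin_all_exists ex.
exists [ffun A : {set 'I_N} => \row_b h b A]; split.
- move=> A; rewrite ffunE => /rV0Pn[b]; rewrite mxE; by case: (hh b) => h1 _ _ /h1.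
- by move=> A b; rewrite ffunE mxE addrAC; case: (hh b).
- apply/ffunP=> A; apply/rowP=> b.
  have := kd_cmap [ffun A : {set 'I_N} => \row_b h b A] (coordr_mulX b).
  have -> : cmap (coordr b) [ffun A : {set 'I_N} => \row_b h b A] = h b.
    by apply/ffunP=> B; rewrite !ffunE /= /coordr mxE.
  have [_ _ ->] := hh b; by move/ffunP/(_ A); rewrite !ffunE.
Qed.

Definition mxh p q (shp : 'I_p -> nat) (shq : 'I_q -> nat) (Mx : 'M[S]_(p, q)) :=
  forall a b, homogz ((shp a)%:Z - (shq b)%:Z) (Mx a b).

Lemma rowh_mul p q shp shq (Mx : 'M[S]_(p, q)) e u : mxh shp shq Mx ->
  rowh shp e u -> rowh shq e (u *m Mx).
Proof.
move=> hM hu b; rewrite mxE; apply: additive_pred_sum; first exact: homogz_add.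
move=> a _; have := homogzM (hu a) (hM a b); by rewrite addrA subrK.
Qed.

Definition compr p (sh : 'I_p -> nat) (e : int) (u : 'rV[S]_p) : 'rV[S]_p :=
  \row_b compz (e - (sh b)%:Z) (u 0 b).

Lemma rowh_compr p (sh : 'I_p -> nat) e u : rowh sh e (compr sh e u).
Proof. by move=> b; rewrite mxE; apply: homogz_compz. Qed.

Lemma compr_id p (sh : 'I_p -> nat) e u : rowh sh e u -> compr sh e u = u.
Proof. by move=> h; apply/rowP=> b; rewrite mxE compz_id. Qed.

Lemma compr_mul p q shp shq (Mx : 'M[S]_(p, q)) e u : mxh shp shq Mx ->
  compr shq e (u *m Mx) = compr shp e u *m Mx.
Proof.
move=> hM; apply/rowP=> b; rewrite !mxE raddf_sum /=; apply: eq_bigr => a _.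
by rewrite mxE -(compzM _ _ (hM a b)) addrA subrK.
Qed.

Lemma compr_sum p (sh : 'I_p -> nat) u : exists B, u = \sum_(e < B) compr sh e%:Z u.
Proof.
pose B := (\sum_b (msize (u 0%R b) + sh b))%N; exists B.
apply/rowP=> b; rewrite summxE; apply/mpolyP=> mu; rewrite raddf_sum /=.
under eq_bigr do rewrite mxE mcoeff_compz.
rewrite -big_mkcond /=; have [hm|hm] := boolP (mu \in msupp (u 0 b)); last first.
  by rewrite (memN_msupp_eq0 hm) big1_eq.
have lt : (mdeg mu + sh b < B)%N.
  rewrite /B (bigD1 b) //= (leq_trans _ (leq_addr _ _)) // -addSn leq_add2r.
  exact: msize_mdeg_lt.
rewrite (big_pred1 (Ordinal lt)) // => e; rewrite /degz /= -val_eqE /= eq_sym subr_eq -PoszD eqz_nat.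
by [].
Qed.

Lemma mul_is_zmod_morphism p q (Mx : 'M[S]_(p, q)) : zmod_morphism (fun u : 'rV[S]_p => u *m Mx).
Proof. by move=> u w; rewrite mulmxBl. Qed.

Definition mulr_mx p q (Mx : 'M[S]_(p, q)) (u : 'rV[S]_p) := u *m Mx.
HB.instance Definition _ p q (Mx : 'M[S]_(p, q)) :=
  GRing.isZmodMorphism.Build 'rV[S]_p 'rV[S]_q (mulr_mx Mx) (mul_is_zmod_morphism Mx).

Lemma mulr_mxX p q (Mx : 'M[S]_(p, q)) g u : mulr_mx Mx (mulX g u) = mulX g (mulr_mx Mx u).
Proof. by rewrite /mulX /mulr_mx scalemxAl. Qed.

Section MatrixStep.
Variables (p q : nat) (shp : 'I_p -> nat) (shq : 'I_q -> nat) (Mx : 'M[S]_(p, q)).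
Variable (Z : 'rV[S]_q -> Prop).
Hypothesis hM : mxh shp shq Mx.
Hypothesis imM : forall z, Z z <-> exists u, z = u *m Mx.
Let ker (u : 'rV[S]_p) := mulr_mx Mx u = 0.

Lemma mx_lift e z : Z z -> rowh shq e z -> exists2 x, rowh shp e x & mulr_mx Mx x = z.
Proof.
move=> /imM [u zu] hz; exists (compr shp e u); first exact: rowh_compr.
by rewrite /mulr_mx -(compr_mul _ _ hM) -zu compr_id.
Qed.

(** Beyond T the free module has no Koszul homology, so homology of the image in position j + 1 and
    degree e comes from the kernel in position j and degree e + 1. *)
Lemma kexact_mx_image (T : int) : (forall a, (shp a)%:Z <= T) ->
  (forall j e, T + 1 < e -> kexact (@mulX p) ker (rowh shp) j e) ->
  forall j e, T < e -> kexact (@mulX q) Z (rowh shq) j e.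
Proof.
move=> hT hK.
have hZ x : Z (mulr_mx Mx x) by apply/imM; exists x.
have ph e x : rowh shp e x -> rowh shq e (mulr_mx Mx x) by apply: rowh_mul.
case=> [|j] e Te.
  apply: (kexact_image0 (phi := mulr_mx Mx) (YF := @mulX p) (HF := rowh shp)) => //.
  - exact: mulr_mxX.
  - exact: rowh_add.
  - exact: mx_lift.
  - move=> f fj fH fc; apply: row_koszul => // b _ eb; move: (hT b) Te; rewrite eb.
    by move=> h1 /(le_lt_trans h1); rewrite ltxx.
apply: (kexact_image (phi := mulr_mx Mx) (YF := @mulX p) (HF := rowh shp)) => //.
- exact: mulXC.
- exact: mulr_mxX.
- exact: rowh_add.
- by move=> *; apply: rowh_mulX.
- exact: mx_lift.
- by move=> f fj fH fc; apply: row_koszul.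
- by apply: hK; rewrite ltrD2r.
Qed.

(** The first hypothesis is minimality: relations have no nonzero constant entries, so the homology
    of the free module does not meet the kernel. *)
Lemma kexact_mx_kernel j e :
  (forall u, ker u -> rowh shp e u -> forall b, e = (shp b)%:Z -> u 0 b = 0) ->
  kexact (@mulX q) Z (rowh shq) j.+1 (e - 1) -> kexact (@mulX p) ker (rowh shp) j e.
Proof.
move=> hmin hK.
have hZ x : Z (mulr_mx Mx x) by apply/imM; exists x.
have ph e' x : rowh shp e' x -> rowh shq e' (mulr_mx Mx x) by apply: rowh_mul.
apply: (kexact_kernel (phi := mulr_mx Mx) (YF := @mulX p) (HF := rowh shp) _ _ _ _ _ _ _ _ hK) => //.
- exact: mulXC.
- exact: mulr_mxX.
- exact: rowh_add.
- by move=> *; apply: rowh_mulX.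
- exact: mx_lift.
- move=> f fj fH fc; apply: row_koszul => // [A|b j0 eb A]; first by case: (fH A).
  by case: (fH A) => h1 h2; apply: hmin.
Qed.

End MatrixStep.

End GradedRows.

Section FiniteSpan.
Local Open Scope ring_scope.

Lemma row_col_mx (R : Type) m1 m2 n (A : 'M[R]_(m1, n)) (B : 'M[R]_(m2, n)) i :
  row i (col_mx A B) = match split i with inl a => row a A | inr b => row b B end.
Proof. by apply/rowP=> j; rewrite !mxE; case: split => a; rewrite mxE. Qed.

(** W is an arbitrary predicate: vectors outside the current span are added, and the rank bounds how
    often this happens. *)
Lemma finite_span (k : fieldType) n (W : 'rV[k]_n -> Prop) :
  exists m (B : 'M[k]_(m, n)), (forall i, W (row i B)) /\ forall w, W w -> (w <= B)%MS.
Proof.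
suff H t : (exists m (B : 'M[k]_(m, n)), (forall i, W (row i B)) /\ (t <= \rank B)%N) \/
    exists m (B : 'M[k]_(m, n)), (forall i, W (row i B)) /\ forall w, W w -> (w <= B)%MS.
  case: (H n.+1) => // -[m [B [_ h]]].
  by have := leq_trans h (rank_leq_col B); rewrite ltnn.
elim: t => [|t IH]; first by left; exists 0%N, 0; split=> //; case.
case: IH => [[m [B [WB rB]]]|]; last by right.
have [hW|nW] := classic (forall w, W w -> (w <= B)%MS).
  by right; exists m, B.
have [w hw] := not_all_ex_not _ _ nW; have [Ww nw] := imply_to_and _ _ hw.
left; exists (m + 1)%N, (col_mx B w); split.
  move=> i; rewrite row_col_mx; case: splitP => a _ //=.
  by rewrite (_ : row a w = w) //; apply/rowP=> b; rewrite mxE ord1.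
apply: leq_ltn_trans rB _; rewrite -addsmxE.
apply: rank_ltmx; rewrite ltmxE addsmxSl /= addsmx_sub submx_refl /=.
exact/negP.
Qed.

Lemma exists_min_nat (P : nat -> Prop) : (exists p, P p) ->
  exists p, P p /\ forall p', (p' < p)%N -> ~ P p'.
Proof.
case=> p; elim/ltn_ind: p => p IH Pp.
have [h|nh] := classic (forall p', (p' < p)%N -> ~ P p'); first by exists p.
have [p' hp] := not_all_ex_not _ _ nh; have [lt /NNPP Pp'] := imply_to_and _ _ hp.
exact: IH lt Pp'.
Qed.

End FiniteSpan.

(** * Minimal generators of graded submodules of free modules *)

Section MinimalGenerators.
Local Open Scope ring_scope.
Variables (k : fieldType) (N : nat).
Local Notation S := {mpoly k[N]}.
Variables (q : nat) (shq : 'I_q -> nat) (Z : 'rV[S]_q -> Prop).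
Hypothesis Zadd : additive_pred Z.
Hypothesis Zscale : forall (s : S) z, Z z -> Z (s *: z).
Hypothesis Zcomp : forall e z, Z z -> Z (compr shq e z).

Definition gen_family (T : nat) p (shp : 'I_p -> nat) (Mx : 'M[S]_(p, q)) :=
  [/\ forall a, Z (row a Mx), mxh shp shq Mx & forall a, (shp a <= T)%N].

Definition generates p (Mx : 'M[S]_(p, q)) := forall z, Z z -> exists u, z = u *m Mx.

Lemma Z_mul p (Mx : 'M[S]_(p, q)) u : (forall a, Z (row a Mx)) -> Z (u *m Mx).
Proof.
by move=> h; rewrite mulmx_sum_row; apply: additive_pred_sum => // a _; apply: Zscale.
Qed.

Section Encode.
Variable T : nat.
Local Notation I := ('I_q * 'X_{1..N < T.+1})%type.

(** Injective on homogeneous rows of degree at most T, so graded pieces are finite-dimensional.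
    Generators are collected degree by degree, up to the bound that Koszul vanishing gives. *)
Definition enc (z : 'rV[S]_q) : 'rV[k]_#|{: I}| :=
  \row_i (z 0 (enum_val i).1)@_(bmnm (enum_val i).2).

Lemma enc_inj (e : nat) z z' : (e <= T)%N -> rowh shq e%:Z z -> rowh shq e%:Z z' ->
  enc z = enc z' -> z = z'.
Proof.
move=> eT hz hz' E; apply/rowP=> b; apply/mpolyP=> mu.
have [hmu|hmu] := ltnP (mdeg mu) T.+1.
  have := congr1 (fun w : 'rV_ _ => w 0 (enum_rank ((b, BMultinom hmu) : I))) E.
  by rewrite !mxE enum_rankK.
have h0 w : rowh shq e%:Z w -> (w 0 b)@_mu = 0.
  move=> hw; apply/memN_msupp_eq0/negP => /hw; rewrite /degz => /eqP.
  rewrite eq_sym subr_eq -PoszD eqz_nat => /eqP ee.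
  by move: hmu; rewrite ltnNge (leq_trans _ eT) // ee leq_addr.
by rewrite !h0.
Qed.

Lemma enc_sum p (c : 'rV[k]_p) (z : 'I_p -> 'rV[S]_q) :
  enc (\sum_a (c 0 a)%:MP *: z a) = \sum_a c 0 a *: enc (z a).
Proof.
apply/rowP=> i; rewrite mxE !summxE raddf_sum /=; apply: eq_bigr => a _.
by rewrite !mxE mcoeffCM.
Qed.
End Encode.

Lemma gens_deg (e : nat) : exists p (Mx : 'M[S]_(p, q)),
  (forall a, Z (row a Mx) /\ rowh shq e%:Z (row a Mx)) /\
  forall z, Z z -> rowh shq e%:Z z -> exists u, z = u *m Mx.
Proof.
have [p [B [WB spB]]] :=
  finite_span (fun w => exists z, [/\ Z z, rowh shq e%:Z z & w = enc e z]).
have [z hz] := fin_all_exists WB.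
pose Mx : 'M[S]_(p, q) := \matrix_a z a.
have rM a : row a Mx = z a by rewrite rowK.
exists p, Mx; split=> [a|z0 Zz0 hz0]; first by rewrite rM; case: (hz a).
have /submxP[c cE] : (enc e z0 <= B)%MS by apply: spB; exists z0.
exists (map_mx (@mpolyC N k) c).
have E : map_mx (@mpolyC N k) c *m Mx = \sum_a (c 0 a)%:MP *: z a.
  by rewrite mulmx_sum_row; apply: eq_bigr => a _; rewrite mxE rM.
rewrite E; apply: (@enc_inj e e) => //.
  apply: additive_pred_sum; first exact: rowh_add.
  move=> a _ b; rewrite mxE -[X in homogz X _]add0r; apply: homogzM; last by case: (hz a).
  move=> mu; rewrite msuppC; case: ifP; rewrite ?inE // => _ /eqP ->.
  by rewrite /degz mdeg0.
rewrite enc_sum cE mulmx_sum_row; apply: eq_bigr => a _.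
by case: (hz a) => _ _ ->.
Qed.

Lemma gens_upto T E : (E <= T.+1)%N -> exists p shp (Mx : 'M[S]_(p, q)),
  gen_family T shp Mx /\
  forall e, (e < E)%N -> forall z, Z z -> rowh shq e%:Z z -> exists u, z = u *m Mx.
Proof.
elim: E => [|E IH] ET.
  by exists 0%N, (fun=> 0%N), 0; split=> //; split=> // -[].
have [p [shp [Mx [[h1 h2 h3] h4]]]] := IH (ltnW ET).
have [p' [Mx' [h1' h4']]] := gens_deg E.
exists (p + p')%N, (fun a => if split a is inl i then shp i else E), (col_mx Mx Mx').
split; first split.
- by move=> a; rewrite row_col_mx; case: splitP => i _ //; case: (h1' i).
- move=> a b; rewrite mxE; case: splitP => i _ //.
  by case: (h1' i) => _ /(_ b); rewrite mxE.
- by move=> a; case: splitP.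
move=> e; rewrite ltnS leq_eqVlt => /orP[/eqP ->|lt] z Zz hz.
  have [u ->] := h4' z Zz hz; exists (row_mx 0 u).
  by rewrite mul_row_col mul0mx add0r.
have [u ->] := h4 e lt z Zz hz; exists (row_mx u 0).
by rewrite mul_row_col mul0mx addr0.
Qed.

(* In degree [e], [Z] is contained in [m Z], with [m] the irrelevant ideal. *)
Definition multiples_at (e : int) := forall z, Z z -> rowh shq e z ->
  exists zs : 'I_N -> 'rV[S]_q, (forall g, Z (zs g) /\ rowh shq (e - 1) (zs g)) /\
    z = \sum_g mulX g (zs g).

(** z is placed at the empty set, where it is a cycle; the values at singletons of a chain bounding
    it are the rows [zs g]. *)
Lemma kexact_multiples e : kexact (@mulX k N q) Z (rowh shq) 0 e -> multiples_at e.
Proof.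
move=> ex z Zz hz.
pose f := [ffun A : {set 'I_N} => if A == set0 then z else 0].
have [|||b [bj bS bE]] := ex f.
- by move=> A; rewrite ffunE; have [->|] := eqVneq A set0; rewrite ?cards0 ?eqxx.
- move=> A; rewrite ffunE; case: ifP => _ //; split; first by case: Zadd.
  by case: (rowh_add k N shq e).
- apply/ffunP=> A; rewrite kdE ffunE; apply: big1 => g gA; rewrite ffunE.
  rewrite ifF ?raddf0 ?sgn0 //; apply/negP=> /eqP h; have := setU11 g A.
  by rewrite h inE.
exists (fun g => b [set g]); split=> [g|]; first exact: bS.
have := congr1 (fun h : {ffun {set 'I_N} -> 'rV[S]_q} => h set0) bE.
rewrite kdE ffunE eqxx => <-; rewrite [in RHS](eq_bigl (fun g => g \notin set0)); last first.
  by move=> g; rewrite inE.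
apply: eq_bigr => g _; rewrite setU0 /pos_in.
rewrite (_ : [set h in set0 | _] = set0) ?cards0 //.
by apply/setP=> h; rewrite !inE.
Qed.

(** Graded Nakayama lemma above degree T. *)
Lemma gens_all T p (shp : 'I_p -> nat) (Mx : 'M[S]_(p, q)) :
  (forall e : int, T%:Z < e -> multiples_at e) ->
  (forall e, (e < T.+1)%N -> forall z, Z z -> rowh shq e%:Z z -> exists u, z = u *m Mx) ->
  generates Mx.
Proof.
move=> hm hT.
have hall (e : nat) z : Z z -> rowh shq e%:Z z -> exists u, z = u *m Mx.
  elim: e z => [|e IH] z Zz hz; first exact: hT hz.
  have [lt|lt] := ltnP e.+1 T.+1; first exact: hT hz.
  have [zs [hzs ->]] := hm e.+1%:Z lt z Zz hz.
  have ex g : exists u, zs g = u *m Mx.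
    by apply: IH; case: (hzs g) => // _; rewrite -addn1 PoszD addrK.
  have [us hu] := fin_all_exists ex.
  exists (\sum_g mulX g (us g)); rewrite mulmx_suml; apply: eq_bigr => g _.
  by rewrite hu /mulX scalemxAl.
move=> z Zz; have [B ->] := compr_sum shq z.
have ex (e : 'I_B) : exists u, compr shq e%:Z z = u *m Mx.
  by apply: (hall e); [apply: Zcomp | apply: rowh_compr].
have [us hu] := fin_all_exists ex.
exists (\sum_e us e); rewrite mulmx_suml; apply: eq_bigr => e _; exact: hu.
Qed.

(** Graded Nakayama lemma, with degrees bounded below by 0; it makes the resolution stop. *)
Lemma gens_zero : (forall e, multiples_at e) -> forall z, Z z -> z = 0.
Proof.
move=> hm.
have h0 (e : int) (z : 'rV[S]_q) : e < 0 -> rowh shq e z -> z = 0.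
  move=> e0 hz; apply/rowP=> b; rewrite [RHS]mxE; apply: homogz_neg (hz b) _.
  by apply: le_lt_trans e0; rewrite lerBlDr lerDl.
have hall (e : nat) z : Z z -> rowh shq e%:Z z -> z = 0.
  elim: e z => [|e IH] z Zz hz; have [zs [hzs ->]] := hm _ z Zz hz; apply: big1 => g _.
    by have [_ h] := hzs g; rewrite (h0 _ _ _ h) // raddf0.
  have [Zg hg] := hzs g; rewrite (IH (zs g)) ?raddf0 //.
  by move: hg; rewrite -addn1 PoszD addrK.
move=> z Zz; have [B ->] := compr_sum shq z; apply: big1 => e _; apply: (hall e).
  exact: Zcomp.
exact: rowh_compr.
Qed.

Definition min_gens T p shp (Mx : 'M[S]_(p, q)) :=
  [/\ gen_family T shp Mx, generates Mx &
   forall (e : int) u, u *m Mx = 0 -> rowh shp e u -> forall b, e = (shp b)%:Z -> u 0 b = 0].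

Lemma mul_lift_row p (Mx : 'M[S]_(p.+1, q)) u b :
  u *m Mx = u 0 b *: row b Mx + col' b u *m row' b Mx.
Proof.
apply/rowP=> i; rewrite !mxE (bigD1_ord b) //=; congr (_ + _).
by apply: eq_bigr => a _; rewrite !mxE.
Qed.

(* A generating family of minimal cardinality is minimal in the graded sense: a relation with a
   nonzero constant coefficient would make a generator redundant. *)
Lemma exists_min_gens T :
  (forall e : int, T%:Z < e -> multiples_at e) ->
  exists p shp (Mx : 'M[S]_(p, q)), min_gens T shp Mx /\
   ((forall e, multiples_at e) -> p = 0%N).
Proof.
move=> hm.
pose GP p := exists shp (Mx : 'M[S]_(p, q)), gen_family T shp Mx /\ generates Mx.
have [|p [[shp [Mx [fM gM]]] minp]] := @exists_min_nat GP.
  have [p [shp [Mx [fM gM]]]] := gens_upto (leqnn T.+1).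
  by exists p, shp, Mx; split=> //; apply: gens_all gM.
exists p, shp, Mx; split; last first.
  move=> hm'; apply/eqP; apply/negP=> /negP; rewrite -lt0n => /minp; apply.
  exists (fun=> 0%N), 0; split; first by split=> // -[].
  by move=> z /(gens_zero hm') ->; exists 0; rewrite mul0mx.
split=> // e u uM hu b eb; apply/eqP; apply/negP=> /negP ub.
case: p shp Mx fM gM minp u uM hu b eb ub => [|p] shp Mx; first by move=> ? ? ? ? ? ? [].
move=> [h1 h2 h3] gM minp u uM hu b eb ub; apply: (minp p (ltnSn p)).
exists (fun a => shp (lift b a)), (row' b Mx); split.
  split=> [a|a i|a] //; last by rewrite mxE.
  by have := h1 (lift b a); congr Z; apply/rowP=> i; rewrite !mxE.
pose c := (u 0 b)@_0%MM.
have uc : u 0 b = c%:MP by apply: homogz_const; have := hu b; rewrite eb subrr.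
have c0 : c != 0 by apply: contraNneq ub => c0; rewrite uc c0 mpolyC0.
have rb : row b Mx = ((- c^-1)%:MP *: col' b u) *m row' b Mx.
  have := mul_lift_row Mx u b; rewrite uM uc => /esym/eqP; rewrite addr_eq0 => /eqP h.
  have -> : row b Mx = (c^-1)%:MP *: (c%:MP *: row b Mx).
    by rewrite scalerA -mpolyCM mulVf // mpolyC1 scale1r.
  by rewrite h scalerN -scalemxAl mpolyCN scaleNr.
move=> z /gM [w ->]; rewrite (mul_lift_row Mx w b) {1}rb.
exists (w 0 b *: ((- c^-1)%:MP *: col' b u) + col' b w).
by rewrite mulmxDl -!scalemxAl.
Qed.

End MinimalGenerators.

(** * From resolutions to Koszul vanishing and back *)

Section GradedQuotient.
Local Open Scope ring_scope.
Variables (k : fieldType) (N : nat).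
Local Notation S := {mpoly k[N]}.
Variables (Q : zmodType) (Y : 'I_N -> {additive Q -> Q}) (pi : {additive S -> Q}).
Variables (Z : Q -> Prop) (H : int -> Q -> Prop).
Hypothesis piX : forall g p, pi ('X_g * p) = Y g (pi p).
Hypothesis piH : forall e p, homogz e p -> H e (pi p).
Hypothesis piZ : forall p, Z (pi p).
Hypothesis pi_lift : forall e z, Z z -> H e z -> exists2 p, homogz e p & pi p = z.
Hypothesis piC : forall c : k, pi c%:MP = 0 -> c = 0.
Hypothesis ker_ideal : forall s p, pi p = 0 -> pi (s * p) = 0.
Hypothesis ker_graded : forall e p, pi p = 0 -> pi (compz e p) = 0.
Let J : pred S := fun p => pi p == 0.

Let sh0 (_ : 'I_1) : nat := 0%N.

Definition pi0 (u : 'rV[S]_1) : Q := pi (u 0 0).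
Fact pi0_is_zmod_morphism : zmod_morphism pi0.
Proof. by move=> u w; rewrite /pi0 !mxE raddfB. Qed.
HB.instance Definition _ := GRing.isZmodMorphism.Build 'rV[S]_1 Q pi0 pi0_is_zmod_morphism.

Lemma pi0X g u : pi0 (mulX g u) = Y g (pi0 u).
Proof. by rewrite /pi0 mxE piX. Qed.

Lemma rowh_sh0 e (u : 'rV[S]_1) : rowh sh0 e u <-> homogz e (u 0 0).
Proof. by split=> [/(_ 0)|h b]; rewrite ?ord1 subr0. Qed.

Lemma pi0_lift e z : Z z -> H e z -> exists2 u, rowh sh0 e u & pi0 u = z.
Proof.
move=> Zz Hz; have [p hp pz] := pi_lift Zz Hz; exists (const_mx p).
  by apply/rowh_sh0; rewrite mxE.
by rewrite /pi0 mxE.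
Qed.

Lemma pi0H e u : rowh sh0 e u -> H e (pi0 u).
Proof. by move/rowh_sh0; apply: piH. Qed.

(** No set of variables has more than N elements; through dimension shifting this becomes Hilbert's
    bound on the length of a resolution. *)
Lemma kexact_large (Q' : zmodType) (Y' : 'I_N -> {additive Q' -> Q'}) Z' H' j e :
  additive_pred Z' -> (forall e', additive_pred (H' e')) -> (N < j)%N -> kexact Y' Z' H' j e.
Proof.
move=> Z0 H0 jN f fj fS fc; exists 0; split; first exact: has_card0.
  by move=> A; rewrite ffunE; split; [case: Z0 | case: (H0 (e - 1))].
rewrite raddf0; apply/ffunP=> A; rewrite ffunE; apply/esym/eqP; apply/negP=> /negP /fj cA.
by have := max_card (mem A); rewrite cA card_ord leqNgt jN.
Qed.

Local Notation ker0 := (fun u : 'rV[S]_1 => pi0 u = 0).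

Lemma kexact_ideal j e : kexact Y Z H j.+1 (e - 1) -> kexact (@mulX k N 1) ker0 (rowh sh0) j e.
Proof.
move=> hK.
apply: (kexact_kernel (phi := pi0) (YF := @mulX k N 1) (HF := rowh sh0) _ _ _ _ _ _ _ _ hK).
- exact: mulXC.
- exact: pi0X.
- exact: rowh_add.
- by move=> *; apply: rowh_mulX.
- exact: pi0H.
- by move=> x; apply: piZ.
- exact: pi0_lift.
- move=> f fj fH fc; apply: row_koszul => // [A|b _ eb A]; first by case: (fH A).
  (* In position 0 the free module has homology only in constants, and the ideal contains no nonzero
     constant. *)
  have [h0 /rowh_sh0] := fH A; rewrite eb ord1 => /homogz_const hc.
  have h1 : pi (((f A 0 0)@_0%MM)%:MP) = 0 by rewrite -hc.
  by rewrite hc (piC h1) mpolyC0.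
Qed.

Lemma kexact_quotient (T : nat) :
  (forall j e, T%:Z + 1 < e -> kexact (@mulX k N 1) ker0 (rowh sh0) j e) ->
  forall j e, T%:Z < e -> kexact Y Z H j e.
Proof.
move=> hK [|j] e Te.
  apply: (kexact_image0 (phi := pi0) (YF := @mulX k N 1) (HF := rowh sh0)).
  - exact: pi0X.
  - exact: rowh_add.
  - exact: pi0H.
  - by move=> x; apply: piZ.
  - exact: pi0_lift.
  - by move=> f fj fH fc; apply: row_koszul => // b _ eb; move: Te; rewrite eb.
apply: (kexact_image (phi := pi0) (YF := @mulX k N 1) (HF := rowh sh0)).
- exact: mulXC.
- exact: pi0X.
- exact: rowh_add.
- by move=> *; apply: rowh_mulX.
- exact: pi0H.
- by move=> x; apply: piZ.
- exact: pi0_lift.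
- by move=> f fj fH fc; apply: row_koszul.
- by apply: hK; rewrite ltrD2r.
Qed.

Lemma dhomog_homogz d (p : S) : p \is d.-homog <-> homogz d%:Z p.
Proof.
split=> [/dhomogP h mu /h|h]; first by rewrite /degz => ->.
by apply/dhomogP=> mu /h; rewrite /degz => -[].
Qed.

(** Dimension shifting from the far end, where the free module is zero, down to R; each step lowers
    the bound on e by one. *)
Lemma kexact_of_resolution (F : graded_free_res k N J) (r : nat) : res_reg_le F r ->
  forall j e, r%:Z < e -> kexact Y Z H j e.
Proof.
case: F => rk sh N0 M [pm rk0] N0h Mh ex0 ex1 exS hr; rewrite /res_reg_le /= in hr.
have Mh' i : mxh (sh i.+1) (sh i) (M i).
  move=> a b; case: (Mh i a b) => [->|[le hm]]; first by case: (@homogz_add k N ((sh i.+1 a)%:Z - (sh i b)%:Z)).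
  by rewrite subzn //; apply/dhomog_homogz.
(* The kernel of [M i] is the image of [M i.+1], whose rows have degree [sh i.+2] at most r + i +
   3. *)
have hM i m : (i + m)%N = pm -> forall j e, (r + i + 3)%N%:Z < e ->
    kexact (@mulX k N (rk i.+1)) (fun u => mulr_mx (M i) u = 0) (rowh (sh i.+1)) j e.
  elim: m i => [|m IH] i im.
    move=> j e _ f fj _ _; exists 0; split; first exact: has_card0.
      move=> A; rewrite ffunE raddf0; split=> //; by case: (rowh_add k N (sh i.+1) (e - 1)).
    rewrite raddf0; apply/ffunP=> A; apply/rowP=> b; exfalso.
    by move: b; rewrite rk0 => [[]//|]; rewrite -im addn0.
  apply: (kexact_mx_image (Mh' i.+1)).
  - by move=> z; split=> [/exS//|/exS].
  - by move=> a; rewrite lez_nat (leq_trans (hr i.+2 a)) // -addnA addn3.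
  - move=> j e he; apply: (IH i.+1); first by rewrite addSnnS.
    by lia.
have hM0 : forall j e, (r + 3)%N%:Z < e ->
    kexact (@mulX k N (rk 1%N)) (fun u => mulr_mx (M 0%N) u = 0) (rowh (sh 1%N)) j e.
  by move=> j e he; apply: (hM 0%N pm) => //; rewrite addn0.
have hN0 : forall j e, (r + 2)%N%:Z < e ->
    kexact (@mulX k N (rk 0%N)) (fun u => mulr_mx N0 u = 0) (rowh (sh 0%N)) j e.
  apply: (kexact_mx_image (Mh' 0%N)).
  - by move=> z; split=> [/ex1//|/ex1].
  - by move=> a; rewrite lez_nat (leq_trans (hr 1%N a)).
  - by move=> j e he; apply: hM0; lia.
apply: kexact_quotient.
have -> : r%:Z + 1 = (r + 1)%N%:Z by rewrite PoszD.
apply: (kexact_mx_image (shp := sh 0%N) (Mx := N0)).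
- by move=> a b; rewrite subr0 ord1; apply/dhomog_homogz; apply: N0h.
- move=> z; split=> [/eqP/(ex0 (z 0 0)) [u hu]|[u ->]].
    by exists u; apply/rowP=> b; rewrite ord1 hu.
  by apply/eqP/(ex0 ((u *m N0) 0 0)); exists u.
- by move=> a; rewrite lez_nat hr.
- by move=> j e he; apply: hN0; lia.
Qed.

(** The size of each matrix depends on the previous one, so a stage bundles the ambient free module,
    the submodule to be covered and the chosen generators. *)
Record stage := Stage {
  st_q : nat; st_shq : 'I_st_q -> nat; st_Z : 'rV[S]_st_q -> Prop;
  st_p : nat; st_shp : 'I_st_p -> nat; st_mx : 'M[S]_(st_p, st_q) }.

Definition good_gens q (shq : 'I_q -> nat) (Zq : 'rV[S]_q -> Prop) (T : nat)
    (x : {p : nat & (('I_p -> nat) * 'M[S]_(p, q))%type}) :=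
  min_gens shq Zq T (tagged x).1 (tagged x).2 /\
  ((forall e, multiples_at shq Zq e) -> tag x = 0%N).

(** The implication makes the choice total, so that [stages] can be defined before the invariant
    that guarantees existence is proved. *)
Lemma pick_gens_subproof q (shq : 'I_q -> nat) Zq T : exists x,
  (exists y, good_gens shq Zq T y) -> good_gens shq Zq T x.
Proof.
have [[y hy]|h] := classic (exists y, good_gens shq Zq T y); first by exists y.
by exists (existT _ 0%N (fun=> 0%N, 0)) => hy; case: h.
Qed.

Definition pick_gens q shq Zq T :=
  sval (constructive_indefinite_description _ (@pick_gens_subproof q shq Zq T)).

Definition mk_stage q shq Zq T : stage :=
  @Stage q shq Zq _ (tagged (pick_gens shq Zq T)).1 (tagged (pick_gens shq Zq T)).2.

Section Construction.
Variable r : nat.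
Hypothesis regR : forall j e, r%:Z < e -> kexact Y Z H j e.
Hypothesis Z_add : additive_pred Z.
Hypothesis H_add : forall e, additive_pred (H e).

Fixpoint stages (i : nat) : stage :=
  if i is i'.+1 then let s := stages i' in
    mk_stage (@st_shp s) (fun u => mulr_mx (st_mx s) u = 0) (r + i'.+2)
  else mk_stage sh0 (fun u : 'rV[S]_1 => pi0 u = 0) (r + 1).

(** The second clause is the vanishing for R (degrees above r, or positions above N) after i + 1
    shifts. Once i >= N it covers position 0 in every degree, so no generator is left. *)
Definition stage_inv (i : nat) (s : stage) :=
  [/\ [/\ additive_pred (@st_Z s), (forall (c : S) (z : 'rV_(st_q s)), st_Z z -> st_Z (c *: z)) &
          (forall e z, st_Z z -> st_Z (compr (@st_shq s) e z))],
      (forall j e, ((r + i.+1)%N%:Z < e) \/ (N < j + i.+1)%N ->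
         kexact (@mulX k N _) (@st_Z s) (rowh (@st_shq s)) j e),
      min_gens (@st_shq s) (@st_Z s) (r + i.+1) (@st_shp s) (st_mx s) &
      ((N <= i)%N -> st_p s = 0%N)].

Lemma mk_stage_inv i q shq (Zq : 'rV[S]_q -> Prop) :
  [/\ additive_pred Zq, (forall (c : S) z, Zq z -> Zq (c *: z)) &
          (forall e z, Zq z -> Zq (compr shq e z))] ->
  (forall j e, ((r + i.+1)%N%:Z < e) \/ (N < j + i.+1)%N ->
         kexact (@mulX k N _) Zq (rowh shq) j e) ->
  stage_inv i (mk_stage shq Zq (r + i.+1)).
Proof.
move=> [Za Zs Zc] hK.
have ex : exists y, good_gens shq Zq (r + i.+1) y.
  have [|p [shp [Mx hM]]] := exists_min_gens Zc (T := r + i.+1).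
    by move=> e he; apply: kexact_multiples => //; apply: hK; left.
  by exists (existT _ p (shp, Mx)).
have [h1 h2] := svalP (constructive_indefinite_description _ (pick_gens_subproof shq Zq (r + i.+1))) ex.
split=> // iN; apply: h2 => e; apply: kexact_multiples => //; apply: hK; right.
by rewrite add0n ltnS.
Qed.

Lemma min_gens_image i s : stage_inv i s ->
  forall z : 'rV_(st_q s), st_Z z <-> exists u, z = u *m st_mx s.
Proof.
case=> [[Za Zs Zc] _ [[h1 h2 h3] hg _] _] z; split; first exact: hg.
by case=> u ->; apply: Z_mul.
Qed.

Lemma stagesP i : stage_inv i (stages i).
Proof.
elim: i => [|i IH].
  apply: mk_stage_inv.
    split.
    - exact: (Z'_add pi0).
    - by move=> c z; rewrite /pi0 mxE; apply: ker_ideal.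
    - by move=> e z; rewrite /pi0 mxE; apply: ker_graded.
  move=> j e h; apply: kexact_ideal; case: h => h.
    by apply: regR; lia.
  by apply: kexact_large => //; move: h; rewrite addn1.
have imM := min_gens_image IH.
case: IH imM; rewrite [stages i.+1]/=; move: (stages i) => s [Za Zs Zc] hK [[h1 h2 h3] hg hmin] hp imM.
apply: mk_stage_inv.
  split.
  - exact: (Z'_add (mulr_mx (st_mx s))).
  - by move=> c z; rewrite /mulr_mx -scalemxAl => ->; rewrite scaler0.
  - move=> e z; rewrite /mulr_mx -(compr_mul _ _ h2) => ->.
    by apply/rowP=> b; rewrite !mxE raddf0.
move=> j e h; apply: (kexact_mx_kernel h2 imM).
  by move=> u hu hh b eb; apply: hmin hh b eb.
apply: hK; case: h => h; [left|right].
  by lia.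
by move: h; rewrite addSnnS.
Qed.

Lemma resolution_of_kexact : exists F : graded_free_res k N J, res_reg_le F r.
Proof.
pose rkf i := st_p (stages i).
pose shf i : 'I_(rkf i) -> nat := @st_shp (stages i).
pose N0f : 'M[S]_(rkf 0%N, 1) := st_mx (stages 0).
pose Mf i : 'M[S]_(rkf i.+1, rkf i) := st_mx (stages i.+1).
have h1 : exists p, forall i, (p <= i)%N -> rkf i = 0%N.
  by exists N => i Ni; case: (stagesP i) => _ _ _; apply.
have h2 j : N0f j ord0 \is (shf 0%N j).-homog.
  have [_ _ [[_ hm _] _ _] _] := stagesP 0.
  by apply/dhomog_homogz; have := hm j ord0; rewrite /= subr0.
have h3 i a b : Mf i a b = 0 \/
     ((shf i b <= shf i.+1 a)%N /\ Mf i a b \is (shf i.+1 a - shf i b).-homog).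
  have [_ _ [[_ hm _] _ _] _] := stagesP i.+1; have {hm} h := hm a b.
  have [le|lt] := leqP (shf i b) (shf i.+1 a).
    right; split=> //; apply/dhomog_homogz; rewrite -subzn //; exact: h.
  by left; apply: homogz_neg h _; rewrite subr_lt0 ltz_nat.
have h4 f : J f <-> exists u : 'rV_(rkf 0%N), (u *m N0f) ord0 ord0 = f.
  have im := min_gens_image (stagesP 0); split=> [/eqP Jf|[u <-]].
    have [|u hu] := (im (const_mx f)).1; first by rewrite /= /pi0 mxE.
    by exists u; rewrite -[u *m N0f]hu mxE.
  by apply/eqP; apply: (im (u *m N0f)).2; exists u.
have h5 (u : 'rV_(rkf 0%N)) : u *m N0f = 0 <-> exists v, u = v *m Mf 0%N.
  exact: (min_gens_image (stagesP 1) u).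
have h6 i (u : 'rV_(rkf i.+1)) : u *m Mf i = 0 <-> exists v, u = v *m Mf i.+1.
  exact: (min_gens_image (stagesP i.+2) u).
exists (@GFRes k N J rkf shf N0f Mf h1 h2 h3 h4 h5 h6) => i j /=.
by have [_ _ [[_ _ hb] _ _] _] := stagesP i; apply: hb.
Qed.

End Construction.

End GradedQuotient.

(** * Regularity of normal toric rings *)

Section MinkowskiWeyl.
Local Open Scope ring_scope.

(** Supplies the least multiplier t in the elimination step: 0 or one of the lower bounds. *)
Lemma seq_upper_bound (s : seq rat) : exists c : rat,
  [/\ (c == 0) || (c \in s), 0 <= c & forall x, x \in s -> x <= c].
Proof.
elim: s => [|x s [c [h1 h2 h3]]]; first by exists 0; rewrite eqxx.
have [xc|cx] := leP x c.
  exists c; split=> //; first by rewrite inE orbCA h1 orbT.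
  by move=> y; rewrite inE => /orP[/eqP ->//|/h3].
exists x; split; first by rewrite inE eqxx orbT.
  exact: le_trans (ltW cx).
by move=> y; rewrite inE => /orP[/eqP ->//|/h3 /le_trans]; apply; apply: ltW.
Qed.

Variables (N d : nat) (G : 'M[rat]_(N, d)).
Implicit Types (f : 'cV[rat]_d) (y : 'rV[rat]_d).

Definition pairing y f : rat := (y *m f) 0 0.

Lemma pairingDl y y' f : pairing (y + y') f = pairing y f + pairing y' f.
Proof. by rewrite /pairing mulmxDl mxE. Qed.
Lemma pairingNl y f : pairing (- y) f = - pairing y f.
Proof. by rewrite /pairing mulNmx mxE. Qed.
Lemma pairingZl t y f : pairing (t *: y) f = t * pairing y f.
Proof. by rewrite /pairing -scalemxAl mxE. Qed.
Lemma pairingDr y f f' : pairing y (f + f') = pairing y f + pairing y f'.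
Proof. by rewrite /pairing mulmxDr mxE. Qed.
Lemma pairingNr y f : pairing y (- f) = - pairing y f.
Proof. by rewrite /pairing mulmxN mxE. Qed.
Lemma pairingZr t y f : pairing y (t *: f) = t * pairing y f.
Proof. by rewrite /pairing -scalemxAr mxE. Qed.
Lemma pairing_suml (I : Type) (r : seq I) (P : pred I) (F : I -> 'rV[rat]_d) f :
  pairing (\sum_(i <- r | P i) F i) f = \sum_(i <- r | P i) pairing (F i) f.
Proof. by rewrite /pairing mulmx_suml summxE. Qed.
Lemma pairing_delta y i : pairing y (delta_mx i 0) = y 0 i.
Proof.
rewrite /pairing mxE (bigD1 i) //= mxE !eqxx mulr1 big1 ?addr0 // => j ji.
by rewrite mxE (negPf ji) mulr0.
Qed.

Lemma conic0 y : conic G set0 y <-> y = 0.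
Proof.
split=> [[c [_ ->]]|->]; first by rewrite big_set0.
by exists (fun=> 0); split=> //; rewrite big_set0.
Qed.

Lemma conicU1 (E : {set 'I_N}) g y : g \notin E ->
  conic G (g |: E) y <-> exists2 t, 0 <= t & conic G E (y - t *: row g G).
Proof.
move=> gE; split=> [[c [c0 ->]]|[t t0 [c [c0 yE]]]].
  exists (c g) => //; exists c; split=> //; rewrite big_setU1 //=.
  by rewrite addrAC subrr add0r.
exists (fun h => if h == g then t else c h); split=> [h|]; first by case: ifP.
rewrite big_setU1 //= eqxx -[y](subrK (t *: row g G)) addrC yE; congr (_ + _).
by apply: eq_bigr => h hE; rewrite ifF //; apply: contraNF gE => /eqP <-.
Qed.

(* Fourier-Motzkin elimination, one generator at a time. *)
Lemma minkowski_weyl_seq (E : {set 'I_N}) : exists ls : seq 'cV[rat]_d, forall y,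
  (forall f, f \in ls -> 0 <= pairing y f) <-> conic G E y.
Proof.
have [m] := ubnP #|E|; elim: m E => // m IH E /ltnSE Em.
have [->|/set0Pn[g gE]] := eqVneq E set0.
  exists ([seq delta_mx i 0 | i : 'I_d] ++ [seq - delta_mx i 0 | i : 'I_d]) => y; split=> [h|/conic0 -> f _].
    apply/conic0/rowP=> i; rewrite [RHS]mxE; apply/eqP; rewrite eq_le.
    rewrite -oppr_ge0 -!(pairing_delta y) -pairingNr !h //= mem_cat; apply/orP.
      by left; apply/mapP; exists i; rewrite ?mem_enum.
    by right; apply/mapP; exists i; rewrite ?mem_enum.
  by rewrite /pairing mul0mx mxE.
have [|ls hls] := IH (E :\ g); first by move: Em; rewrite (cardsD1 g) gE.
pose u := row g G.
(* In t * pairing u f <= pairing y f, a positive value at u bounds t from above and a negative one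
   from below; each such pair gives an inequality free of t. Functionals nonnegative at u are kept,
   which accounts for t >= 0. *)
exists ([seq f <- ls | 0 <= pairing u f] ++
  [seq pairing u p.1 *: p.2 - pairing u p.2 *: p.1 |
     p <- [seq (f, f') | f <- [seq f <- ls | 0 < pairing u f], f' <- [seq f <- ls | pairing u f < 0]]]) => y.
rewrite -[E in conic G E](setD1K gE) conicU1 ?setD11 //; split=> [h|[t t0 /hls h] f].
  pose s := [seq pairing y f / pairing u f | f <- [seq f <- ls | pairing u f < 0]].
  have [c [cs c0 cmax]] := seq_upper_bound s.
  exists c => //; apply/hls => f fl; rewrite pairingDl pairingNl pairingZl subr_ge0 -/u.
  have [uf|uf|uf] := ltgtP (pairing u f) 0.
  - rewrite -ler_ndivrMr //; apply: cmax; apply/mapP; exists f => //.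
    by rewrite mem_filter uf.
  - case/orP: cs => [/eqP ->|/mapP[f']].
      by rewrite mul0r; apply: h; rewrite mem_cat mem_filter ltW ?fl.
    rewrite mem_filter => /andP[uf' f'l] ->.
    have := h (pairing u f *: f' - pairing u f' *: f).
    rewrite pairingDr pairingNr !pairingZr subr_ge0 => h'.
    rewrite mulrAC ler_ndivrMr // [pairing y f * _]mulrC [pairing y f' * _]mulrC; apply: h'.
    rewrite mem_cat; apply/orP; right; apply/mapP; exists (f, f') => //.
    by apply: allpairs_f; rewrite mem_filter ?uf ?uf'.
  - by rewrite uf mulr0; apply: h; rewrite mem_cat mem_filter uf lexx fl.
have {}h f' : f' \in ls -> t * pairing u f' <= pairing y f'.
  by move/h; rewrite pairingDl pairingNl pairingZl subr_ge0.
rewrite mem_cat => /orP[|/mapP[[f1 f2]]].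
  by rewrite mem_filter => /andP[uf /h]; apply: le_trans; rewrite mulr_ge0.
case/allpairsP=> -[f1' f2'] /= []; rewrite !mem_filter => /andP[u1 l1] /andP[u2 l2] [-> ->] ->.
rewrite pairingDr pairingNr !pairingZr subr_ge0.
have := h _ l1; have := h _ l2; nra.
Qed.

Lemma minkowski_weyl : exists M (L : 'M[rat]_(d, M)), forall y,
  (forall j, 0 <= lv L y j) <-> conic G setT y.
Proof.
have [ls hls] := minkowski_weyl_seq setT.
exists (size ls), (\matrix_(i, j) (nth 0 ls j) i 0) => y; rewrite -hls.
have E (j : 'I_(size ls)) : lv (\matrix_(i, j) (nth 0 ls j) i 0) y j = pairing y (nth 0 ls j).
  by rewrite /lv /pairing !mxE; apply: eq_bigr => i _; rewrite mxE.
split=> h; last by move=> j; rewrite E; apply: h; apply: mem_nth.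
by move=> f /(nthP 0) [i il <-]; rewrite -(E (Ordinal il)).
Qed.

(** All functionals are used, so the notion does not depend on the matrix found by
    [minkowski_weyl]. *)
Definition interior y := forall f : 'cV[rat]_d,
  (forall g, 0 <= pairing (row g G) f) -> (exists g, 0 < pairing (row g G) f) ->
  0 < pairing y f.

Lemma lv_pairing M (L : 'M[rat]_(d, M)) y j : lv L y j = pairing y (col j L).
Proof. by rewrite /lv /pairing colE mulmxA -colE !mxE. Qed.

Lemma conic_row g : conic G setT (row g G).
Proof.
exists (fun h => if h == g then 1 else 0); split=> [h|]; first by case: ifP.
rewrite (bigD1 g) ?inE //= eqxx scale1r big1 ?addr0 // => h /andP[_ /negPf ->].
by rewrite scale0r.
Qed.

Lemma conic_pairing y f : conic G setT y -> (forall g, 0 <= pairing (row g G) f) ->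
  0 <= pairing y f.
Proof.
case=> c [c0 ->] f0; rewrite pairing_suml; apply: sumr_ge0 => g _.
by rewrite pairingZl mulr_ge0.
Qed.

Section Interior.
Variables (M : nat) (L : 'M[rat]_(d, M)).
Hypothesis LP : forall y, (forall j, 0 <= lv L y j) <-> conic G setT y.
Hypothesis rkG : \rank (span_mx G setT) = d.

Lemma gv_ge0_of_cone g j : 0 <= gv G L g j.
Proof. by move: j; apply/LP; apply: conic_row. Qed.

Lemma lv_eq0_full y j : (forall g, gv G L g j = 0) -> lv L y j = 0.
Proof. by move=> h; apply: (lv_span0 (span_all rkG y)) => g _. Qed.

(** If the functionals of L that are not zero on the cone are positive at y, then K y - g stays in
    the cone for large K, so a value f g > 0 forces f y > 0. *)
Lemma negative_interior y : negative G L setT (- y) <-> interior y.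
Proof.
split=> [/forallP neg f f0 [g fg]|int].
  have ygt0 j h : gv G L h j != 0 -> 0 < lv L y j.
    move=> hj; rewrite -oppr_lt0 -lvN; apply: (implyP (neg j)).
    by apply/existsP; exists h; rewrite inE.
  have yge0 j : 0 <= lv L y j.
    have [/existsP[h /ygt0/ltW//]|/existsPn nh] := boolP [exists h, gv G L h j != 0].
    by rewrite lv_eq0_full // => h; apply/eqP; rewrite -[_ == _]negbK nh.
  pose K := \sum_(j | lv L y j != 0) (gv G L g j / lv L y j).
  have K0 : 0 <= K by apply: sumr_ge0 => j _; rewrite divr_ge0 ?gv_ge0_of_cone.
  have : conic G setT (K *: y - row g G).
    apply/LP => j; rewrite lvD lvN lvZ subr_ge0 -/(gv G L g j).
    have [y0|y0] := eqVneq (lv L y j) 0.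
      rewrite y0 mulr0; have [->//|/ygt0] := eqVneq (gv G L g j) 0.
      by rewrite y0 ltxx.
    rewrite -ler_pdivrMr ?lt_def ?y0 //= /K (bigD1 j) //= lerDl.
    by apply: sumr_ge0 => i _; rewrite divr_ge0 ?gv_ge0_of_cone.
  move/conic_pairing => /(_ f f0); rewrite pairingDl pairingNl pairingZl subr_ge0.
  move=> /(lt_le_trans fg); rewrite ltNge; apply: contraNT; rewrite -leNgt.
  exact: mulr_ge0_le0.
apply/forallP=> j; apply/implyP=> /existsP[g /andP[_ gj]]; rewrite lvN oppr_lt0 lv_pairing.
apply: int => [h|]; first by rewrite -lv_pairing; apply: gv_ge0_of_cone.
by exists g; rewrite -lv_pairing lt_def gj; apply: gv_ge0_of_cone.
Qed.

Lemma interior_conic y : interior y -> conic G setT y.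
Proof.
move/negative_interior/forallP=> neg; apply/LP => j.
have [h|/existsPn nh] := boolP [exists g in setT, gv G L g j != 0].
  by have := implyP (neg j) h; rewrite lvN oppr_lt0 => /ltW.
rewrite lv_eq0_full // => g; apply/eqP; have := nh g; rewrite inE /=.
by rewrite negbK.
Qed.
End Interior.

End MinkowskiWeyl.

(** * Regularity and interior lattice points of a normal semigroup *)

Section NormalToric.
Local Open Scope ring_scope.
Variables (k : fieldType) (d N : nat) (v : 'I_N -> 'X_{1..d}).
Variables (wt : 'X_{1..d} -> int) (wtf : 'cV[rat]_d).
Local Notation chain := {ffun {set 'I_N} -> k}.
Local Notation dchain := {ffun {set 'I_N} -> chain}.

Definition rowm (mu : 'X_{1..d}) : 'rV[rat]_d := \row_i (mu i)%:R.
Definition genmx : 'M[rat]_(N, d) := \matrix_(g, i) (v g i)%:R.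
Definition semigroup (mu : 'X_{1..d}) := exists c : 'I_N -> nat,
  mu = (\big[+%MM/0%MM]_g (v g *+ c g))%MM.

Hypothesis rkG : \rank (span_mx genmx setT) = d.
Hypothesis normal_cone : forall mu, conic genmx setT (rowm mu) -> semigroup mu.
Hypothesis wtD : forall mu nu, wt (mu + nu)%MM = wt mu + wt nu.
Hypothesis wt_v : forall g, wt (v g) = 1.
Hypothesis wtfE : forall mu, pairing (rowm mu) wtf = (wt mu)%:~R.

Lemma row_genmx g : row g genmx = rowm (v g).
Proof. by apply/rowP=> i; rewrite !mxE. Qed.

Lemma rowmD mu nu : rowm (mu + nu)%MM = rowm mu + rowm nu.
Proof. by apply/rowP=> i; rewrite !mxE mnmDE natrD. Qed.

Lemma rowm0 : rowm 0%MM = 0.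
Proof. by apply/rowP=> i; rewrite !mxE mnm0E. Qed.

Lemma rowm_sum (I : Type) (r : seq I) (P : pred I) (F : I -> 'X_{1..d}) :
  rowm (\big[+%MM/0%MM]_(i <- r | P i) F i) = \sum_(i <- r | P i) rowm (F i).
Proof. exact: (big_morph rowm rowmD rowm0). Qed.

Lemma rowmMn mu c : rowm (mu *+ c)%MM = c%:R *: rowm mu.
Proof. by apply/rowP=> i; rewrite !mxE mulmnE natrM mulrC. Qed.

Lemma rowm_inj : injective rowm.
Proof.
move=> mu nu E; apply/mnmP=> i; have := congr1 (fun y : 'rV_d => y 0 i) E.
by rewrite !mxE => /eqP; rewrite eqr_nat => /eqP.
Qed.

Lemma rowm_sumv (F : {set 'I_N}) : \sum_(g in F) row g genmx = rowm (sumv v F).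
Proof. by rewrite /sumv rowm_sum; apply: eq_bigr => g _; rewrite row_genmx. Qed.

Lemma semigroup_conic mu : semigroup mu -> conic genmx setT (rowm mu).
Proof.
case=> c ->; exists (fun g => (c g)%:R); split=> [g|]; first exact: ler0n.
rewrite rowm_sum; apply: eq_big => g; first by rewrite inE.
by rewrite row_genmx rowmMn.
Qed.

Lemma conic_ge0 y i : conic genmx setT y -> 0 <= y 0 i.
Proof.
move=> h; rewrite -(pairing_delta y); apply: (conic_pairing h) => g.
by rewrite pairing_delta !mxE ler0n.
Qed.

Lemma conic_int y : conic genmx setT y -> (forall i, y 0 i \is a Num.int) ->
  exists mu, y = rowm mu.
Proof.
move=> hc hi; exists [multinom Num.truncn (y 0%R i) | i < d].
apply/rowP=> i; rewrite mxE mnmE truncnK // natrEint hi.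
exact: conic_ge0.
Qed.

Lemma conicD y y' : conic genmx setT y -> conic genmx setT y' -> conic genmx setT (y + y').
Proof.
move=> [c [c0 ->]] [c' [c0' ->]]; exists (fun g => c g + c' g); split=> [g|]; first by rewrite addr_ge0.
by rewrite -big_split; apply: eq_bigr => g _; rewrite scalerDl.
Qed.

Lemma conic_sum (F : {set 'I_N}) : conic genmx setT (\sum_(g in F) row g genmx).
Proof.
exists (fun g => if g \in F then 1 else 0); split=> [g|]; first by case: ifP.
rewrite big_mkcond /=; apply: eq_big => g; first by rewrite inE.
by case: ifP; rewrite ?scale1r ?scale0r.
Qed.

Lemma wt_conic_ge0 mu : conic genmx setT (rowm mu) -> 0 <= wt mu.
Proof.
move=> h; rewrite -(ler0z rat) -wtfE; apply: (conic_pairing h) => g.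
by rewrite row_genmx wtfE wt_v.
Qed.

Section Functionals.
Variables (M : nat) (L : 'M[rat]_(d, M)).
Hypothesis LP : forall y, (forall j, 0 <= lv L y j) <-> conic genmx setT y.

Lemma gv_pointed_gen g : exists j, 0 < gv genmx L g j.
Proof.
apply/existsP; apply: contraT => /existsPn h.
have : conic genmx setT (- row g genmx).
  by apply/LP=> j; rewrite lvN oppr_ge0 leNgt; apply: h.
move/conic_pairing => /(_ wtf); rewrite pairingNl row_genmx wtfE wt_v.
by rewrite oppr_ge0 ler10 => ->// h'; rewrite row_genmx wtfE wt_v.
Qed.

(** With normality, the row of Cech degree 0 is the Koszul complex of the semigroup ring itself;
    [ins0] and [evA] pass between the two. *)
Lemma adm_set0 y : adm genmx L setT y set0 <-> conic genmx setT y.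
Proof.
rewrite -LP /adm sub0set /=; split=> [/forallP h j|h].
  rewrite leNgt; apply/negP=> yj; have /implyP/(_ yj)/existsP[g] := h j.
  by rewrite inE.
by apply/forallP=> j; rewrite ltNge h.
Qed.

Lemma degF_rowm a F : (sumv v F <= a)%MM -> degF genmx (rowm a) F = rowm (a - sumv v F)%MM.
Proof.
by move=> h; rewrite /degF rowm_sumv -{1}(submK h) rowmD addrK.
Qed.

Lemma degF_conic a F : conic genmx setT (degF genmx (rowm a) F) <->
  (sumv v F <= a)%MM /\ semigroup (a - sumv v F)%MM.
Proof.
split=> [h|[le sg]]; last by rewrite degF_rowm //; apply: semigroup_conic.
have le : (sumv v F <= a)%MM.
  apply/mnm_lepP=> i; have := conic_ge0 i h; rewrite /degF rowm_sumv !mxE subr_ge0.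
  by rewrite ler_nat.
by split=> //; apply: normal_cone; rewrite -degF_rowm.
Qed.

Definition ins0 (x : k) : chain := [ffun A : {set 'I_N} => if A == set0 then x else 0].
Fact ins0_is_zmod_morphism : zmod_morphism ins0.
Proof. by move=> x y; apply/ffunP=> A; rewrite !ffunE; case: ifP; rewrite ?subr0. Qed.
HB.instance Definition _ := GRing.isZmodMorphism.Build k chain ins0 ins0_is_zmod_morphism.

Lemma dsupp_ins0 a j (c : chain) : fine_supp v semigroup a j c ->
  dsupp genmx L (rowm a) (pred1 j) (pred1 0%N) (cmap ins0 c).
Proof.
move=> cS F A; rewrite !ffunE; have [->|] := eqVneq A set0; rewrite ?eqxx // => /cS [cF h1 h2].
rewrite /= cF cards0 !eqxx /=; apply/adm_set0; exact/degF_conic.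
Qed.

Lemma fine_supp_ev0 a j (b : dchain) : dsupp genmx L (rowm a) (pred1 j) (pred1 0%N) b ->
  fine_supp v semigroup a j (cmap (evA set0) b).
Proof.
by move=> bS F; rewrite ffunE => /bS /and3P[/eqP cF _ /adm_set0/degF_conic[]].
Qed.

Lemma cmap_ev_ins (c : chain) : cmap (evA set0) (cmap ins0 c) = c.
Proof. by apply/ffunP=> F; rewrite !ffunE /= /evA ffunE eqxx. Qed.

Lemma cmap_ins_ev y j (b : dchain) : dsupp genmx L y (pred1 j) (pred1 0%N) b ->
  cmap ins0 (cmap (evA set0) b) = b.
Proof.
move=> bS; apply/ffunP=> F; apply/ffunP=> A; rewrite !ffunE /= /evA; case: eqP => [->//|nA].
by apply/esym/eqP; apply: contra_notT nA => /bS /and3P[_ /=]; rewrite cards_eq0 => /eqP.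
Qed.

Lemma fine_exact_gen a j :
  (forall F : {set 'I_N}, #|F| = (j + d)%N -> ~~ negative genmx L setT (degF genmx (rowm a) F)) ->
  fine_exact k v semigroup a j.
Proof.
move=> hF c cS cc.
have [|b bS bE] := koszul_fine_exact (k := k) (gv_ge0_of_cone LP) gv_pointed_gen
    (fun y _ h => (LP y).1 h) rkG hF (dsupp_ins0 cS).
  by rewrite bd_cmap cc raddf0.
exists (cmap (evA set0) b); first exact: fine_supp_ev0.
by rewrite bd_cmap bE cmap_ev_ins.
Qed.

End Functionals.

Theorem toric_reg_upper (r : nat) :
  (forall y : 'rV[rat]_d, (forall i, y 0 i \is a Num.int) -> interior genmx y ->
     d%:R - r%:R <= pairing y wtf) ->
  forall j e, r%:Z < e -> kexact (@mulv k d N v) (msupp_in semigroup) (wt_homog wt) j e.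
Proof.
move=> hint j e re; have [M [L LP]] := minkowski_weyl genmx.
apply: kexact_of_fine => // a wa; apply: (fine_exact_gen LP) => F cF.
apply/negP; rewrite -[degF _ _ _]opprK => /(negative_interior LP rkG) int.
have int_y i : (- degF genmx (rowm a) F) 0 i \is a Num.int.
  by rewrite /degF rowm_sumv !mxE rpredN rpredB ?natr_int.
have := hint _ int_y int.
have -> : pairing (- degF genmx (rowm a) F) wtf = (#|F|%:Z - wt a)%:~R.
  by rewrite /degF rowm_sumv pairingNl pairingDl pairingNl !wtfE wt_sumv // opprB intrD rmorphN.
have -> : d%:R - r%:R = (d%:Z - r%:Z)%:~R :> rat by rewrite intrD rmorphN.
(* |F| = j + d and wt a = e + j, so the interior point has degree d - e < d - r. *)
by rewrite ler_int cF wa; lia.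
Qed.

Theorem toric_reg_lower (r : nat) : (0 < d)%N ->
  (forall j e, r%:Z < e -> kexact (@mulv k d N v) (msupp_in semigroup) (wt_homog wt) j e) ->
  forall mu, interior genmx (rowm mu) -> d%:Z - r%:Z <= wt mu.
Proof.
move=> d0 hK mu0 int0; have [M [L LP]] := minkowski_weyl genmx.
pose P t := exists mu, interior genmx (rowm mu) /\ wt mu = t%:Z.
have wt_nat mu : interior genmx (rowm mu) -> exists t, wt mu = t%:Z.
  move/(interior_conic LP rkG)/wt_conic_ge0; case: (wt mu) => // t _; by exists t.
have [|t [[w [int_w wt_w]] min_t]] := @exists_min_nat P.
  by have [t ht] := wt_nat _ int0; exists t, mu0.
have [t0 ht0] := wt_nat _ int0.
have tt0 : (t <= t0)%N.
  by rewrite leqNgt; apply/negP=> /min_t; apply; exists mu0.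
suff : d%:Z - r%:Z <= t%:Z by move=> h; apply: le_trans h _; rewrite ht0.
rewrite leNgt; apply/negP=> ht.
have dN : (d <= N)%N by rewrite -rkG rank_leq_row.
(* w has the least degree t among interior lattice points, so no w - v g is interior. Its class sits
   in position N - d with coefficients of degree (N - t) - (N - d) = d - t > r. *)
apply: (koszul_fine_nonexact (k := k) (gv_ge0_of_cone LP) (gv_pointed_gen LP)
    (fun y _ h => (LP y).1 h) rkG (w := rowm w) d0).
- exact/(negative_interior LP rkG).
- move=> g; apply/negP; rewrite -[_ - _]opprK opprB => /(negative_interior LP rkG) int.
  have [|mu' Emu] := conic_int (interior_conic LP rkG int).
    by move=> i; rewrite !mxE rpredB // ?natr_int.
  rewrite Emu in int; have [t' ht'] := wt_nat _ int.
  have : wt w = wt mu' + 1.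
    rewrite -(wt_v g) -wtD; congr wt; apply: rowm_inj.
    by rewrite rowmD -Emu row_genmx subrK.
  rewrite wt_w ht' => E; apply: (min_t t'); first lia.
  by exists mu'.
have sumE : \sum_g row g genmx = rowm (sumv v setT).
  by rewrite -rowm_sumv; apply: eq_bigl => g; rewrite inE.
move=> c cS cc.
(* The sum of all generators minus w may have negative entries; a nonzero chain in that degree
   forces it into the cone, hence to be an exponent. *)
have [c0|/eqP c0] := eqVneq c 0.
  by exists 0; [apply: dsupp0 | rewrite raddf0 c0].
have [F [A cFA]] : exists F A, c F A != 0.
  apply: NNPP => h; apply: c0; apply/ffunP=> F; apply/ffunP=> A; rewrite !ffunE.
  by apply/eqP; apply/negP=> /negP cFA; apply: h; exists F, A.
have /and3P[_ /= cA admA] := cS F A cFA.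
rewrite cards_eq0 in cA; rewrite (eqP cA) in admA.
move/(adm_set0 LP): admA => /(conicD (conic_sum F)).
rewrite /degF addrC subrK => conic_a.
have [|a Ea] := conic_int conic_a.
  by move=> i; rewrite sumE !mxE rpredB ?natr_int.
rewrite Ea in cS.
have wa : wt a = N%:Z - t%:Z.
  have : rowm (a + w)%MM = rowm (sumv v setT).
    by rewrite rowmD -Ea subrK.
  move/rowm_inj/(congr1 wt); rewrite wtD wt_sumv // cardsT card_ord wt_w => <-.
  by rewrite addrK.
have [|||b bS bE] := @fine_of_kexact k d N v semigroup wt wtD wt_v (N - d) (wt a - (N - d)%N%:Z) a _ _
   (cmap (evA set0) c) (fine_supp_ev0 LP cS).
- by rewrite subrK.
- by apply: hK; rewrite wa; lia.
- by rewrite bd_cmap cc raddf0.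
exists (cmap (ins0) b); first by rewrite Ea; apply: dsupp_ins0.
by rewrite bd_cmap bE (cmap_ins_ev cS).
Qed.

End NormalToric.

(** * The presentation of a monomial algebra and its semigroup *)

Section Presentation.
Local Open Scope ring_scope.
Variables (k : fieldType) (d N : nat) (v : 'I_N -> 'X_{1..d}).
Local Notation S := {mpoly k[N]}.
Local Notation P := {mpoly k[d]}.
Variables (gen : 'I_N -> P) (wt : 'X_{1..d} -> int).
Hypothesis genE : forall g, gen g = 'X_[v g].
Hypothesis wtD : forall mu nu, wt (mu + nu)%MM = wt mu + wt nu.
Hypothesis wt_v : forall g, wt (v g) = 1.

Definition pres (p : S) : P := mmap (@mpolyC d k) gen p.
HB.instance Definition _ := GRing.RMorphism.copy pres (mmap (@mpolyC d k) gen).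

Definition expo (q : 'X_{1..N}) : 'X_{1..d} := (\big[+%MM/0%MM]_g (v g *+ q g))%MM.

Lemma presXn q : pres 'X_[q] = 'X_[expo q].
Proof.
rewrite /pres mmapX /mmap1 /expo.
rewrite (big_morph (fun mu => 'X_[mu] : P) (fun x y => @mpolyXD _ _ x y) (@mpolyX0 _ _)).
by apply: eq_bigr => g _; rewrite genE mpolyXn.
Qed.

Lemma presC c : pres c%:MP = c%:MP.
Proof. by rewrite /pres mmapC. Qed.

Lemma presX g p : pres ('X_g * p) = mulv v g (pres p).
Proof. by rewrite rmorphM /= {1}/pres mmapX mmap1U genE. Qed.

Lemma presE p : pres p = \sum_(q <- msupp p) p@_q *: 'X_[expo q].
Proof.
rewrite {1}(mpolyE p) rmorph_sum; apply: eq_bigr => q _.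
by rewrite -mul_mpolyC rmorphM /= presC presXn mul_mpolyC.
Qed.

Lemma msupp_pres p mu : mu \in msupp (pres p) -> exists2 q, q \in msupp p & mu = expo q.
Proof.
rewrite presE => h; apply: NNPP => nex; move: h; rewrite mcoeff_msupp => /negP; apply.
rewrite raddf_sum /= big_seq big1 // => q hq; rewrite mcoeffZ mcoeffX.
by case: eqP => [e|_]; rewrite ?mulr0 //; case: nex; exists q.
Qed.

Lemma wt_expo q : wt (expo q) = degz q.
Proof.
rewrite /expo (big_morph wt wtD (wt0 wtD)) /degz mdegE (big_morph Posz PoszD (erefl 0%Z)).
apply: eq_bigr => g _; elim: (q g) => [|c IH]; first by rewrite mulm0n (wt0 wtD).
by rewrite mulmS wtD IH wt_v.
Qed.

Lemma pres_homog e p : homogz e p -> wt_homog wt e (pres p).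
Proof. by move=> h mu /msupp_pres [q /h <- ->]; rewrite wt_expo. Qed.

Lemma semigroup_expo mu : semigroup v mu <-> exists q, mu = expo q.
Proof.
split=> [[c ->]|[q ->]]; last by exists q.
by exists [multinom c i | i < N]; rewrite /expo; apply: eq_bigr => g _; rewrite mnmE.
Qed.

Lemma pres_semigroup p : msupp_in (semigroup v) (pres p).
Proof. by move=> mu /msupp_pres [q _ ->]; apply/semigroup_expo; exists q. Qed.

Lemma pres_lift e z : msupp_in (semigroup v) z -> wt_homog wt e z ->
  exists2 p, homogz e p & pres p = z.
Proof.
move=> sz hz; rewrite (mpolyE z).
have : forall mu, mu \in msupp z -> semigroup v mu /\ wt mu = e by move=> mu h; split; [apply: sz|apply: hz].
elim: (msupp z) => [|mu s IH] h.
  exists 0; first by case: (@homogz_add k N e).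
  by rewrite raddf0 big_nil.
have [|p hp pE] := IH; first by move=> nu hs; apply: h; rewrite inE hs orbT.
have [/semigroup_expo [q qE] wmu] := h mu (mem_head _ _).
exists (z@_mu *: 'X_[q] + p).
  apply: (additive_predD (@homogz_add k N e)) => // nu; rewrite mcoeff_msupp mcoeffZ mcoeffX.
  by have [<- _|_] := eqVneq q nu; rewrite ?mulr0 ?eqxx // -wt_expo -qE.
by rewrite raddfD /= pE big_cons -mul_mpolyC rmorphM /= presC presXn mul_mpolyC -qE.
Qed.

(** The coefficient of [pres p] at mu collects only monomials of degree wt mu, so a graded component
    keeps or kills it as a whole. *)
Lemma pres_ker_graded e p : pres p = 0 -> pres (compz e p) = 0.
Proof.
move=> p0; apply/mpolyP=> mu; rewrite mcoeff0 /compz rmorph_sum raddf_sum /=.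
have E q : (pres (p@_q *: 'X_[q]))@_mu = p@_q * (expo q == mu)%:R.
  by rewrite -mul_mpolyC rmorphM /= presC presXn mcoeffCM mcoeffX.
rewrite (eq_bigr _ (fun q _ => E q)).
have [wmu|wmu] := eqVneq (wt mu) e; last first.
  apply: big1 => q /eqP hq; case: eqP => [eq|]; rewrite ?mulr0 //.
  by move: wmu; rewrite -eq wt_expo hq eqxx.
transitivity ((pres p)@_mu); last by rewrite p0 mcoeff0.
rewrite presE raddf_sum /= big_mkcond; apply: eq_bigr => q _; rewrite mcoeffZ mcoeffX.
case: ifP => // hq; case: eqP => [eq|]; rewrite ?mulr0 //.
by move: hq; rewrite -wt_expo eq wmu eqxx.
Qed.

Lemma pres_reg_of_resolution (r : nat)
  (F : graded_free_res k N (fun p => pres p == 0)) : res_reg_le F r ->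
  forall j e, r%:Z < e -> kexact (@mulv k d N v) (msupp_in (semigroup v)) (wt_homog wt) j e.
Proof.
move=> hF j e he.
exact: (kexact_of_resolution (pi := pres) presX pres_homog pres_semigroup pres_lift hF he).
Qed.

Lemma pres_resolution (r : nat) :
  (forall j e, r%:Z < e -> kexact (@mulv k d N v) (msupp_in (semigroup v)) (wt_homog wt) j e) ->
  exists F : graded_free_res k N (fun p => pres p == 0), res_reg_le F r.
Proof.
move=> hK; apply: (resolution_of_kexact (pi := pres) _ _ _ _ _ _ _ hK).
- exact: presX.
- exact: pres_homog.
- exact: pres_semigroup.
- exact: pres_lift.
- move=> c; rewrite /= presC => /(congr1 (fun p : P => p@_0%MM)).
  by rewrite mcoeffC mcoeff0 eqxx mulr1.
- by move=> s p h; rewrite [LHS](rmorphM pres) /= h mulr0.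
- exact: pres_ker_graded.
- exact: additive_msupp_in.
- exact: additive_wt_homog.
Qed.

(* A lattice point of the cone has a multiple in the semigroup, so its monomial is integral
   over the algebra. *)
Lemma normal_semigroup :
  normal_subring (fun f : P => exists p, pres p = f) ->
  (forall mu, exists nu nu', [/\ semigroup v nu, semigroup v nu' & (mu + nu')%MM = nu]) ->
  forall mu, conic (genmx v) setT (rowm mu) -> semigroup v mu.
Proof.
move=> norm grp mu [c [c0 cE]].
(* A common denominator of the c g, so that m times mu lies in the semigroup. *)
pose m := (\prod_g `|denq (c g)|)%N.
have m0 : (0 < m)%N by rewrite prodn_gt0 // => g; rewrite absz_gt0 denq_eq0.
have cm g : exists t : nat, m%:R * c g = t%:R.
  have [t ht] : exists t : nat, `|denq (c g)|%:R * c g = t%:R.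
    exists `|numq (c g)|%N; rewrite -{2}(divq_num_den (c g)) !natr_absz.
    rewrite !ger0_norm ?denq_ge0 ?numq_ge0 // mulrCA divff ?mulr1 //.
    by rewrite intr_eq0 denq_eq0.
  exists ((\prod_(h | h != g) `|denq (c h)|) * t)%N.
  by rewrite /m (bigD1 g) //= natrM mulrAC ht mulrC -natrM.
have [t ht] := fin_all_exists cm.
have mumE : (mu *+ m)%MM = (\big[+%MM/0%MM]_g (v g *+ t g))%MM.
  apply: rowm_inj; rewrite rowmMn cE rowm_sum scaler_sumr; apply: eq_big => g; first by rewrite inE.
  by rewrite row_genmx scalerA ht rowmMn.
have sgX nu : semigroup v nu -> exists p, pres p = 'X_[nu].
  by case/semigroup_expo=> q ->; exists 'X_[q]; rewrite presXn.
have [nu [nu' [s1 s2 E]]] := grp mu.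
have [] := norm (FracField.tofrac 'X_[mu]).
- exists 'X_[nu], 'X_[nu']; split; [exact: sgX | exact: sgX | by rewrite -msupp_eq0 msuppX | ].
  rewrite -E mpolyXD rmorphM /= mulfK //.
  by rewrite tofrac_eq0 -msupp_eq0 msuppX.
- exists ('X^m - ('X_[mu] ^+ m)%:P); split.
  + exact: monicXnsubC.
  + move=> i; rewrite coefB coefXn coefC.
    have [p1 h1] : exists p, pres p = (i == m)%:R by exists (i == m)%:R; rewrite rmorph_nat.
    have [p2 h2] : exists p, pres p = if i == 0%N then 'X_[mu] ^+ m else 0.
      case: ifP => _; last by exists 0; rewrite rmorph0.
      by rewrite mpolyXn mumE; apply: sgX; exists t.
    by exists (p1 - p2); rewrite rmorphB /= h1 h2.
  + rewrite rmorphB /= map_polyXn map_polyC /= rootE hornerD hornerN hornerXn hornerC.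
    by rewrite rmorphXn /= subrr.
move=> f [[p hp] /eqP]; rewrite tofrac_eq -hp => /eqP hX.
have : mu \in msupp ('X_[mu] : P) by rewrite msuppX inE.
by rewrite hX; apply: pres_semigroup.
Qed.

End Presentation.

(** * Interior points of the Rees cone and matchings *)

Section Matchings.
Variables (n : nat) (adj : rel 'I_n).
Hypothesis simpleG : simple_graph adj.
Implicit Types (e : {set 'I_n}) (T : {set 'I_n}).

Lemma edgeP e : e \in edges adj -> exists i j, [/\ adj i j, i != j & e = [set i; j]].
Proof.
rewrite inE => /existsP[i /existsP[j /andP[ij /eqP ->]]]; exists i, j; split=> //.
by apply: contraTneq ij => ->; case: simpleG => _ ->.
Qed.

Lemma card_edge e : e \in edges adj -> #|e| = 2.
Proof. by case/edgeP=> i [j [_ ij ->]]; rewrite cards2 ij. Qed.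

Lemma matching_trivIset Mt : is_matching adj Mt -> trivIset Mt.
Proof.
case/andP=> _ /forallP h; apply/trivIsetP => A B AM BM AB.
by have /implyP/(_ AM)/forallP/(_ B)/implyP/(_ BM)/implyP/(_ AB) := h A.
Qed.

Lemma matching_edges Mt e : is_matching adj Mt -> e \in Mt -> e \in edges adj.
Proof. by case/andP=> /subsetP h _ /h. Qed.

Lemma max_matching : exists2 Mt, is_matching adj Mt & #|Mt| = matching_number adj.
Proof.
rewrite /matching_number.
have [|Mt Mm ->] := @eq_bigmax_cond _ [pred Mt | is_matching adj Mt] (fun Mt => #|Mt|) _.
  apply/card_gt0P; exists set0; rewrite inE /is_matching sub0set /=.
  by apply/forallP=> A; rewrite inE.
by exists Mt.
Qed.

Lemma leq_matching Mt : is_matching adj Mt -> #|Mt| <= matching_number adj.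
Proof. by move=> h; apply: (@leq_bigmax_cond _ (is_matching adj) (fun Mt => #|Mt|)). Qed.

Lemma matching_set1 e : e \in edges adj -> is_matching adj [set e].
Proof.
move=> he; rewrite /is_matching sub1set he /=; apply/forallP=> A; apply/implyP=> /set1P ->.
by apply/forallP=> B; apply/implyP=> /set1P ->; rewrite eqxx.
Qed.

Lemma matching_number_gt0 e : e \in edges adj -> 0 < matching_number adj.
Proof. by move/matching_set1/leq_matching; rewrite cards1. Qed.

Local Open Scope ring_scope.

Lemma sum_cover (V : nmodType) Mt (w : 'I_n -> V) : is_matching adj Mt ->
  \sum_i w i = \sum_(e in Mt) \sum_(i in e) w i + \sum_(i | i \notin cover Mt) w i.
Proof.
by move=> Mm; rewrite (bigID (mem (cover Mt))) /= (big_trivIset _ (matching_trivIset Mm)).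
Qed.

Lemma card_cover Mt : is_matching adj Mt -> #|cover Mt| = (2 * #|Mt|)%N.
Proof.
move=> Mm; have /eqP <- := matching_trivIset Mm.
rewrite (eq_bigr (fun=> 2%N)); first by rewrite sum_nat_const mulnC.
by move=> e /(matching_edges Mm)/card_edge.
Qed.

Lemma card_uncovered Mt : is_matching adj Mt ->
  (\sum_(i | i \notin cover Mt) 1 = n%:Z - 2%:Z * (#|Mt|)%:Z)%R.
Proof.
move=> Mm; rewrite sumr_const natz.
have <- : #|~: cover Mt| = #|[pred i | i \notin cover Mt]|.
  by apply: eq_card => i; rewrite !inE.
have := cardsC (cover Mt); rewrite card_ord card_cover //; lia.
Qed.

Lemma sum_edge (V : nmodType) i j (w : 'I_n -> V) : i != j ->
  \sum_(h in [set i; j]) w h = w i + w j.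
Proof. by move=> ij; rewrite big_setU1 ?inE //= big_set1. Qed.

Definition ind (A : {set 'I_n}) i : int := (i \in A)%:Z.

Lemma sum_ind A : \sum_i ind A i = (#|A|)%:Z.
Proof.
rewrite -sum1_card (big_morph Posz PoszD (erefl 0%Z)) [RHS]big_mkcond /=.
by apply: eq_bigr => i _; rewrite /ind; case: (i \in A).
Qed.

(** An end in T puts the other end in N(T), whether or not T is independent. *)
Lemma ind_edge T i j : adj i j -> ind T i + ind T j <= ind (nbhd adj T) i + ind (nbhd adj T) j.
Proof.
move=> ij; have [sym _] := simpleG; rewrite /ind.
have h1 : i \in T -> j \in nbhd adj T by move=> iT; rewrite inE; apply/existsP; exists i; rewrite iT.
have h2 : j \in T -> i \in nbhd adj T by move=> jT; rewrite inE; apply/existsP; exists j; rewrite jT sym.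
move: h1 h2; case: (i \in T); case: (j \in T); case: (i \in nbhd adj T);
  case: (j \in nbhd adj T) => // h1 h2; first [by have := h1 isT | by have := h2 isT].
Qed.

(** A matching edge contributes at most 0 to |T| - |N(T)|, an uncovered vertex at most 1.
    Tutte-Berge graphs are thus the case of equality. *)
Lemma tutte_berge_leq T :
  (#|T|)%:Z <= (#|nbhd adj T|)%:Z + n%:Z - 2%:Z * (matching_number adj)%:Z.
Proof.
have [Mt Mm <-] := max_matching.
rewrite -!sum_ind -addrA -lerBlDl -(card_uncovered Mm) -sumrB (sum_cover _ Mm).
rewrite -[leRHS]add0r; apply: lerD.
  apply: sumr_le0 => e /(matching_edges Mm)/edgeP[i [j [ij nij ->]]]; rewrite sum_edge //.
  by have := ind_edge T ij; lia.
by apply: ler_sum => i _; rewrite /ind; case: (i \in T); case: (_ \in nbhd _ _).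
Qed.

(** * Functionals nonnegative on the Rees cone as weights: w on the x_i, s on t *)

Section Weights.
Variables (w : 'I_n -> rat) (s : rat).
Hypothesis w0 : forall i, 0 <= w i.
Hypothesis ws : forall e, e \in edges adj -> 0 <= \sum_(i in e) w i + s.
Hypothesis e0 : exists e, e \in edges adj.
Hypothesis pos : (exists i, 0 < w i) \/ exists2 e, e \in edges adj & 0 < \sum_(i in e) w i + s.

Lemma weights_zero : (forall i, w i = 0) -> s <= 0 -> False.
Proof.
move=> wz s0; case: pos => [[i]|[e _]]; first by rewrite wz ltxx.
by rewrite big1 ?add0r ?ltNge ?s0.
Qed.

Lemma weights_sum_ge0 : 0 <= \sum_i w i.
Proof. exact: sumr_ge0. Qed.

Lemma weights_sum_eq0 : \sum_i w i <= 0 -> forall i, w i = 0.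
Proof.
move=> h i; apply: (@psumr_eq0P rat 'I_n predT w) => //.
by apply/eqP; rewrite eq_le h weights_sum_ge0.
Qed.

Lemma matching_weight Mt : is_matching adj Mt ->
  (#|Mt|)%:R * - s <= \sum_(e in Mt) \sum_(i in e) w i.
Proof.
move=> Mm; rewrite mulrC -[(#|Mt|)%:R]sumr_const mulr_sumr.
by apply: ler_sum => e /(matching_edges Mm)/ws; rewrite mulr1 -subr_ge0 opprK.
Qed.

Lemma total_weight : (matching_number adj)%:R * - s <= \sum_i w i.
Proof.
have [Mt Mm <-] := max_matching; apply: le_trans (matching_weight Mm) _.
by rewrite (sum_cover _ Mm) lerDl; apply: sumr_ge0.
Qed.

(* The weights are tight on a maximum matching, so [w i < - s / 2] cuts out the set [T]. *)
Lemma weights_not_tutte_berge : ~ tutte_berge_graph adj ->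
  0 < \sum_i w i + (matching_number adj)%:R * s.
Proof.
move=> nTB; rewrite ltNge; apply/negP=> le.
have [e he] := e0; have nu0 := matching_number_gt0 he.
have nuR : (0 : rat) < (matching_number adj)%:R by rewrite ltr0n.
have [s0|s0] := leP 0 s.
  have wz : forall i, w i = 0.
    apply: weights_sum_eq0; apply: le_trans le; rewrite lerDl mulr_ge0 ?ler0n //.
  apply: (weights_zero wz); move: le; rewrite big1 ?add0r //.
  by rewrite pmulr_rle0.
have [Mt Mm cM] := max_matching.
have eqw := sum_cover w Mm.
have off_ge0 : 0 <= \sum_(i | i \notin cover Mt) w i by apply: sumr_ge0.
have onM := matching_weight Mm; rewrite cM in onM.
have off0 : \sum_(i | i \notin cover Mt) w i = 0 by lra.
have w_off i : i \notin cover Mt -> w i = 0.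
  by apply: (psumr_eq0P _ off0).
have tight : \sum_(e in Mt) (\sum_(i in e) w i + s) = 0.
  rewrite big_split /= sumr_const cM -mulr_natl; lra.
have w_on e' : e' \in Mt -> \sum_(i in e') w i + s = 0.
  by apply: (psumr_eq0P _ tight) => e1 /(matching_edges Mm)/ws.
(* Weights on a tight edge are symmetric about - s / 2, so it meets T and U in one vertex each or
   not at all; uncovered vertices have weight 0 and lie in T. Hence |T| - |U| = n - 2 nu, while N(T)
   lies in U. *)
pose T := [set i | w i < - s / 2]; pose U := [set i | - s / 2 < w i].
have indT : independent adj T.
  apply/forallP=> i; apply/implyP; rewrite inE => wi.
  apply/forallP=> j; apply/implyP; rewrite inE => wj; apply/negP=> ij.
  have nij : i != j by apply: contraTneq ij => ->; case: simpleG => _ ->.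
  have /ws : [set i; j] \in edges adj by rewrite inE; apply/existsP; exists i; apply/existsP; exists j; rewrite ij /=.
  rewrite sum_edge //; lra.
have NU : nbhd adj T \subset U.
  apply/subsetP=> j; rewrite !inE => /existsP[i /andP[]]; rewrite inE => wi ij.
  have nij : i != j by apply: contraTneq ij => ->; case: simpleG => _ ->.
  have /ws : [set i; j] \in edges adj by rewrite inE; apply/existsP; exists i; apply/existsP; exists j; rewrite ij /=.
  rewrite sum_edge //; lra.
apply: nTB; exists T; split=> //; apply/eqP; rewrite eq_le tutte_berge_leq /=.
have cNU : (#|nbhd adj T|)%:Z <= (#|U|)%:Z by rewrite lez_nat subset_leq_card.
suff E : (#|T|)%:Z - (#|U|)%:Z = n%:Z - 2%:Z * (matching_number adj)%:Z.
  by rewrite -addrA -E addrC -addrA gerDl addrC subr_le0.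
rewrite -!sum_ind -sumrB (sum_cover _ Mm) -cM -(card_uncovered Mm) big1 ?add0r.
  apply: eq_bigr => i /w_off wi; rewrite /ind !inE wi.
  have -> : (0 < - s / 2) by lra.
  by have /negPf -> : ~~ (- s / 2 < 0) by lra.
move=> e' eM; have := w_on e' eM; have /edgeP[i [j [_ nij ->]]] := matching_edges Mm eM.
rewrite !sum_edge // /ind !inE => h.
have [h1|h1|h1] := ltgtP (w i) (- s / 2).
- have -> : - s / 2 < w j by lra.
  by have /negPf -> : ~~ (w j < - s / 2) by lra.
- have -> : w j < - s / 2 by lra.
  by have /negPf -> : ~~ (- s / 2 < w j) by lra.
- have /negPf -> : ~~ (w j < - s / 2) by lra.
  by have /negPf -> : ~~ (- s / 2 < w j) by lra.
Qed.

(** For s < 0 the total weight is at least nu * - s, which exceeds (nu - 1) * - s. For s >= 0 the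
    factor nu - 1 has to be positive. *)
Lemma weights_pred_matching : (1 < matching_number adj)%N ->
  0 < \sum_i w i + (matching_number adj).-1%:R * s.
Proof.
move=> nu1; rewrite ltNge; apply/negP=> le.
have nuE : (matching_number adj)%:R = (matching_number adj).-1%:R + 1 :> rat.
  by rewrite natr1 prednK // ltnW.
have nuR : (0 : rat) < (matching_number adj).-1%:R by rewrite ltr0n -subn1 subn_gt0.
have [s0|s0] := leP 0 s.
  have wz : forall i, w i = 0.
    by apply: weights_sum_eq0; apply: le_trans le; rewrite lerDl mulr_ge0 ?ler0n.
  apply: (weights_zero wz); move: le; rewrite big1 ?add0r //.
  by rewrite pmulr_rle0.
have := total_weight; rewrite nuE; lra.
Qed.

(** Serves the case nu = 1: adding the inequalities of the two edges at c shows that for s < 0 the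
    value is at least - s. *)
Lemma weights_common_vertex c j1 j2 : [set c; j1] \in edges adj -> [set c; j2] \in edges adj ->
  c != j1 -> c != j2 -> j1 != j2 -> 0 < \sum_i w i + w c + s.
Proof.
move=> /ws h1 /ws h2 n1 n2 n12; rewrite sum_edge // in h1; rewrite sum_edge // in h2.
rewrite ltNge; apply/negP=> le; have wc := w0 c.
have [s0|s0] := leP 0 s.
  have wz : forall i, w i = 0 by apply: weights_sum_eq0; lra.
  by apply: (weights_zero wz); move: le; rewrite big1 // wz !add0r.
have : w c + w j1 + w j2 <= \sum_i w i.
  rewrite (bigD1 c) //= (bigD1 j1) 1?eq_sym //= (bigD1 j2) /=; last by rewrite ![j2 == _]eq_sym n2 n12.
  by rewrite !addrA lerDl; apply: sumr_ge0.
lra.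
Qed.
End Weights.

End Matchings.

Section SemigroupClosure.
Variables (d N : nat) (v : 'I_N -> 'X_{1..d}).

Lemma semigroup0 : semigroup v 0%MM.
Proof. by exists (fun=> 0%N); rewrite big1 // => g _; rewrite mulm0n. Qed.

Lemma semigroupD mu nu : semigroup v mu -> semigroup v nu -> semigroup v (mu + nu)%MM.
Proof.
case=> [c ->] [c' ->]; exists (fun g => c g + c' g)%N; rewrite -big_split /=.
by apply: eq_bigr => g _; apply/mnmP=> i; rewrite mnmDE !mulmnE mulnDr.
Qed.

Lemma semigroup_gen g : semigroup v (v g).
Proof.
exists (fun h => (h == g : nat)); rewrite (bigD1 g) //= eqxx mulm1n big1 ?addm0 // => h /negPf ->.
by rewrite mulm0n.
Qed.

Lemma semigroupMn mu c : semigroup v mu -> semigroup v (mu *+ c)%MM.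
Proof.
move=> h; elim: c => [|c IH]; first by rewrite mulm0n; apply: semigroup0.
by rewrite mulmS; apply: semigroupD.
Qed.

Lemma semigroup_sum (I : Type) (r : seq I) (P : pred I) F :
  (forall i, P i -> semigroup v (F i)) ->
  semigroup v (\big[+%MM/0%MM]_(i <- r | P i) F i)%MM.
Proof.
move=> h; apply: (big_ind (semigroup v)) => //; [exact: semigroup0 | exact: semigroupD].
Qed.
End SemigroupClosure.

(** * The Rees cone and its interior lattice points *)

Section ReesExponents.
Local Open Scope ring_scope.
Variables (k : fieldType) (n : nat) (adj : rel 'I_n).
Hypothesis simpleG : simple_graph adj.
Hypothesis edge2 : (2 <= #|edges adj|)%N.
Local Notation wid := (widen_ord (leqnSn n)).
Local Notation N := (n + nedges adj)%N.

Definition edge_expo (e : {set 'I_n}) : 'X_{1..n.+1} :=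
  (\big[+%MM/0%MM]_(i in e) U_(wid i) + U_(ord_max))%MM.
Definition rees_expo (g : 'I_N) : 'X_{1..n.+1} :=
  match split g with inl i => U_(wid i)%MM | inr e => edge_expo (enum_val e) end.

Lemma rees_genE g : rees_gen k g = 'X_[rees_expo g].
Proof.
rewrite /rees_gen /rees_expo; case: (split g) => // e; rewrite /edge_mon /edge_expo mpolyXD.
congr (_ * _).
by rewrite (big_morph (fun mu => 'X_[mu] : {mpoly k[n.+1]}) (fun x y => @mpolyXD _ _ x y) (@mpolyX0 _ _)).
Qed.

Lemma rees_expo_vertex i : rees_expo (lshift _ i) = U_(wid i)%MM.
Proof. by rewrite /rees_expo (unsplitK (inl i)). Qed.

Lemma rees_expo_edge e : rees_expo (rshift _ e) = edge_expo (enum_val e).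
Proof. by rewrite /rees_expo (unsplitK (inr e)). Qed.

Lemma rees_expo_edgeP e : e \in edges adj -> exists g, rees_expo g = edge_expo e.
Proof. by move=> he; exists (rshift _ (enum_rank_in he e)); rewrite rees_expo_edge enum_rankK_in. Qed.

Lemma exists_edge : exists e, e \in edges adj.
Proof. by apply/set0Pn; rewrite -card_gt0 (leq_trans _ edge2). Qed.

Lemma pairing_wid y f :
  pairing y f = \sum_(i < n) y 0 (wid i) * f (wid i) 0 + y 0 ord_max * f ord_max 0.
Proof. by rewrite /pairing mxE big_ord_recr. Qed.

Lemma pairing_U i (f : 'cV[rat]_n.+1) : pairing (rowm U_(i)%MM) f = f i 0.
Proof.
rewrite /pairing mxE (bigD1 i) //= mxE mnm1E eqxx mul1r big1 ?addr0 // => j ji.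
by rewrite mxE mnm1E eq_sym (negPf ji) mul0r.
Qed.

Lemma pairing_edge e f :
  pairing (rowm (edge_expo e)) f = \sum_(i in e) f (wid i) 0 + f ord_max 0.
Proof.
rewrite /edge_expo rowmD pairingDl pairing_U rowm_sum pairing_suml; congr (_ + _).
by apply: eq_bigr => i _; rewrite pairing_U.
Qed.

(** The standard grading: t counts -1, so that x_i and x_i x_j t both have degree 1. *)
Definition wtR (mu : 'X_{1..n.+1}) : int := \sum_(i < n) (mu (wid i))%:Z - (mu ord_max)%:Z.
Definition wtRf : 'cV[rat]_n.+1 := \col_i (if i == ord_max then -1 else 1).

Lemma wid_neq_max i : (wid i == ord_max) = false.
Proof. by rewrite -val_eqE /= ltn_eqF. Qed.

Lemma pairing_wtRf y : pairing y wtRf = \sum_(i < n) y 0 (wid i) - y 0 ord_max.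
Proof.
rewrite pairing_wid; congr (_ + _); last by rewrite mxE eqxx mulrN1.
by apply: eq_bigr => i _; rewrite mxE wid_neq_max mulr1.
Qed.

Lemma wtRfE mu : pairing (rowm mu) wtRf = (wtR mu)%:~R.
Proof.
rewrite pairing_wtRf /wtR rmorphB /= rmorph_sum /= mxE; congr (_ - _).
by apply: eq_bigr => i _; rewrite mxE.
Qed.

Lemma wtRD mu nu : wtR (mu + nu)%MM = wtR mu + wtR nu.
Proof.
apply: (@intr_inj rat); have := wtRfE (mu + nu)%MM.
by rewrite rowmD pairingDl !wtRfE -intrD => ->.
Qed.

Lemma wtR_expo g : wtR (rees_expo g) = 1.
Proof.
apply: (@intr_inj rat); rewrite -wtRfE /rees_expo; case: (split g) => [i|e].
  by rewrite pairing_U mxE wid_neq_max.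
rewrite pairing_edge mxE eqxx (eq_bigr (fun=> 1)); last by move=> i _; rewrite mxE wid_neq_max.
by rewrite sumr_const (card_edge simpleG (enum_valP e)).
Qed.

Lemma rank_rees : \rank (span_mx (genmx rees_expo) setT) = n.+1.
Proof.
apply/eqP; rewrite -[_ == _]/(row_full _) -sub1mx; apply/row_subP=> i.
have -> : row i 1%:M = rowm U_(i)%MM.
  by apply/rowP=> j; rewrite !mxE mnm1E.
have hv j : (rowm U_(wid j)%MM <= span_mx (genmx rees_expo) setT)%MS.
  by rewrite -rees_expo_vertex -row_genmx row_span_mx ?inE.
have [->|im] := eqVneq i ord_max; last first.
  have ilt : (i < n)%N by move: (ltn_ord i) im; rewrite ltnS leq_eqVlt -val_eqE /= => /orP[/eqP ->|//]; rewrite eqxx.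
  have -> : i = wid (Ordinal ilt) by apply: val_inj.
  exact: hv.
have [e /rees_expo_edgeP[g gE]] := exists_edge.
have -> : rowm U_(ord_max)%MM = row g (genmx rees_expo) - \sum_(i in e) rowm U_(wid i)%MM.
  by rewrite row_genmx gE /edge_expo rowmD rowm_sum addrC addKr.
rewrite addmx_sub ?row_span_mx ?inE // eqmx_opp; apply: summx_sub => j _; exact: hv.
Qed.

(** Needed to place monomials in the fraction field: multiplying by the b-th power of the product of
    the x_i in e turns t^b into a power of an edge generator. *)
Lemma rees_group mu : exists nu nu', [/\ semigroup rees_expo nu, semigroup rees_expo nu' &
  (mu + nu')%MM = nu].
Proof.
have [e he] := exists_edge; have [g gE] := rees_expo_edgeP he.
have hU i : semigroup rees_expo U_(wid i)%MM.
  by rewrite -rees_expo_vertex; apply: semigroup_gen.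
pose b := mu ord_max.
pose E := (\big[+%MM/0%MM]_(i in e) U_(wid i))%MM.
pose X := (\big[+%MM/0%MM]_(i < n) (U_(wid i) *+ mu (wid i)))%MM.
exists (X + edge_expo e *+ b)%MM, (E *+ b)%MM; split.
- apply: semigroupD; first by apply: semigroup_sum => i _; apply: semigroupMn.
  by apply: semigroupMn; rewrite -gE; apply: semigroup_gen.
- by apply: semigroupMn; apply: semigroup_sum => i _.
have {1}-> : mu = (X + U_(ord_max) *+ b)%MM.
  have key f : pairing (rowm mu) f = pairing (rowm (X + U_(ord_max) *+ b)%MM) f.
    rewrite pairing_wid rowmD rowmMn pairingDl pairingZl pairing_U rowm_sum pairing_suml mxE.
    by congr (_ + _); apply: eq_bigr => i _; rewrite mxE rowmMn pairingZl pairing_U.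
  by apply: rowm_inj; apply/rowP=> j; rewrite -[LHS]pairing_delta key pairing_delta.
apply/mnmP=> j; rewrite /edge_expo -/E !mnmDE !mulmnE mnmDE mulnDl; lia.
Qed.

Lemma rees_semigroup : normal_subring (rees_algebra k adj) ->
  forall mu, conic (genmx rees_expo) setT (rowm mu) -> semigroup rees_expo mu.
Proof. move=> norm; exact: (normal_semigroup rees_genE norm rees_group). Qed.

Lemma interior_rees (y : 'rV[rat]_n.+1) :
  (forall (w : 'I_n -> rat) s, (forall i, 0 <= w i) ->
     (forall e, e \in edges adj -> 0 <= \sum_(i in e) w i + s) ->
     (exists i, 0 < w i) \/ (exists2 e, e \in edges adj & 0 < \sum_(i in e) w i + s) ->
     0 < \sum_(i < n) y 0 (wid i) * w i + y 0 ord_max * s) ->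
  interior (genmx rees_expo) y.
Proof.
move=> h f f0 [g fg]; rewrite pairing_wid; apply: h.
- by move=> i; have := f0 (lshift _ i); rewrite row_genmx rees_expo_vertex pairing_U.
- move=> e /rees_expo_edgeP[g' g'E]; have := f0 g'.
  by rewrite row_genmx g'E pairing_edge.
- move: fg; rewrite row_genmx /rees_expo; case: (split g) => [i|e].
    by rewrite pairing_U => ?; left; exists i.
  by rewrite pairing_edge => ?; right; exists (enum_val e) => //; apply: enum_valP.
Qed.

(** [insub] fails exactly at the last index, that of t, where the default b is taken. *)
Definition mkpt (a : 'I_n -> nat) (b : nat) : 'X_{1..n.+1} :=
  [multinom oapp a b (insub (val i)) | i < n.+1].

Lemma mkpt_wid a b i : mkpt a b (wid i) = a i.
Proof. by rewrite mnmE /= valK. Qed.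

Lemma mkpt_max a b : mkpt a b ord_max = b.
Proof. by rewrite mnmE insubF //= ltnn. Qed.

Lemma wtR_mkpt a b : wtR (mkpt a b) = \sum_i (a i)%:Z - b%:Z.
Proof.
by rewrite /wtR mkpt_max; congr (_ - _); apply: eq_bigr => i _; rewrite mkpt_wid.
Qed.

Lemma interior_not_tutte_berge : ~ tutte_berge_graph adj ->
  interior (genmx rees_expo) (rowm (mkpt (fun=> 1%N) (matching_number adj))).
Proof.
move=> nTB; apply: interior_rees => w s w0 ws pos.
rewrite (eq_bigr w); last by move=> i _; rewrite mxE mkpt_wid mul1r.
rewrite mxE mkpt_max; exact: (weights_not_tutte_berge simpleG w0 ws exists_edge pos nTB).
Qed.

(** For nu >= 2 the point is x_1 ... x_n t^(nu - 1). For nu = 1 any two edges meet, and it is x_1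
    ... x_n x_c t with c common to two edges. *)
Lemma interior_point : exists mu, interior (genmx rees_expo) (rowm mu) /\
  wtR mu = n.+1%:Z - (matching_number adj)%:Z.
Proof.
have [e he] := exists_edge; have nu0 := matching_number_gt0 he.
have [nu1|nu1] := ltnP 1 (matching_number adj).
  exists (mkpt (fun=> 1%N) (matching_number adj).-1); split; last first.
    by rewrite wtR_mkpt sumr_const card_ord -[1%:Z *+ n]/(1 *+ n) natz; lia.
  apply: interior_rees => w s w0 ws pos.
  rewrite (eq_bigr w); last by move=> i _; rewrite mxE mkpt_wid mul1r.
  rewrite mxE mkpt_max; exact: (weights_pred_matching w0 ws pos nu1).
have [e1 [e2 [he1 he2 ne]]] : exists e1 e2, [/\ e1 \in edges adj, e2 \in edges adj & e1 != e2].
  by have /card_gt1P[e1 [e2 [h1 h2 h3]]] := edge2; exists e1, e2.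
have : ~~ [disjoint e1 & e2].
  apply/negP=> dis; have : is_matching adj [set e1; e2].
    apply/andP; split; first by apply/subsetP=> A /set2P[] ->.
    apply/forallP=> A; apply/implyP=> hA; apply/forallP=> B; apply/implyP=> hB.
    apply/implyP=> AB; move: AB; case/set2P: hA => ->; case/set2P: hB => ->; rewrite ?eqxx //.
    by rewrite disjoint_sym.
  by move/leq_matching; rewrite cards2 ne => h; have := leq_trans h nu1.
rewrite -setI_eq0 => /set0Pn[c]; rewrite inE => /andP[c1 c2].
have other e' : e' \in edges adj -> c \in e' -> exists2 j, c != j & e' = [set c; j].
  case/(edgeP simpleG)=> i [j [_ ij ->]]; rewrite !inE => /orP[] /eqP ->; first by exists j.
  by exists i; rewrite 1?eq_sym // setUC.
have [j1 n1 E1] := other _ he1 c1; have [j2 n2 E2] := other _ he2 c2.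
have n12 : j1 != j2 by apply: contraNneq ne => E; rewrite E1 E2 E.
exists (mkpt (fun i => 1 + (i == c))%N 1); split; last first.
  have sum_c : \sum_i (i == c)%:Z = 1%Z.
    by rewrite (bigD1 c) //= eqxx big1 // => i /negPf ->.
  rewrite wtR_mkpt (eq_bigr (fun i => 1 + (i == c)%:Z)); last by move=> i _; rewrite PoszD.
  rewrite big_split /= sum_c sumr_const card_ord natz; lia.
apply: interior_rees => w s w0 ws pos.
rewrite (eq_bigr (fun i => w i + (i == c)%:R * w i)); last first.
  by move=> i _; rewrite mxE mkpt_wid natrD mulrDl mul1r.
have sum_c : \sum_(i < n) (i == c)%:R * w i = w c.
  by rewrite (bigD1 c) //= eqxx mul1r big1 ?addr0 // => i /negPf ->; rewrite mul0r.
rewrite big_split /= sum_c mxE mkpt_max mul1r.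
by apply: (weights_common_vertex w0 ws pos _ _ n1 n2 n12); rewrite -?E1 -?E2.
Qed.

Lemma interior_tutte_berge (y : 'rV[rat]_n.+1) : tutte_berge_graph adj ->
  (forall i, y 0 i \is a Num.int) -> interior (genmx rees_expo) y ->
  n.+1%:R - (matching_number adj)%:R <= pairing y wtRf.
Proof.
case=> T [indT cT] yint yin.
(* Coordinates are functionals nonnegative on the cone, hence positive at y, and they are
   integers. *)
have y1 i : 1 <= y 0 (wid i).
  have : 0 < y 0 (wid i).
    rewrite -pairing_delta; apply: yin => [g|].
      by rewrite pairing_delta !mxE ler0n.
    exists (lshift _ i); rewrite row_genmx rees_expo_vertex pairing_delta mxE mnm1E eqxx.
    exact: ltr01.
  have /intrP[z ->] := yint (wid i); rewrite (ltr_int _ 0) (ler_int _ 1); lia.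
(* The facet functional of the Rees cone attached to the independent set [T]. *)
pose c i : int := 1 + ind (nbhd adj T) i - ind T i.
pose f : 'cV[rat]_n.+1 := \col_i oapp (fun j => (c j)%:~R) (- 2) (insub (val i)).
have fw i : f (wid i) 0 = (c i)%:~R by rewrite mxE /= valK.
have fm : f ord_max 0 = - 2 by rewrite mxE insubF //= ltnn.
have cge0 i : 0 <= c i.
  by rewrite /c /ind; case: (i \in T); case: (i \in nbhd adj T).
have fpos : 0 < pairing y f.
  apply: yin => [g|].
    rewrite row_genmx /rees_expo; case: (split g) => [i|e].
      by rewrite pairing_U fw ler0z.
    rewrite pairing_edge fm; have [i [j [ij nij ->]]] := edgeP simpleG (enum_valP e).
    rewrite sum_edge // !fw subr_ge0 -rmorphD /= (ler_int _ 2).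
    have := ind_edge simpleG T ij; rewrite /c; lia.
  have [e he] := exists_edge; have [i [j [ij nij eE]]] := edgeP simpleG he.
  have [l lT] : exists l, l \notin T.
    have [iT|] := boolP (i \in T); last by exists i.
    exists j; apply/negP=> jT.
    by have /forallP/(_ i)/implyP/(_ iT)/forallP/(_ j)/implyP/(_ jT)/negP := indT.
  exists (lshift _ l); rewrite row_genmx rees_expo_vertex pairing_U fw ltr0z.
  by rewrite /c /ind (negPf lT); case: (l \in nbhd adj T).
have [z yz] : exists z : 'I_n.+1 -> int, forall i, y 0 i = (z i)%:~R.
  apply: (@fin_all_exists _ _ (fun i (z : int) => y 0 i = z%:~R)) => i.
  by have /intrP[z ->] := yint i; exists z.
have z1 i : 1 <= z (wid i) by have := y1 i; rewrite yz (ler_int _ 1).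
(* The coefficients c i here and those in [F2] add up to 2, so twice the degree of y is at least 1 +
   n - |N(T)| + |T| = 2 (n - nu) + 1. Integrality rounds n - nu + 1/2 up to n + 1 - nu. *)
have F1 : 0 < \sum_i z (wid i) * c i - 2 * z ord_max.
  rewrite -(ltr0z rat) rmorphB rmorph_sum /=; move: fpos; rewrite pairing_wid fm.
  rewrite yz mulrN mulrC rmorphM /=; congr (_ < _ - _).
  by apply: eq_bigr => i _; rewrite yz fw rmorphM.
have F2 : \sum_i (1 - ind (nbhd adj T) i + ind T i) <=
    \sum_i z (wid i) * (1 - ind (nbhd adj T) i + ind T i).
  apply: ler_sum => i _; rewrite ler_peMl //.
  by rewrite /ind; case: (i \in T); case: (i \in nbhd adj T).
have F3 : \sum_i (1 - ind (nbhd adj T) i + ind T i) = n%:Z - (#|nbhd adj T|)%:Z + (#|T|)%:Z.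
  by rewrite big_split /= sumrB !sum_ind sumr_const card_ord natz.
have F4 : \sum_i z (wid i) * (1 - ind (nbhd adj T) i + ind T i) +
    \sum_i z (wid i) * c i = 2 * \sum_i z (wid i).
  rewrite -big_split mulr_sumr; apply: eq_bigr => i _; rewrite /c /=; ring.
rewrite pairing_wtRf (eq_bigr (fun i => (z (wid i))%:~R)); last by move=> i _; rewrite yz.
rewrite yz -rmorph_sum -rmorphB /=.
have -> : n.+1%:R - (matching_number adj)%:R = (n.+1%:Z - (matching_number adj)%:Z)%:~R :> rat.
  by rewrite rmorphB.
rewrite ler_int; move: cT F1 F2 F3 F4.
set A := \sum_i _; set B := \sum_i z (wid i) * c i; set C := \sum_i _; set D := \sum_i z (wid i).
lia.
Qed.

End ReesExponents.

Theorem theorem1p2 (k : fieldType) (n : nat) (adj : rel 'I_n) :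
  simple_graph adj ->
  2 <= #|edges adj| ->
  normal_subring (rees_algebra k adj) ->
  (cm_regularity_eq (rees_ideal k adj) (matching_number adj)
   <-> tutte_berge_graph adj).
Proof.
move=> simpleG edge2 norm.
have rk := rank_rees edge2.
have sg := rees_semigroup edge2 norm.
have wD := @wtRD n.
have w1 := wtR_expo simpleG.
have wf := @wtRfE n.
have lower (F : graded_free_res k (n + nedges adj) (rees_ideal k adj)) r mu :
    res_reg_le F r -> interior (genmx (rees_expo (adj := adj))) (rowm mu) ->
    (n.+1%:Z - r%:Z <= wtR mu)%R.
  move=> /(pres_reg_of_resolution (@rees_genE k n adj) wD w1) hK.
  exact: (toric_reg_lower rk sg wD w1 wf (ltn0Sn n) hK).
split=> [[[F hF] _]|TB].
  (* The interior point x_1 ... x_n t^nu has degree n - nu, below the bound n + 1 - nu that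
     regularity nu imposes. *)
  apply: NNPP => nTB.
  have := lower F _ _ hF (interior_not_tutte_berge simpleG edge2 nTB).
  rewrite wtR_mkpt sumr_const card_ord -[(1%:Z *+ n)%R]/((1 *+ n)%R) natz; lia.
split; last first.
  move=> F r hF; have [mu [int_mu wmu]] := interior_point simpleG edge2.
  by have := lower F r mu hF int_mu; rewrite wmu; lia.
apply: (pres_resolution (@rees_genE k n adj) wD w1).
apply: (toric_reg_upper rk sg wD w1 wf) => y yint int.
exact: interior_tutte_berge.
Qed.
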